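(* Let $n\ge 2$, $1<p<\infty$, $n<q\le\infty$, and let $\Omega\subset\mathbb{R}^n$ be a bounded Lipschitz domain, $U\Subset\Omega$ a Lipschitz subdomain, and $f\in C^\infty(\Omega)$. Let $\{E^\epsilon\}_{0<\epsilon\le1}\subset C^\infty(\mathbb{R}^n)$ be a family of strictly convex functions for which there are constants $0<C_1\le C_2<\infty$, independent of $\epsilon$, such that $$C_1(\epsilon^2+|z_0|^2)^{p/2-1}|\zeta|^2\le\langle\nabla_z^2E^\epsilon(z_0)\zeta\mid\zeta\rangle,\qquad |\langle\nabla_z^2E^\epsilon(z_0)\zeta\mid\omega\rangle|\le C_2(\epsilon^2+|z_0|^2)^{p/2-1}|\zeta||\omega|$$ for all $0<\epsilon\le 1$ and all $z_0,\zeta,\omega\in\mathbb{R}^n$ with $|z_0|\ge1$. For $0<\epsilon\le1$ let $u^\epsilon\in C^\infty(U)$ be a classical solution to $$-\mathrm{div}\,\nabla_zE^\epsilon(\nabla u^\epsilon)=f\quad\text{in }U.$$ (1) If $n\ge3$, then for any closed ball $B_R\subset U$ with $0<R\le1$ and any $0<\theta<1$, $$\sup_{B_{\theta R}}|\nabla u^\epsilon|\le\frac{C(n,p,q,C_1,C_2)}{(1-\theta)^{n/p}}\left(1+\|f\|_{L^q(B_R)}^{1/(p-1)}+R^{-n/p}\|\nabla u^\epsilon\|_{L^p(B_R)}\right).$$ (2) If $n=2$, then for each fixed $1<\chi<\infty$, for any closed ball $B_R\subset U$ with $0<R\le1$ and any $0<\theta<1$, $$\sup_{B_{\theta R}}|\nabla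 u^\epsilon|\le\frac{C(p,q,\chi,C_1,C_2)}{(1-\theta)^{\frac{2\chi}{p(\chi-1)}}}\left(1+\|f\|_{L^q(B_R)}^{1/(p-1)}+R^{-2/p}\|\nabla u^\epsilon\|_{L^p(B_R)}\right).$$ In both cases the constant $C$ depends only on the indicated quantities (in particular not on $\epsilon$).
   Context: $\langle\cdot\mid\cdot\rangle$ is the canonical inner product on $\mathbb{R}^n$; $\nabla_z^2E^\epsilon$ is the Hessian matrix of $E^\epsilon$; $B_{\theta R}$ is the closed ball of radius $\theta R$ with the same center as $B_R$. *)

(* Defs.v *)
From HB Require Import structures.
From mathcomp Require Import all_boot all_order all_algebra.
From mathcomp Require Import all_classical all_reals all_analysis.

Set Implicit Arguments.
Unset Strict Implicit.
Unset Printing Implicit Defensive.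

Import Order.TTheory GRing.Theory Num.Theory.
Import numFieldNormedType.Exports.

Local Open Scope classical_set_scope.
Local Open Scope ring_scope.

(** Points of R^n are row vectors ['rV[R]_n].  MathComp's canonical norm on
    this type is the sup norm: it induces the usual topology, but lengths and
    balls below are Euclidean. *)

Section euclidean.
Context {R : realType} {n : nat}.
Implicit Types (x y : 'rV[R]_n).

Definition dot x y : R := \sum_(i < n) x 0 i * y 0 i.

Definition enorm x : R := Num.sqrt (dot x x).

Definition closed_eball (c : 'rV[R]_n) (r : R) : set 'rV[R]_n :=
  [set x | enorm (x - c) <= r].

End euclidean.

Section calculus.
Context {R : realType} {n : nat}.
Implicit Types (f : 'rV[R]_n -> R) (V : 'rV[R]_n -> 'rV[R]_n) (x : 'rV[R]_n).

Definition partial (i : 'I_n) f : 'rV[R]_n -> R := 'D_(delta_mx 0 i) f.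

Definition iter_partial (s : seq 'I_n) f : 'rV[R]_n -> R := foldr partial f s.

(** For open [A] only: the functions are total, and their values outside [A]
    are irrelevant because partial derivatives at points of [A] are local. *)
Definition smooth_on (A : set 'rV[R]_n) f : Prop :=
  forall (s : seq 'I_n) x, A x ->
    {for x, continuous (iter_partial s f)} /\
    forall i, derivable (iter_partial s f) x (delta_mx 0 i).

Definition grad f x : 'rV[R]_n := \row_i partial i f x.

Definition hessian f x : 'M[R]_n := \matrix_(i, j) partial i (partial j f) x.

(** [<A zeta | omega>], with [A] acting on [zeta] seen as a column vector. *)
Definition mx_form (A : 'M[R]_n) (zeta omega : 'rV[R]_n) : R :=
  dot (zeta *m A^T) omega.

Definition divergence V x : R := \sum_(i < n) partial i (fun y => V y 0 i) x.

Definition strictly_convex f : Prop :=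
  forall x y (t : R), x != y -> 0 < t < 1 ->
    f (t *: x + (1 - t) *: y) < t * f x + (1 - t) * f y.

End calculus.

Section domains.
Context {R : realType} {n : nat}.
Implicit Types (A B : set 'rV[R]_n).

Definition is_domain A : Prop := [/\ A !=set0, open A & connected A].

Definition lipschitz_fun m (g : 'rV[R]_m -> R) : Prop :=
  exists L : R, forall y z, `|g y - g z| <= L * enorm (y - z).

(** Near each boundary point, after an orthogonal change of coordinates [O],
    [A] is the part of a ball lying strictly above a Lipschitz graph: the
    [k]-th coordinate is the height, and [col' k] deletes it.  For open [A] the
    boundary is [closure A `\` A]. *)
Definition lipschitz_boundary A : Prop :=
  forall x0, (closure A `\` A) x0 ->
    exists (r : R) (O : 'M[R]_n) (k : 'I_n) (g : 'rV[R]_n.-1 -> R),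
      [/\ 0 < r, O *m O^T = 1%:M, lipschitz_fun g &
        forall x, closed_eball x0 r x ->
          (A x <-> g (col' k (x *m O)) < (x *m O) 0 k)].

Definition bounded_lipschitz_domain A : Prop :=
  [/\ is_domain A, bounded_set A & lipschitz_boundary A].

Definition compactly_contained A B : Prop :=
  compact (closure A) /\ closure A `<=` B.

End domains.

(** Lebesgue measure on R^n, as an iterated product.  The product sigma-algebra
    is available on [n.-tuple R]; [tuple_to_row] transports functions on
    ['rV[R]_n] to it. *)
Section lebesgue_tuple.
Context {R : realType}.

Definition cons_pair n (z : measurableTypeR R * n.-tuple (measurableTypeR R)) :
  n.+1.-tuple (measurableTypeR R) := [tuple of z.1 :: z.2].

Lemma measurable_cons_pair n : measurable_fun setT (@cons_pair n).
Proof. by apply: measurable_cons; [exact: measurable_fst|exact: measurable_snd]. Qed.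

Definition lebesgue_cons n
    (m : {measure set (n.-tuple (measurableTypeR R)) -> \bar R}) :
    {measure set (n.+1.-tuple (measurableTypeR R)) -> \bar R} :=
  measure_function_pushforward__canonical__measure_function_Measure
    (lebesgue_measure \x^ m)%E (@measurable_cons_pair n).

Fixpoint lebesgue_tuple n :
    {measure set (n.-tuple (measurableTypeR R)) -> \bar R} :=
  if n is n'.+1 then lebesgue_cons (lebesgue_tuple n') else \d_ [tuple].

Lemma lebesgue_tuple_box n (A : 'I_n -> set (measurableTypeR R)) :
  (forall i, measurable (A i)) ->
  lebesgue_tuple n [set t | forall i, A i (tnth t i)]
  = (\prod_(i < n) lebesgue_measure (A i))%E.
Proof.
elim: n A => [|n IH] A mA.
  rewrite big_ord0 /= diracE mem_set//.
  by case.
rewrite /= /pushforward /=.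
set Y := [set t : n.-tuple (measurableTypeR R) |
  forall i, A (lift ord0 i) (tnth t i)].
have -> : @cons_pair n @^-1` [set t | forall i, A i (tnth t i)] = A ord0 `*` Y.
  apply/seteqP; split=> [z /= Az|z /= [A0 AY] i].
    split; first exact: (Az ord0).
    by move=> i; have := Az (lift ord0 i); rewrite /cons_pair tnthS.
  case: (unliftP ord0 i) => [j ->|->]; last exact: A0.
  by rewrite /cons_pair tnthS; exact: AY.
have mY : measurable Y.
  rewrite (_ : Y = \bigcap_(i in [set: 'I_n])
    ((fun t => tnth t i) @^-1` A (lift ord0 i))); last first.
    by apply/seteqP; split=> [t h i _|t h i]; [exact: h|exact: (h i I)].
  apply: fin_bigcap_measurable => [|i _]; first exact: finite_finset.
  rewrite -[X in measurable X]setTI.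
  by apply: measurable_tnth => //; exact: mA.
have YE : lebesgue_tuple n Y =
    (\prod_(i < n) lebesgue_measure (A (lift ord0 i)))%E.
  by apply: IH => i; exact: mA.
by rewrite product_measure2E// YE big_ord_recl.
Qed.

Definition tuple_to_row n (t : n.-tuple R) : 'rV[R]_n := \row_i tnth t i.

End lebesgue_tuple.

(** The norm of [g] in [L^s(B)], with [s] possibly infinite. *)
Definition Lnorm_on {R : realType} {n : nat} (B : set 'rV[R]_n) (s : \bar R)
    (g : 'rV[R]_n -> R) : \bar R :=
  Lnorm (@lebesgue_tuple R n) s (EFin \o (g \_ B) \o @tuple_to_row R n).

Section problem.
Context {R : realType} {n : nat}.
Implicit Types (E u : R -> 'rV[R]_n -> R).

(** Families are indexed by all of [R]; only [0 < eps <= 1] is constrained. *)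
Definition regularized_energies (p C1 C2 : R) E : Prop :=
  forall eps, 0 < eps <= 1 ->
    [/\ smooth_on setT (E eps),
        strictly_convex (E eps),
        forall z0 zeta, 1 <= enorm z0 ->
          C1 * (eps ^+ 2 + enorm z0 ^+ 2) `^ (p / 2 - 1) * enorm zeta ^+ 2
          <= mx_form (hessian (E eps) z0) zeta zeta &
        forall z0 zeta omega, 1 <= enorm z0 ->
          `|mx_form (hessian (E eps) z0) zeta omega|
          <= C2 * (eps ^+ 2 + enorm z0 ^+ 2) `^ (p / 2 - 1)
             * enorm zeta * enorm omega].

Definition classical_solutions (U : set 'rV[R]_n) (f : 'rV[R]_n -> R) E u :
    Prop :=
  forall eps, 0 < eps <= 1 ->
    smooth_on U (u eps) /\
    forall x, U x ->
      - divergence (fun y => grad (E eps) (grad (u eps) y)) x = f x.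

End problem.

Definition sup_grad {R : realType} {n : nat} (B : set 'rV[R]_n)
    (v : 'rV[R]_n -> R) : \bar R :=
  ereal_sup [set (enorm (grad v x))%:E | x in B].

(* Main.v *)
Require Import Defs.
From HB Require Import structures.
From mathcomp Require Import all_boot all_order all_algebra.
From mathcomp Require Import all_classical all_reals all_analysis.
From mathcomp Require Import measurable_realfun ess_sup_inf ring lra.

Set Implicit Arguments.
Unset Strict Implicit.
Unset Printing Implicit Defensive.

Import Order.TTheory GRing.Theory Num.Theory.
Import numFieldNormedType.Exports.

Local Open Scope classical_set_scope.
Local Open Scope ring_scope.

(** The proof is a De Giorgi iteration for [v = |grad u|^2].

    Differentiate the equation in the direction [k], multiply by [d_k u] and
    sum over [k].  Where [|grad u| >= 1] the Hessian of [E] is comparable to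
    [(eps^2 + v)^(p/2 - 1)] times the identity, so that there [v] is, up to a
    source term, a subsolution of an elliptic equation.  Testing with
    [eta^2 (v - l)_+^2], where [eta] is a cutoff function and [l >= 1], gives a
    Caccioppoli inequality for the excess [s = (v - l)_+]
    ([energy_inequality]).  The computation is one divergence identity, in
    which the derivatives of [f] cancel ([divergence_rearrange]).

    Instead of the Sobolev inequality the proof uses an elementary one of
    Faber-Krahn type: if [{phi <> 0}] has measure less than [L^n], then
    [int |phi| <= L sum_i int |d_i phi|] ([integral_le_volume_gradient]).  It
    holds in every dimension with the same short proof, so that [n = 2] is not
    exceptional.  Applied to [phi = eta^2 s^3] and combined with the energy
    inequality, it bounds the measure of a superlevel set of [v] in a ball by
    that of a lower superlevel set in a larger ball ([degiorgi_step]).  As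
    [q > n], the source term has a positive power of [L] to spare, and the
    iteration over radii decreasing to half of the initial one and levels
    increasing from [k] to [2 k] gives ([speed2_le_of_small_superlevel]): if
    [v <= M k] on a ball of radius [rho <= 1], if [k >= 1] dominates [f], and
    if [{v > k}] fills less than [(rho tau)^n] of the ball, then [v <= 2 k] at
    the centre.

    This is turned into a bound at the centre [x0] of a ball of radius [r] by
    maximizing [(r - |y - x0|)^n |grad u (y)|] over the ball
    ([gradient_at_center]).  Let [x] be the maximum point and
    [d = r - |x - x0|].  On the ball of radius [d / 2] around [x], [|grad u|]
    is at most [2^n] times its value at [x], so the criterion applies with
    [k = v(x) / 4]; its conclusion [v(x) <= v(x) / 2] is absurd, hence one of
    its hypotheses fails.  Either [v(x) <= 4], or [v(x)] is bounded in terms of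
    the norm of [f], or [{v > k}] has measure at least [(d tau / 2)^n] and
    Chebyshev's inequality bounds [d^n |grad u (x)|^p] by the energy.  For
    [q = oo], the norm of [f] in [L^(2 n)] is controlled by the supremum.

    The theorem follows on applying this to the balls of radius
    [(1 - theta) R] around the points of [B_(theta R)].  For [n = 2] it gives
    the exponent [2 / p], which is smaller than [2 chi / (p (chi - 1))]. *)

(** * Tonelli's theorem for the Lebesgue measure of R^n *)

Section sigma_finite_copy.
Context d (X : measurableType d) (R : realType).
Variables (m : {measure set X -> \bar R}) (h : sigma_finite setT m).

(** Tonelli's theorem expects sigma-finiteness as a structure on the measure;
    [h] occurs in the body only so that the instances can refer to it. *)
Definition sigma_finite_copy : set X -> \bar R := let _ := h in m.
HB.instance Definition _ := Measure.copy sigma_finite_copy m.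
HB.instance Definition _ :=
  Measure_isSigmaFinite.Build _ _ _ sigma_finite_copy h.

End sigma_finite_copy.

Section tonelli.
Context {R : realType}.
Local Notation T n := (n.-tuple (measurableTypeR R)).
Local Notation mu1 := (@lebesgue_measure R).
Local Notation mu n := (@lebesgue_tuple R n).

Lemma lebesgue_tuple_sigma_finite n : sigma_finite setT (mu n).
Proof.
pose A (k : nat) : set (measurableTypeR R) := `[- k%:R, k%:R]%classic.
exists (fun k => [set t : T n | forall i, A k (tnth t i)]).
  apply/esym; rewrite -subTset => t _ /=.
  pose M := \sum_(i < n) `|tnth t i|.
  have M0 : 0 <= M by apply: sumr_ge0.
  exists (Num.truncn M).+1 => // i /=.
  have := truncnS_gt M; set K := (_.+1) => MK.
  have : `|tnth t i| <= K%:R.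
    apply: le_trans (ltW MK).
    by rewrite /M (bigD1 i)//= lerDl sumr_ge0.
  by rewrite ler_norml /A /= in_itv/=.
move=> k; split.
  rewrite (_ : mkset _ = \bigcap_(i in [set: 'I_n])
      ((fun t : T n => tnth t i) @^-1` A k)); last first.
    by apply/seteqP; split=> [t h i _|t h i]; [exact: h|exact: (h i I)].
  apply: fin_bigcap_measurable => [|i _]; first exact: finite_finset.
  rewrite -[X in measurable X]setTI.
  by apply: measurable_tnth => //; exact: measurable_itv.
rewrite (lebesgue_tuple_box (A := fun=> A k)); last by move=> i; exact: measurable_itv.
rewrite big_const_ord /A lebesgue_measure_itv/= lte_fin.
case: ifPn => _.
  elim: n => [|n IH]; first by rewrite /= ltry.
  by rewrite iterS -EFinB lte_mul_pinfty//.
elim: n => [|n IH]; first by rewrite /= ltry.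
by rewrite iterS mul0e.
Qed.

Local Open Scope ereal_scope.

Lemma measurable_fun_cons n (f : T n.+1 -> \bar R) :
  measurable_fun setT f ->
  measurable_fun setT (fun z : measurableTypeR R * T n => f [tuple of z.1 :: z.2]).
Proof. move=> mf; exact: measurableT_comp mf (@measurable_cons_pair R n). Qed.

(** The measure of R^(n+1) is defined by a product that asks nothing of its
    second factor, whereas Tonelli's theorem speaks of the product of two
    sigma-finite measures.  They agree on rectangles, hence everywhere. *)
Lemma ge0_integral_tuple_lr n (f : T n.+1 -> \bar R) :
  measurable_fun setT f -> (forall t, 0 <= f t) ->
  \int[mu n.+1]_t f t = \int[mu n]_y \int[mu1]_z f [tuple of z :: y].
Proof.
move=> mf f0.
rewrite ge0_integral_pushforward//; last exact: measurable_cons_pair.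
rewrite preimage_setT.
set m := sigma_finite_copy (@lebesgue_tuple_sigma_finite n).
have <- := (@fubini_tonelli2 _ _ _ _ _ lebesgue_measure m
  (fun z => f [tuple of z.1 :: z.2]) (measurable_fun_cons mf) (fun=> f0 _)).
apply: eq_measure_integral => A mA _.
apply/esym; apply: (product_measure_unique (m1 := lebesgue_measure)
  (m2 := m) (m' := (lebesgue_measure \x^ mu n)%E)) => // B C mB mC.
exact: (@product_measure2E _ _ _ _ _ lebesgue_measure (mu n)).
Qed.

Lemma ge0_integral_tuple_rl n (f : T n.+1 -> \bar R) :
  measurable_fun setT f -> (forall t, 0 <= f t) ->
  \int[mu n.+1]_t f t = \int[mu1]_z \int[mu n]_y f [tuple of z :: y].
Proof.
move=> mf f0; rewrite ge0_integral_tuple_lr//.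
apply/esym.
exact: (@fubini_tonelli _ _ _ _ _ lebesgue_measure (sigma_finite_copy (@lebesgue_tuple_sigma_finite n))
  (fun z => f [tuple of z.1 :: z.2]) (measurable_fun_cons mf) (fun=> f0 _)).
Qed.

End tonelli.

(** * Integration along coordinate lines, and a Faber-Krahn inequality *)

Section coordinates.
Context {R : realType}.
Local Notation T n := (n.-tuple (measurableTypeR R)).
Local Notation mu1 := (@lebesgue_measure R).
Local Notation mu n := (@lebesgue_tuple R n).

Definition update_tuple n (t : T n) (i : 'I_n) (z : R) : T n :=
  [tuple (if j == i then z else tnth t j) | j < n].

Lemma update_tuple_head n (y : T n) (w z : R) :
  update_tuple [tuple of w :: y] ord0 z = [tuple of z :: y].
Proof.
apply: eq_from_tnth => j; rewrite tnth_mktuple.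
case: (unliftP ord0 j) => [k ->|->]; last by rewrite eqxx.
by rewrite eq_sym (negbTE (neq_lift _ _)) !tnthS.
Qed.

Lemma update_tuple_behead n (y : T n) (w z : R) (i : 'I_n) :
  update_tuple [tuple of w :: y] (lift ord0 i) z =
  [tuple of w :: update_tuple y i z].
Proof.
apply: eq_from_tnth => j; rewrite tnth_mktuple.
case: (unliftP ord0 j) => [k ->|->].
  by rewrite !tnthS tnth_mktuple (inj_eq lift_inj).
by rewrite (negbTE (neq_lift _ _)).
Qed.

Local Open Scope ereal_scope.

Lemma measurable_slice_tail n (f : T n.+1 -> \bar R) (z : R) :
  measurable_fun setT f ->
  measurable_fun setT (fun y : T n => f [tuple of z :: y]).
Proof.
by move=> /measurable_fun_cons mf; exact: (measurableT_comp mf (pair1_measurable z)).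
Qed.

Lemma measurable_integral_tail n (f : T n.+1 -> \bar R) :
  measurable_fun setT f -> (forall t, 0 <= f t) ->
  measurable_fun setT
    (fun z : measurableTypeR R => \int[mu n]_y f [tuple of z :: y]).
Proof.
move=> mf f0.
exact: (@measurable_fun_fubini_tonelli_F _ _ _ _ _
  (sigma_finite_copy (@lebesgue_tuple_sigma_finite R n))
  (fun z => f [tuple of z.1 :: z.2]) (measurable_fun_cons mf) (fun=> f0 _)).
Qed.

Lemma measurable_integral_head n (f : T n.+1 -> \bar R) :
  measurable_fun setT f -> (forall t, 0 <= f t) ->
  measurable_fun setT (fun y : T n => \int[mu1]_z f [tuple of z :: y]).
Proof.
move=> mf f0.
have := (@measurable_fun_fubini_tonelli_G _ _ _ (T n) R lebesgue_measure
  (fun z => f [tuple of z.1 :: z.2]) (measurable_fun_cons mf) (fun=> f0 _)).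
by rewrite /fubini_G.
Qed.

(** Integrating first in the [i]-th variable turns an inequality on every line
    parallel to the [i]-th axis into one between the full integrals.  The
    order of integration needs no explicit permutation of the variables: by
    induction on [n], either the first variable is the one to integrate first,
    or it is frozen and the remaining ones are treated recursively. *)
Lemma le_integral_coordinate n (i : 'I_n) (F G : T n -> \bar R) :
  measurable_fun setT F -> measurable_fun setT G ->
  (forall t, 0 <= F t) -> (forall t, 0 <= G t) ->
  (forall t, \int[mu1]_z F (update_tuple t i z) <=
             \int[mu1]_z G (update_tuple t i z)) ->
  \int[mu n]_t F t <= \int[mu n]_t G t.
Proof.
elim: n i F G => [[]//|n IH i F G mF mG F0 G0 FG].
case: (unliftP ord0 i) => [j ij|i0].
  rewrite !ge0_integral_tuple_rl//; apply: ge0_le_integral => //.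
  - by move=> z _; apply: integral_ge0.
  - exact: measurable_integral_tail.
  - exact: measurable_integral_tail.
  move=> z _; apply: (IH j) => //; try exact: measurable_slice_tail.
  move=> t; have := FG [tuple of z :: t].
  have E (H : T n.+1 -> \bar R) :
      \int[mu1]_s H (update_tuple [tuple of z :: t] i s) =
      \int[mu1]_s H [tuple of z :: update_tuple t j s].
    by apply: eq_integral => s _; rewrite ij update_tuple_behead.
  by rewrite !E.
rewrite !ge0_integral_tuple_lr//; apply: ge0_le_integral => //.
- by move=> z _; apply: integral_ge0.
- exact: measurable_integral_head.
- exact: measurable_integral_head.
move=> y _; have := FG [tuple of (0 : R)%R :: y].
have E (H : T n.+1 -> \bar R) :
    \int[mu1]_s H (update_tuple [tuple of (0 : R)%R :: y] i s) =
    \int[mu1]_s H [tuple of s :: y].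
  by apply: eq_integral => s _; rewrite i0 update_tuple_head.
by rewrite !E.
Qed.

(** Think of [g i] as the absolute value of the [i]-th partial derivative of
    [phi]; all that is used of it is that its integral along a line bounds the
    values of [phi] on that line.  Induction on [n], slicing at the first
    coordinate [z].  If the slice of [{phi <> 0}] at [z] has measure less than
    [L ^ n], the induction hypothesis controls the slice of [phi].  The other
    values of [z] form a set of length at most [L], by Chebyshev's inequality,
    and there the slice of [phi] is bounded by the integral of [g ord0], which
    does not depend on [z]. *)
Lemma integral_le_volume_gradient n (L : R) (phi : T n -> \bar R)
    (g : 'I_n -> T n -> \bar R) :
  (0 < L)%R ->
  measurable_fun setT phi -> (forall t, 0 <= phi t) ->
  (forall i, measurable_fun setT (g i)) -> (forall i t, 0 <= g i t) ->
  (forall i t, phi t <= \int[mu1]_z g i (update_tuple t i z)) ->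
  mu n [set t | phi t != 0] < (L ^+ n)%:E ->
  \int[mu n]_t phi t <= L%:E * \sum_(i < n) \int[mu n]_t g i t.
Proof.
move=> L0; elim: n phi g => [|n IH] phi g mphi phi0 mg g0 phig.
  rewrite expr0 big_ord0 mule0 /= diracE => small.
  have phi_nil t : phi t = 0.
    apply/eqP; apply: contraPT small => phit; apply/negP; rewrite -leNgt.
    by rewrite mem_set//= (_ : [tuple] = t)//; apply/val_inj; case: t {phit} => [[]].
  by rewrite integral0_eq.
move=> small.
pose S := [set t | phi t != 0].
have mS : measurable S.
  by rewrite -[S]setTI; apply: emeasurable_neq.
pose N := \int[mu n.+1]_t g ord0 t.
pose D (z : measurableTypeR R) : \bar R := \sum_(i < n) \int[mu n]_y g (lift ord0 i) [tuple of z :: y].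
pose m (z : measurableTypeR R) := mu n [set y : T n | phi [tuple of z :: y] != 0].
have D0 z : 0 <= D z by apply: sume_ge0 => i _; apply: integral_ge0.
have N0 : 0 <= N by apply: integral_ge0.
have mD : measurable_fun setT D.
  by apply: emeasurable_sum => i; apply: measurable_integral_tail.
pose S1 : T n.+1 -> \bar R := EFin \o \1_S.
have mS1 : measurable_fun setT S1 by exact: measurableT_comp.
have S10 t : 0 <= S1 t by rewrite /S1/= lee_fin.
have mE z : m z = \int[mu n]_y S1 [tuple of z :: y].
  rewrite /S1/= -[RHS]/(\int[mu n]_y (\1_[set y : T n | phi [tuple of z :: y] != 0] y)%:E).
  rewrite integral_indic ?setIT//.
  have := measurable_slice_tail z mphi => mz.
  by rewrite -[mkset _]setTI; apply: emeasurable_neq.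
have mm : measurable_fun setT m.
  by rewrite (funext mE); exact: measurable_integral_tail.
have intm : \int[mu1]_z m z = mu n.+1 S.
  under eq_integral do rewrite mE.
  by rewrite -ge0_integral_tuple_rl// /S1 integral_indic// setIT.
pose big := [set z : measurableTypeR R | (L ^+ n)%:E <= m z].
have mbig : measurable big.
  by rewrite -[X in measurable X]setTI; exact: emeasurable_fun_c_infty.
have bigL : mu1 big <= L%:E.
  have Ln0 : (0 < L ^+ n)%R by rewrite exprn_gt0.
  have : (L ^+ n)%:E * mu1 big <= \int[mu1]_z m z.
    have := le_integral_abse lebesgue_measure measurableT mm Ln0.
    rewrite setTI.
    by under [leRHS]eq_integral do rewrite gee0_abs//;
      under eq_set do rewrite gee0_abs//.
  rewrite intm => /le_lt_trans/(_ small).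
  rewrite exprS EFinM muleC lte_pmul2r// => /ltW//.
have slice z : \int[mu n]_y phi [tuple of z :: y] <=
    L%:E * D z + N * (\1_big z)%:E.
  rewrite indicE; have [/set_mem zb|/negP zb] := boolP (z \in big).
    rewrite mule1; apply: (@le_trans _ _ N); last first.
      by rewrite leeDr// mule_ge0// lee_fin ltW.
    rewrite /N ge0_integral_tuple_lr//; apply: ge0_le_integral => //.
    - exact: measurable_slice_tail.
    - exact: measurable_integral_head.
    move=> y _; have := phig ord0 [tuple of z :: y].
    by under eq_integral do rewrite update_tuple_head.
  rewrite mule0 adde0; apply: IH => //.
  - exact: measurable_slice_tail.
  - by move=> i; exact: measurable_slice_tail.
  - move=> i y; have := phig (lift ord0 i) [tuple of z :: y].
    by under eq_integral do rewrite update_tuple_behead.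
  - by rewrite ltNge; apply/negP => zb'; apply: zb; rewrite inE.
rewrite ge0_integral_tuple_rl//.
apply: (@le_trans _ _ (\int[mu1]_z (L%:E * D z + N * (\1_big z)%:E))).
  apply: ge0_le_integral => //.
  - by move=> z _; apply: integral_ge0.
  - exact: measurable_integral_tail.
  apply: emeasurable_funD; first exact: measurable_funeM.
  by apply: measurable_funeM; exact: measurableT_comp.
rewrite ge0_integralD//; first last.
- by apply: measurable_funeM; exact: measurableT_comp.
- by move=> z _; rewrite mule_ge0// lee_fin.
- exact: measurable_funeM.
- by move=> z _; rewrite mule_ge0// lee_fin ltW.
rewrite ge0_integralZl//; last by rewrite lee_fin ltW.
rewrite ge0_integralZl//; last exact: measurableT_comp.
rewrite integral_indic// setIT.
rewrite ge0_integral_sum//; last 2 first.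
- by move=> i; exact: measurable_integral_tail.
- by move=> i z _; apply: integral_ge0 => y _; exact: g0.
rewrite big_ord_recl ge0_muleDr; last 2 first.
- exact: N0.
- by apply: sume_ge0 => i _; apply: integral_ge0 => t _; exact: g0.
rewrite addeC leeD//; first by rewrite muleC lee_wpmul2r.
by under eq_bigr do rewrite -ge0_integral_tuple_rl//.
Qed.

End coordinates.

(** * Measurability of functions of row vectors *)

Section measurability.
Context {R : realType} {n : nat}.
Local Notation T := (n.-tuple (measurableTypeR R)).
Local Notation mu := (@lebesgue_tuple R n).
Local Notation row := (@tuple_to_row R n).

Definition tuple_box (c : T) (e : R) : set T :=
  [set t | forall i, `|tnth c i - tnth t i| < e].

Lemma tuple_box_ball (c t : T) (e : R) : 0 < e ->
  tuple_box c e t <-> ball (row c) e (row t).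
Proof.
move=> e0; split=> [ct|[_ ct] i].
  by split=> // i j; rewrite !mxE; exact: ct.
by have := ct 0 i; rewrite !mxE.
Qed.

Lemma tuple_boxE (c : T) (e : R) : tuple_box c e =
  [set t | forall i, `]tnth c i - e, tnth c i + e[%classic (tnth t i)].
Proof.
apply/seteqP; split=> t /= ct i; have := ct i;
  by rewrite /= in_itv/= ltr_distlC ?ltr_distl => /andP[? ?]; apply/andP; split; lra.
Qed.

Lemma measurable_tuple_box (c : T) (e : R) : measurable (tuple_box c e).
Proof.
rewrite tuple_boxE.
rewrite (_ : mkset _ = \bigcap_(i in [set: 'I_n]) ((fun t : T => tnth t i) @^-1`
    `]tnth c i - e, tnth c i + e[%classic)); last first.
  by apply/seteqP; split=> [t h i _|t h i]; [exact: h|exact: (h i I)].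
apply: fin_bigcap_measurable => [|i _]; first exact: finite_finset.
rewrite -[X in measurable X]setTI.
by apply: measurable_tnth => //; exact: measurable_itv.
Qed.

Lemma lebesgue_tuple_box_pow (c : T) (e : R) : 0 < e ->
  mu (tuple_box c e) = ((2 * e) ^+ n)%:E.
Proof.
move=> e0; rewrite tuple_boxE.
rewrite (lebesgue_tuple_box (A := fun i => `]tnth c i - e, tnth c i + e[%classic));
  last by move=> i; exact: measurable_itv.
rewrite (eq_bigr (fun=> (2 * e)%:E)); last first.
  move=> i _; rewrite lebesgue_measure_itv/= lte_fin ifT; last by lra.
  by congr EFin; lra.
by rewrite prodEFin prodr_const card_ord.
Qed.

(** The sigma-algebra is that of a product and the topology that of the sup
    norm: an open set is the countable union of the cubes with rational centres
    and sides [2 / (k + 1)] that it contains. *)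
Lemma measurable_open_row (O : set 'rV[R]_n) : open O -> measurable (row @^-1` O : set T).
Proof.
move=> oO.
pose q (c : n.-tuple rat) : T := map_tuple ratr c.
pose B (ck : n.-tuple rat * nat) :=
  if `[< tuple_box (q ck.1) ck.2.+1%:R^-1 `<=` row @^-1` O >]
  then tuple_box (q ck.1) ck.2.+1%:R^-1 else set0.
rewrite (_ : _ @^-1` _ = \bigcup_ck B ck).
  apply: countable_bigcupT_measurable => [|ck]; first exact: countableP.
  by rewrite /B; case: ifP => _; [exact: measurable_tuple_box|exact: measurable0].
apply/seteqP; split=> [t Ot|t [ck _]]; last first.
  by rewrite /B; case: ifPn => // /asboolP; apply.
have /nbhs_ballP[e /= e0 eO] : nbhs (row t) O by apply: open_nbhs_nbhs; split.
pose k := Num.truncn (2 / e).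
have k0 : 0 < k.+1%:R^-1 :> R by rewrite invr_gt0.
have ke : 2 * k.+1%:R^-1 < e.
  rewrite -ltr_pdivlMl// mulrC; rewrite -ltf_pV2 ?posrE ?divr_gt0// invrK invf_div.
  exact: truncnS_gt.
have /choice[c cP] : forall i, exists c : rat, `|ratr c - tnth t i| < k.+1%:R^-1.
  move=> i; have [|c] := @rat_in_itvoo R (tnth t i - k.+1%:R^-1) (tnth t i + k.+1%:R^-1).
    by rewrite ltrBlDr -addrA ltrDl addr_gt0.
  by rewrite in_itv/= => c12; exists c; rewrite ltr_distl.
exists ([tuple c i | i < n], k) => //=; rewrite /B /= ifT.
  by move=> i; rewrite tnth_map tnth_mktuple.
apply/asboolP => s qs; apply: eO; apply/tuple_box_ball => // i.
have := qs i; rewrite tnth_map tnth_mktuple => csi.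
have := cP i => cti.
rewrite -(subrKA (ratr (c i))) (le_lt_trans (ler_normD _ _))//.
by rewrite distrC (lt_trans _ ke)// mulr2n mulrDl mul1r ltrD// distrC.
Qed.

Lemma measurable_closed_row (K : set 'rV[R]_n) : closed K -> measurable (row @^-1` K : set T).
Proof.
by move=> cK; have := measurableC (measurable_open_row (closed_openC cK)); rewrite -preimage_setC setCK.
Qed.

Lemma measurable_fun_row (U : set 'rV[R]_n) (B : set T) (F : 'rV[R]_n -> R) :
  open U -> measurable B -> B `<=` row @^-1` U ->
  (forall x, U x -> {for x, continuous F}) ->
  measurable_fun B (F \o row).
Proof.
move=> oU mB BU cF _; apply: (measurability _ (RGenOpens.measurableE R)) => //.
move=> _ [_ [a [b ->] <-]].
rewrite (_ : B `&` _ = B `&` row @^-1` (U `&` F @^-1` `]a, b[%classic)).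
  apply: measurableI => //; apply: measurable_open_row.
  rewrite openE => x [Ux Fx]; apply: filterI; first exact: open_nbhs_nbhs.
  apply: cF => //; apply: open_nbhs_nbhs; split=> //; exact: interval_open.
apply/seteqP; split=> t [Bt] /=; first by move=> Ft; split=> //; split=> //; exact: BU.
by case.
Qed.

Lemma measurable_continuous_row (F : 'rV[R]_n -> R) :
  continuous F -> measurable_fun setT (F \o row).
Proof.
move=> cF; apply: (@measurable_fun_row setT); [exact: openT|exact: measurableT| |].
  by [].
by move=> x _; exact: cF.
Qed.

Lemma measurable_powR_norm_on (U D : set 'rV[R]_n) (g : 'rV[R]_n -> R) (q : R) :
  open U -> D `<=` U -> measurable (row @^-1` D : set T) ->
  (forall x, U x -> {for x, continuous g}) ->
  measurable_fun (row @^-1` D : set T) (fun t : T => (`|g (row t)| `^ q)%:E).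
Proof.
move=> oU DU mD cg.
have mfr : measurable_fun (row @^-1` D : set T) (g \o row).
  by apply: (measurable_fun_row oU mD) => [t Kt|]; [exact: DU|exact: cg].
apply/measurable_EFinP; apply: (measurableT_comp (measurable_powR q)).
exact: measurableT_comp mfr.
Qed.

Lemma row_surj (x : 'rV[R]_n) : exists t : T, row t = x.
Proof.
exists [tuple x 0 i | i < n]; apply/rowP => i.
by rewrite mxE tnth_mktuple.
Qed.

Lemma row_update (t : T) (i : 'I_n) (z : R) :
  row (update_tuple t i z) = z *: delta_mx 0 i + row (update_tuple t i 0).
Proof.
apply/rowP => j; rewrite !mxE !tnth_mktuple /=.
by case: eqP => _; rewrite ?mulr1 ?mulr0 ?addr0 ?add0r.
Qed.

End measurability.

(** * Functions of one variable with compact support *)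

Section line.
Context {R : realType}.
Local Notation mu1 := (@lebesgue_measure R).
Variables (h : R -> R) (b : R).
Hypothesis dh : forall z, derivable h z 1.
Hypothesis ch : continuous (derive1 h).
Hypothesis h0 : forall z, b < `|z| -> h z = 0.

Let continuous_h : continuous h.
Proof.
by move=> z; apply/differentiable_continuous/derivable1_diffP.
Qed.

Let oo z c : derivable_oo_LRcontinuous h z c.
Proof.
split=> [x _||]; [exact: dh| |].
  by apply: cvg_at_right_filter; exact: continuous_h.
by apply: cvg_at_left_filter; exact: continuous_h.
Qed.

Let FTC z c : z < c ->
  (\int[mu1]_(x in `[z, c]) (derive1 h x)%:E = (h c)%:E - (h z)%:E)%E.
Proof.
move=> zc.
exact: (continuous_FTC2 zc (continuous_subspaceT ch) (oo z c) (fun _ _ => erefl)).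
Qed.

Let derive_outside z : b < `|z| -> derive1 h z = 0.
Proof.
move=> bz; rewrite derive1E (@near_eq_derive _ _ _ h (cst 0)) ?derive_cst//.
have : open [set y : R | b < `|y|].
  rewrite (_ : mkset _ = Num.norm @^-1` `]b, +oo[%classic); last first.
    by apply/seteqP; split=> y /=; rewrite in_itv/= andbT.
  apply: open_comp => [y _|]; first exact: norm_continuous.
  exact: interval_open.
move=> oB; near=> y; apply: h0; near: y.
exact: (open_nbhs_nbhs (conj oB bz)).
Unshelve. all: by end_near. Qed.

Lemma le_integral_abs_derive z : (`|h z|%:E <= \int[mu1]_x `|derive1 h x|%:E)%E.
Proof.
pose a := Num.min z (- `|b|) - 1.
have az : a < z by rewrite /a ltrBlDr (@le_lt_trans _ _ z)// ?ge_min ?lexx// ltrDl.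
have ha : h a = 0.
  apply: h0; have : Num.min z (- `|b|) <= - `|b| by rewrite ge_min lexx orbT.
  rewrite /a; set m := Num.min _ _ => mb.
  have : b <= `|b| by exact: ler_norm.
  move=> bb; rewrite ltr_normr; apply/orP; right; have := normr_ge0 b; lra.
have := FTC az; rewrite ha sube0 -abse_EFin => <-.
have mh : measurable_fun setT (EFin \o derive1 h).
  by apply/measurable_EFinP; exact: continuous_measurable_fun.
apply: (le_trans (le_abse_integral _ _ _)) => //.
  exact: measurable_funS mh.
rewrite [leRHS](_ : _ = \int[mu1]_(x in setT) `|(derive1 h x)%:E|)%E//.
apply: ge0_subset_integral => //.
exact: measurableT_comp.
Qed.

(** The integral of a derivative vanishes.  Equating the integrals of its
    positive and negative parts keeps all integrands nonnegative, so that
    the equality can be integrated in the other variables by Tonelli's theorem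
    alone. *)
Lemma integral_derive_pos_neg :
  (\int[mu1]_x (Num.max (derive1 h x) 0)%:E =
   \int[mu1]_x (Num.max (- derive1 h x) 0)%:E)%E.
Proof.
pose c : R := `|b| + 1.
have c0 : - c < c by have := normr_ge0 b; rewrite /c; lra.
have bc : b < c by have := ler_norm b; rewrite /c; lra.
have hc : h c = 0 by apply: h0; rewrite (lt_le_trans bc)// ler_norm.
have hNc : h (- c) = 0 by apply: h0; rewrite normrN (lt_le_trans bc)// ler_norm.
have out x : ~ `[- c, c]%classic x -> derive1 h x = 0.
  move=> xc; apply: derive_outside; rewrite ltNge; apply/negP => xb; apply: xc.
  by rewrite /= in_itv/= -ler_norml; lra.
have int : mu1.-integrable `[-c, c] (EFin \o derive1 h).
  exact: (continuous_compact_integrable (@segment_compact R _ _) (continuous_subspaceT ch)).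
have := FTC c0; rewrite hc hNc sube0 integralE.
have pE : (\int[mu1]_(x in `[(- c)%R, c]) (EFin \o derive1 h)^\+ x =
           \int[mu1]_x (Num.max (derive1 h x) 0)%:E)%E.
  rewrite integral_mkcond; apply: eq_integral => x _; rewrite patchE.
  case: ifPn => [_|/negP xc]; first by rewrite funeposE /= EFin_max.
  by rewrite out ?maxxx// => xc'; apply: xc; rewrite inE.
have nE : (\int[mu1]_(x in `[(- c)%R, c]) (EFin \o derive1 h)^\- x =
           \int[mu1]_x (Num.max (- derive1 h x) 0)%:E)%E.
  rewrite integral_mkcond; apply: eq_integral => x _; rewrite patchE.
  case: ifPn => [_|/negP xc]; first by rewrite funenegE /= EFin_max EFinN.
  by rewrite out ?oppr0 ?maxxx// => xc'; apply: xc; rewrite inE.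
have mI : measurable (`[- c, c]%classic : set (measurableTypeR R)) by exact: measurable_itv.
have := integral_funeneg_lt_pinfty mI int.
have := integral_funepos_lt_pinfty mI int.
rewrite pE nE.
have : (0 <= \int[mu1]_x (Num.max (derive1 h x) 0)%:E)%E.
  by apply: integral_ge0 => x _; rewrite lee_fin le_max lexx orbT.
have : (0 <= \int[mu1]_x (Num.max (- derive1 h x) 0)%:E)%E.
  by apply: integral_ge0 => x _; rewrite lee_fin le_max lexx orbT.
case: (\int[mu1]_x _)%E => [r| |]//; case: (\int[mu1]_x _)%E => [s| |]// _ _ _ _.
by rewrite -EFinB => -[] /eqP; rewrite subr_eq0 => /eqP ->.
Qed.

End line.

(** * Compactly supported functions of class C^1 *)

Section compact_C1.
Context {R : realType} {n : nat}.
Local Notation T := (n.-tuple (measurableTypeR R)).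
Local Notation mu1 := (@lebesgue_measure R).
Local Notation mu := (@lebesgue_tuple R n).
Local Notation row := (@tuple_to_row R n).
Implicit Types (z : 'rV[R]_n -> R).

Lemma measurable_max0 (g : T -> R) : measurable_fun setT g ->
  measurable_fun setT (fun t => Num.max (g t) 0).
Proof. by move=> mg; apply: measurable_maxr => //; apply: measurable_cst. Qed.

Definition compact_support z := exists b : R, forall x, b < `|x| -> z x = 0.

Definition C1c z : Prop :=
  [/\ forall x i, derivable z x (delta_mx 0 i), forall i, continuous (partial i z),
      continuous z & compact_support z].

Lemma compact_support_partial z i : compact_support z -> compact_support (partial i z).
Proof.
move=> [b zb]; exists b => x bx.
rewrite /partial (@near_eq_derive _ _ _ z (cst 0)) ?derive_cst//.
have : open [set y : 'rV[R]_n | b < `|y|].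
  rewrite (_ : mkset _ = Num.norm @^-1` `]b, +oo[%classic); last first.
    by apply/seteqP; split=> y /=; rewrite in_itv/= andbT.
  apply: open_comp => [y _|]; first exact: norm_continuous.
  exact: interval_open.
move=> oB; near=> y; apply: zb; near: y.
exact: (open_nbhs_nbhs (conj oB bx)).
Unshelve. all: by end_near. Qed.

Lemma coord_le_norm (x : 'rV[R]_n) i : `|x 0 i| <= `|x|.
Proof. by rewrite [leRHS]mx_normrE; exact: (le_bigmax _ _ (0, i)). Qed.

Section along_line.
Variables (z : 'rV[R]_n -> R) (t : T) (i : 'I_n).
Let h (s : R) := z (row (update_tuple t i s)).

Let shiftE (s k : R) :
  row (update_tuple t i (k + s)) = k *: delta_mx 0 i + row (update_tuple t i s).
Proof. by rewrite row_update scalerDl -addrA -row_update. Qed.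

Let quotE (s : R) : (fun k : R => k^-1 *: ((h \o shift s) (k *: 1) - h s)) =
  (fun k : R => k^-1 *: ((z \o shift (row (update_tuple t i s))) (k *: delta_mx 0 i) -
                      z (row (update_tuple t i s)))).
Proof. by apply/funext => k; rewrite /h /shift /= [k *: 1]mulr1 shiftE. Qed.

Lemma derivable_line s : derivable z (row (update_tuple t i s)) (delta_mx 0 i) ->
  derivable h s 1.
Proof. by rewrite /derivable quotE. Qed.

Lemma derive1_line s : derive1 h s = partial i z (row (update_tuple t i s)).
Proof. by rewrite derive1E /partial /derive quotE. Qed.

Lemma continuous_line (g : 'rV[R]_n -> R) : continuous g ->
  continuous (fun s : R => g (row (update_tuple t i s))).
Proof.
move=> cg s.
rewrite (_ : (fun s => _) = g \o (fun s : R =>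
   s *: delta_mx 0 i + row (update_tuple t i 0))); last first.
  by apply/funext => k /=; rewrite row_update.
apply: continuous_comp; last exact: cg.
by apply: cvgD; [apply: cvgZl; exact: cvg_id|exact: cvg_cst].
Qed.

Lemma outside_line b : (forall x, b < `|x| -> z x = 0) ->
  forall s, b < `|s| -> h s = 0.
Proof.
move=> zb s bs; apply: zb; apply: (lt_le_trans bs).
apply: le_trans (coord_le_norm _ i).
by rewrite mxE tnth_mktuple eqxx.
Qed.

End along_line.

Lemma integral_partial_pos_neg z i : C1c z ->
  (\int[mu]_t (Num.max (partial i z (row t)) 0)%:E =
   \int[mu]_t (Num.max (- partial i z (row t)) 0)%:E)%E.
Proof.
move=> [dz cz _ [b zb]].
have mz : measurable_fun setT (partial i z \o row).
  exact: measurable_continuous_row.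
have mp : measurable_fun setT (fun t : T => (Num.max (partial i z (row t)) 0)%:E).
  by apply/measurable_EFinP; exact: (measurable_max0 mz).
have mn : measurable_fun setT (fun t : T => (Num.max (- partial i z (row t)) 0)%:E).
  apply/measurable_EFinP; apply: measurable_max0.
  exact: measurableT_comp mz.
have E t : (\int[mu1]_s (Num.max (partial i z (row (update_tuple t i s))) 0)%:E =
  \int[mu1]_s (Num.max (- partial i z (row (update_tuple t i s))) 0)%:E)%E.
  have := @integral_derive_pos_neg R (fun s => z (row (update_tuple t i s))) b.
  have -> : derive1 (fun s => z (row (update_tuple t i s))) =
      fun s => partial i z (row (update_tuple t i s)).
    by apply/funext => s; rewrite derive1_line.
  apply; first by move=> s; apply: derivable_line; exact: dz.
  - exact: continuous_line.
  - exact: outside_line.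
apply/eqP; rewrite eq_le; apply/andP; split; apply: (le_integral_coordinate (i := i)) => //;
  try (by move=> t; rewrite lee_fin le_max lexx orbT).
  by move=> t; rewrite E.
by move=> t; rewrite E.
Qed.

Lemma integral_compact_support_lty (g : 'rV[R]_n -> R) :
  continuous g -> compact_support g -> (\int[mu]_t `|g (row t)|%:E < +oo)%E.
Proof.
move=> cg [b gb].
pose K := [set x : 'rV[R]_n | forall i, `[- `|b|, `|b|]%classic (x ord0 i)].
have cK : compact K by apply: (@rV_compact _ n (fun=> `[- `|b|, `|b|]%classic)) => _; exact: segment_compact.
have out x : ~ K x -> g x = 0.
  move=> Kx; apply: gb; rewrite ltNge; apply/negP => xb; apply: Kx => i.
  rewrite /= in_itv/= -ler_norml; apply: le_trans (coord_le_norm _ _) _.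
  by rewrite (le_trans xb) ?ler_norm.
have [M M0 gM] : exists2 M : R, 0 <= M & forall x, `|g x| <= M.
  have [|] := pselect (exists x, K x).
    move=> K0.
    have [|c _ cmax] := @compact_EVT_max _ R (fun x => `|g x|) K K0 cK.
      apply: continuous_subspaceT => x; apply: continuous_comp; first exact: cg.
      exact: norm_continuous.
    exists `|g c| => // x; have [Kx|/out ->] := pselect (K x); last by rewrite normr0.
    by apply: cmax; rewrite inE.
  move=> K0; exists 0 => // x; rewrite out ?normr0// => Kx.
  by apply: K0; exists x.
pose e := `|b| + 1.
have e0 : 0 < e by rewrite /e; have := normr_ge0 b; lra.
pose c : T := [tuple 0 | i < n].
have mB := measurable_tuple_box c e.
apply: (@le_lt_trans _ _ (\int[mu]_t (M%:E * (\1_(tuple_box c e) t)%:E))%E).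
  apply: ge0_le_integral => //.
  - apply/measurable_EFinP; apply: measurableT_comp => //.
    exact: measurable_continuous_row.
  - by apply: measurable_funeM; exact: measurableT_comp.
  move=> t _; rewrite -EFinM lee_fin indicE.
  have [_|/negP tB] := boolP (t \in tuple_box c e); first by rewrite mulr1.
  rewrite out ?normr0 ?mulr0// => Kt; apply: tB; rewrite inE => i.
  rewrite tnth_mktuple sub0r normrN.
  have := Kt i; rewrite /= in_itv/= -ler_norml mxE => h.
  by rewrite (le_lt_trans h)// /e ltrDl.
rewrite ge0_integralZl//; last exact: measurableT_comp.
by rewrite integral_indic// setIT lebesgue_tuple_box_pow// ltry.
Qed.

(** The divergence of a compactly supported field integrates to zero.  With
    [p i] and [m i] the positive and negative parts of [d_i Z_i], the pointwise
    bound reads [A + sum_i m i <= B + sum_i p i], and the two sums have the same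
    finite integral, which can be subtracted even if those of [A] and [B] are
    infinite. *)
Lemma le_integral_divergence (Z : 'I_n -> 'rV[R]_n -> R) (A B : 'rV[R]_n -> R) :
  (forall i, C1c (Z i)) ->
  measurable_fun setT (A \o row) -> measurable_fun setT (B \o row) ->
  (forall x, 0 <= A x) -> (forall x, 0 <= B x) ->
  (forall x, A x - B x <= \sum_i partial i (Z i) x) ->
  (\int[mu]_t (A (row t))%:E <= \int[mu]_t (B (row t))%:E)%E.
Proof.
move=> CZ mA mB A0 B0 AB.
pose p i (t : T) := Num.max (partial i (Z i) (row t)) 0.
pose m i (t : T) := Num.max (- partial i (Z i) (row t)) 0.
have mZ i : measurable_fun setT (partial i (Z i) \o row).
  by have [_ cZ _ _] := CZ i; exact: measurable_continuous_row.
have mp i : measurable_fun setT (EFin \o p i).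
  by apply/measurable_EFinP; exact: (measurable_max0 (mZ i)).
have mm i : measurable_fun setT (EFin \o m i).
  apply/measurable_EFinP; apply: measurable_max0.
  exact: measurableT_comp (mZ i).
have mSp : measurable_fun setT (fun t : T => \sum_(i < n) (p i t)%:E)%E.
  by apply: emeasurable_sum => i; exact: mp.
have mSm : measurable_fun setT (fun t : T => \sum_(i < n) (m i t)%:E)%E.
  by apply: emeasurable_sum => i; exact: mm.
have p0 i t : 0 <= p i t by rewrite le_max lexx orbT.
have m0 i t : 0 <= m i t by rewrite le_max lexx orbT.
have pmE i : (\int[mu]_t (p i t)%:E = \int[mu]_t (m i t)%:E)%E.
  exact: integral_partial_pos_neg.
have p_fin i : (\int[mu]_t (p i t)%:E < +oo)%E.
  case: (CZ i) => _ cZ _ sZ.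
  apply: le_lt_trans (integral_compact_support_lty (cZ i) (compact_support_partial i sZ)).
  apply: ge0_le_integral => //.
  - by move=> t _; rewrite lee_fin.
  - exact: mp.
  - by apply/measurable_EFinP; apply: measurableT_comp => //; exact: mZ.
  - by move=> t _; rewrite lee_fin ge_max ler_norm normr_ge0.
pose S := (\sum_(i < n) \int[mu]_t (p i t)%:E)%E.
have S_fin : S \is a fin_num.
  rewrite ge0_fin_numE; last by apply: sume_ge0 => i _; apply: integral_ge0 => t _; rewrite lee_fin.
  by apply: lte_sum_pinfty => i _; exact: p_fin.
rewrite -(leeD2rE _ _ S_fin).
rewrite {1}/S (eq_bigr _ (fun i _ => pmE i)) /S.
rewrite -!ge0_integral_sum//; try (by move=> i t _; rewrite lee_fin).
rewrite -!ge0_integralD//; first last.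
all: try (by apply/measurable_EFinP).
all: try (by move=> t _; rewrite lee_fin).
all: try (by move=> t _; apply: sume_ge0 => i _; rewrite lee_fin).
all: try exact: mSm.
all: try exact: mSp.
apply: ge0_le_integral => //.
- by move=> t _; apply: adde_ge0; rewrite ?lee_fin//; apply: sume_ge0 => i _; rewrite lee_fin.
- apply: emeasurable_funD; first exact/measurable_EFinP.
  exact: mSm.
- apply: emeasurable_funD; first exact/measurable_EFinP.
  exact: mSp.
move=> t _; rewrite !sumEFin -!EFinD lee_fin.
have := AB (row t).
have -> : \sum_i partial i (Z i) (row t) = \sum_i p i t - \sum_i m i t.
  rewrite -sumrB; apply: eq_bigr => i _; rewrite /p /m.
  set a := partial _ _ _; rewrite /Num.max; case: ltP => ?; case: ltP => ?; lra.
by lra.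
Qed.

Lemma le_integral_volume_partial z (L : R) : 0 < L -> C1c z ->
  (mu [set t | z (row t) != 0%R] < (L ^+ n)%:E)%E ->
  (\int[mu]_t (`|z (row t)|)%:E <=
   L%:E * \sum_(i < n) \int[mu]_t (`|partial i z (row t)|)%:E)%E.
Proof.
move=> L0 [dz cz cz0 [b zb]] small.
apply: (@integral_le_volume_gradient R n L (fun t => `|z (row t)|%:E)
  (fun i t => `|partial i z (row t)|%:E)) => //.
- by apply/measurable_EFinP; apply: measurableT_comp => //; exact: measurable_continuous_row.
- move=> i; apply/measurable_EFinP; apply: measurableT_comp => //.
  by apply: measurable_continuous_row.
- move=> i t; have := @le_integral_abs_derive R (fun s => z (row (update_tuple t i s))) b.
  have -> : derive1 (fun s => z (row (update_tuple t i s))) =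
      fun s => partial i z (row (update_tuple t i s)).
    by apply/funext => s; rewrite derive1_line.
  move=> H; have := H _ _ _ (tnth t i).
  have -> : update_tuple t i (tnth t i) = t.
    by apply: eq_from_tnth => j; rewrite tnth_mktuple; case: eqP => // ->.
  apply; first by move=> s; apply: derivable_line; exact: dz.
  - exact: continuous_line.
  - exact: outside_line.
- apply: le_lt_trans small; rewrite le_eqVlt; apply/orP; left; apply/eqP.
  by congr (mu _); apply/seteqP; split=> t /=; rewrite eqe normr_eq0.
Qed.

End compact_C1.

(** * Functions with continuous partial derivatives *)

Section partials.
Context {R : realType} {n : nat}.
Implicit Types (f : 'rV[R]_n -> R) (x y v : 'rV[R]_n).
Local Notation e_ i := (delta_mx 0 i : 'rV[R]_n).

Lemma norm_le_coord x (b : R) : 0 <= b -> (forall i, `|x 0 i| <= b) -> `|x| <= b.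
Proof.
move=> b0 xb; rewrite [leLHS]mx_normrE; apply: bigmax_le => // -[i j] _ /=.
by rewrite ord1.
Qed.

(** The mean value theorem on the segment from [y] to [c v + y], for [c] of
    either sign, without naming an interval. *)
Lemma MVT_direction f y v (c : R) :
  (forall s, `|s| <= `|c| -> derivable f (s *: v + y) v) ->
  exists2 s, `|s| <= `|c| & f (c *: v + y) - f y = c * 'D_v f (s *: v + y).
Proof.
move=> df; pose h (s : R) := f (s *: v + y).
have quotE (s : R) : (fun k : R => k^-1 *: ((h \o shift s) (k *: 1) - h s)) =
    (fun k : R => k^-1 *: ((f \o shift (s *: v + y)) (k *: v) - f (s *: v + y))).
  by apply/funext => k; rewrite /h /shift /= [k *: 1]mulr1 scalerDl addrA.
have dh (s : R) : `|s| <= `|c| -> is_derive s (1 : R) h ('D_v f (s *: v + y)).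
  move=> sc; apply: DeriveDef; first by rewrite /derivable quotE; exact: df.
  by rewrite /derive quotE.
have ch (s : R) : `|s| <= `|c| -> {for s, continuous h}.
  move=> sc; apply/differentiable_continuous/derivable1_diffP.
  by have [] := dh _ sc.
have hc : f (c *: v + y) = h c by [].
have h0 : f y = h 0 by rewrite /h scale0r add0r.
have [c0|c0] := leP 0 c.
  have [s||s sc E] := @MVT_segment R h (fun s => 'D_v f (s *: v + y)) 0 c c0.
  - rewrite in_itv/= => /andP[s0 sc]; apply: dh.
    by rewrite !ger0_norm// ltW.
  - apply: continuous_in_subspaceT => s; rewrite inE/= in_itv/= => /andP[s0 sc].
    by apply: ch; rewrite !ger0_norm// ltW.
  exists s; last by rewrite hc h0 E subr0 mulrC.
  by move: sc; rewrite in_itv/= => /andP[s0 sc]; rewrite !ger0_norm.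
have [s||s sc E] := @MVT_segment R h (fun s => 'D_v f (s *: v + y)) c 0 (ltW c0).
- rewrite in_itv/= => /andP[s0 sc]; apply: dh.
  by rewrite !ler0_norm ?lerN2// ltW.
- apply: continuous_in_subspaceT => s; rewrite inE/= in_itv/= => /andP[s0 sc].
  by apply: ch; rewrite !ler0_norm ?lerN2// ltW.
exists s.
  by move: sc; rewrite in_itv/= => /andP[s0 sc]; rewrite !ler0_norm ?lerN2// ltW.
by rewrite hc h0 -opprB E sub0r mulrN opprK mulrC.
Qed.

Lemma differentiable_sumr (V : normedModType R) m (F : 'I_m -> V -> R) (x : V) :
  (forall i, differentiable (F i) x) ->
  differentiable (fun w => \sum_(i < m) F i w) x.
Proof.
move=> dF; rewrite (_ : (fun w => _) = \sum_(i < m) F i).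
  exact: differentiable_sum.
by apply/funext => y; rewrite fct_sumE.
Qed.

Lemma differentiable_expansion (V W : normedModType R) (f : V -> W)
    (df : {linear V -> W}) (x : V) : continuous df ->
  (forall e : R, 0 < e ->
     \forall h \near (0 : V), `|f (h + x) - f x - df h| <= e * `|h|) ->
  differentiable f x.
Proof.
move=> cdf exp.
have E : f \o shift x = cst (f x) + df +o_ 0 id.
  apply/eqaddoP => e e0; near=> h.
  have : `|f (h + x) - f x - df h| <= e * `|h| by near: h; exact: exp.
  by rewrite -addrA -opprD.
by apply/diff_locallyP; rewrite (diff_unique cdf E).
Unshelve. all: by end_near. Qed.

Definition linear_form (a : 'rV[R]_n) (h : 'rV[R]_n) : R := \sum_i h 0 i * a 0 i.

Lemma linear_form_is_linear a : linear (linear_form a).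
Proof.
move=> k u w; rewrite /linear_form scaler_sumr -big_split/=.
by apply: eq_bigr => i _; rewrite !mxE mulrDl -mulrA.
Qed.

HB.instance Definition _ a :=
  GRing.isLinear.Build R 'rV[R]_n R _ (linear_form a) (linear_form_is_linear a).

Lemma continuous_linear_form a : continuous (linear_form a).
Proof.
move=> x; apply: differentiable_continuous; apply: differentiable_sumr => i.
apply: differentiableM; last exact: differentiable_cst.
exact: differentiable_coord.
Qed.

(* The first [k] coordinates of [h]: the vertices of a path from [0] to [h]
   whose edges are parallel to the axes. *)
Let trunc (h : 'rV[R]_n) (k : nat) : 'rV[R]_n := \row_i (if (i < k)%N then h 0 i else 0).

Let truncS h (k : 'I_n) : trunc h k.+1 = h 0 k *: e_ k + trunc h k.
Proof.
apply/rowP => i; rewrite !mxE eqxx/= ltnS leq_eqVlt.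
have [->|ik] := eqVneq i k; first by rewrite eqxx ltnn/= mulr1 addr0.
have /negbTE -> : nat_of_ord i != k by [].
by rewrite mulr0 add0r.
Qed.

(** Telescoping along the path of truncations of [h] and using the mean value
    theorem on each edge, the error is a sum of [n] terms
    [h_k (d_k f (xi_k) - d_k f (x))]. *)
Lemma C1_expansion f x (e : R) : 0 < e ->
  (\forall y \near x, forall i, derivable f y (e_ i)) ->
  (forall i, {for x, continuous (partial i f)}) ->
  \forall h \near (0 : 'rV[R]_n),
    `|f (h + x) - f x - linear_form (grad f x) h| <= e * `|h|.
Proof.
move=> e0 df cf.
pose e' := e / n.+1%:R.
have e'0 : 0 < e' by rewrite divr_gt0.
have : \forall y \near x, forall i, derivable f y (e_ i) /\
     `|partial i f x - partial i f y| <= e'.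
  have : \forall y \near x, forall i, `|partial i f x - partial i f y| <= e'.
    have H i : \forall y \near x, `|partial i f x - partial i f y| <= e'.
      exact: (cvgrPdist_le _ _).1 (cf i) _ e'0.
    exact: (@filter_forall _ _ (fun i y => `|partial i f x - partial i f y| <= e')
      (nbhs x) _ H).
  by move=> H; apply: filterS (filterI df H) => y [dy Hy] i; split.
move=> /nbhs_ballP[d /= d0 dP].
apply/nbhs_ballP; exists d => //= h; rewrite -ball_normE/= sub0r normrN => hd.
have hk (k : 'I_n) (s : R) : `|s| <= `|h 0 k| ->
    ball x d (s *: e_ k + (trunc h k + x)).
  move=> sh; rewrite -ball_normE/= addrA opprD addrCA subrr addr0 normrN.
  apply: le_lt_trans hd; apply: norm_le_coord => // i.
  rewrite !mxE eqxx/=; have [->|ik] := eqVneq i k.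
    by rewrite ltnn mulr1 addr0 (le_trans sh)// coord_le_norm.
  rewrite mulr0 add0r; case: ifP => _; last by rewrite normr0.
  exact: coord_le_norm.
have -> : f (h + x) - f x = \sum_(k < n) (f (trunc h k.+1 + x) - f (trunc h k + x)).
  rewrite -(big_mkord xpredT (fun k => f (trunc h k.+1 + x) - f (trunc h k + x))).
  rewrite telescope_sumr//; congr (f (_ + x) - f _).
    by apply/rowP => i; rewrite mxE ltn_ord.
  by rewrite (_ : trunc h 0 = 0) ?add0r//; apply/rowP => i; rewrite !mxE.
rewrite /linear_form -sumrB.
apply: le_trans (ler_norm_sum _ _ _) _.
apply: (@le_trans _ _ (\sum_(k < n) e' * `|h|)); last first.
  rewrite sumr_const card_ord -mulr_natl mulrA ler_wpM2r// /e'.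
  rewrite mulrA ler_pdivrMr// mulrC ler_pM2l// ler_nat//.
apply: ler_sum => k _; rewrite truncS -(addrA (h 0 k *: _)).
have [s sh ->] := @MVT_direction f (trunc h k + x) (e_ k) (h 0 k)
  (fun s sh => (dP _ (hk k s sh) k).1).
rewrite mxE -mulrBr normrM mulrC ler_pM// ?coord_le_norm//.
by rewrite distrC; exact: (dP _ (hk k s sh) k).2.
Unshelve. all: by end_near. Qed.

Lemma C1_differentiable f x :
  (\forall y \near x, forall i, derivable f y (e_ i)) ->
  (forall i, {for x, continuous (partial i f)}) ->
  differentiable f x.
Proof.
move=> df cf.
apply: (@differentiable_expansion _ _ _ (linear_form (grad f x))).
  exact: continuous_linear_form.
by move=> e e0; exact: C1_expansion.
Qed.

(** Schwarz's theorem.  The second difference of [f] on a small square can be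
    written as a mixed derivative at some point of the square in either
    order; let the square shrink. *)
Lemma partial_comm (A : set 'rV[R]_n) f x i j : open A -> A x ->
  (forall y, A y -> derivable f y (e_ i) /\ derivable f y (e_ j)) ->
  (forall y, A y -> derivable (partial i f) y (e_ j) /\
                    derivable (partial j f) y (e_ i)) ->
  {for x, continuous (partial i (partial j f))} ->
  {for x, continuous (partial j (partial i f))} ->
  partial i (partial j f) x = partial j (partial i f) x.
Proof.
move=> oA Ax df ddf cij cji.
apply/eqP; rewrite -subr_eq0 -normr_le0; apply/ler_addgt0Pl => e e0; rewrite addr0.
have : \forall y \near x, A y /\
    (`|partial i (partial j f) x - partial i (partial j f) y| <= e / 2 /\
     `|partial j (partial i f) x - partial j (partial i f) y| <= e / 2).
  have e2 : 0 < e / 2 by rewrite divr_gt0.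
  have H1 : \forall y \near x, `|partial i (partial j f) x - partial i (partial j f) y| <= e / 2.
    exact: (cvgrPdist_le _ _).1 cij _ e2.
  have H2 : \forall y \near x, `|partial j (partial i f) x - partial j (partial i f) y| <= e / 2.
    exact: (cvgrPdist_le _ _).1 cji _ e2.
  exact: filterI (open_nbhs_nbhs (conj oA Ax)) (filterI H1 H2).
move=> /nbhs_ballP[d /= d0 dP].
pose t := d / 3.
have t0 : 0 < t by rewrite divr_gt0.
have inA (k l : 'I_n) (s s' : R) : `|s| <= `|t| -> `|s'| <= `|t| ->
    ball x d (s *: e_ k + (s' *: e_ l + x)).
  rewrite (gtr0_norm t0) => st s't.
  rewrite -ball_normE/= addrA opprD addrCA subrr addr0 normrN.
  apply: (@le_lt_trans _ _ (t + t)); last by rewrite /t; lra.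
  apply: norm_le_coord => [|o]; first by rewrite addr_ge0// ltW.
  rewrite !mxE eqxx/= (le_trans (ler_normD _ _))// lerD// normrM.
    by case: eqP => _; rewrite ?normr1 ?mulr1// normr0 mulr0 ltW.
  by case: eqP => _; rewrite ?normr1 ?mulr1// normr0 mulr0 ltW.
have t00 : `|0 : R| <= `|t| by rewrite normr0.
(* Two applications of the mean value theorem: first to the increment of [f] in
   the direction [l], as a function along [k], then to [d_k f] along [l]. *)
have mixed (k l : 'I_n) :
    (forall y, A y -> derivable f y (e_ k)) ->
    (forall y, A y -> derivable (partial k f) y (e_ l)) ->
    exists y, ball x d y /\
    (f (t *: e_ k + (t *: e_ l + x)) - f (t *: e_ l + x)) -
    (f (t *: e_ k + x) - f x) = t * (t * partial l (partial k f) y).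
  move=> dk dl.
  pose g y := f (t *: e_ l + y) - f y.
  have gE (y : 'rV[R]_n) : (f \o +%R (t *: e_ l)) y = f (t *: e_ l + y) by [].
  have dfs (s : R) : `|s| <= `|t| -> is_derive (s *: e_ k + x) (e_ k) g
      (partial k f (t *: e_ l + (s *: e_ k + x)) - partial k f (s *: e_ k + x)).
    move=> st.
    have A1 : A (t *: e_ l + (s *: e_ k + x)) by exact: (dP _ (inA l k t s _ st)).1.
    have A2 : A (s *: e_ k + x).
      by have := (dP _ (inA l k 0 s t00 st)).1; rewrite scale0r add0r.
    have Q : (fun k' : R => k'^-1 *: (((fun y => f (t *: e_ l + y)) \o
          shift (s *: e_ k + x)) (k' *: e_ k) - f (t *: e_ l + (s *: e_ k + x)))) =
        (fun k' : R => k'^-1 *: ((f \o shift (t *: e_ l + (s *: e_ k + x))) (k' *: e_ k) -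
          f (t *: e_ l + (s *: e_ k + x)))).
      by apply/funext => k'; rewrite /shift/= addrCA.
    apply: is_deriveB.
      by apply: DeriveDef; [rewrite /derivable Q; exact: dk|rewrite /derive Q].
    by apply: DeriveDef; first exact: dk.
  have [s st gs] := @MVT_direction g x (e_ k) t (fun s st => @ex_derive _ _ _ _ _ _ _ (dfs s st)).
  have [s' s't fs'] := @MVT_direction (partial k f) (s *: e_ k + x) (e_ l) t
    (fun s' s't => dl _ (dP _ (inA l k s' s s't st)).1).
  exists (s' *: e_ l + (s *: e_ k + x)); split; first exact: inA.
  rewrite -fs' -(@derive_val _ _ _ _ _ _ _ (dfs s st)) -gs /g.
  by rewrite addrCA; lra.
have [y [By Ey]] := mixed i j (fun y Ay => (df y Ay).1) (fun y Ay => (ddf y Ay).1).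
have [z [Bz Ez]] := mixed j i (fun y Ay => (df y Ay).2) (fun y Ay => (ddf y Ay).2).
have yz : partial j (partial i f) y = partial i (partial j f) z.
  have : t * (t * partial j (partial i f) y) = t * (t * partial i (partial j f) z).
    apply: (etrans (esym Ey)); apply: (etrans _ Ez).
    rewrite (addrCA (t *: e_ i)).
    by move: (f _) (f _) (f _) (f _) => a b c a'; ring.
  by move=> /(mulfI (lt0r_neq0 t0))/(mulfI (lt0r_neq0 t0)).
have [_ [Hz _]] := dP _ Bz; have [_ [_ Hy]] := dP _ By.
rewrite (_ : _ - _ = (partial i (partial j f) x - partial i (partial j f) z) -
  (partial j (partial i f) x - partial j (partial i f) y)); last first.
  by rewrite yz; move: (partial _ _ _) (partial _ _ _) (partial _ _ _) => a b c; ring.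
apply: le_trans (ler_normB _ _) _; rewrite [leRHS](splitr e); exact: lerD Hz Hy.
Qed.

End partials.

(** * Calculus of functions of class C^1 on an open set *)

Section C1_functions.
Context {R : realType} {n : nat}.
Implicit Types (f g : 'rV[R]_n -> R) (x y : 'rV[R]_n) (A : set 'rV[R]_n).
Local Notation e_ i := (delta_mx 0 i : 'rV[R]_n).

Lemma continuous_addr f g x : {for x, continuous f} -> {for x, continuous g} ->
  {for x, continuous (fun y => f y + g y)}.
Proof. by move=> cf cg; exact: (cvgD cf cg). Qed.

Lemma continuous_mulr f g x : {for x, continuous f} -> {for x, continuous g} ->
  {for x, continuous (fun y => f y * g y)}.
Proof. by move=> cf cg; exact: (cvgM cf cg). Qed.

Lemma continuous_sumr m (F : 'I_m -> 'rV[R]_n -> R) x :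
  (forall j, {for x, continuous (F j)}) ->
  {for x, continuous (fun y => \sum_j F j y)}.
Proof.
move=> cF; rewrite (_ : (fun y => _) = \sum_j F j); last first.
  by apply/funext => y; rewrite fct_sumE.
elim/big_ind : _ => [|f g cf cg|//]; first exact: cst_continuous.
exact: continuous_addr.
Qed.

Lemma smooth_on_sub A B f : A `<=` B -> smooth_on B f -> smooth_on A f.
Proof. by move=> AB sf s x Ax; apply: sf; exact: AB. Qed.

Definition C1_on A f : Prop :=
  forall x, A x -> differentiable f x /\ forall i, {for x, continuous (partial i f)}.

Lemma C1_on_continuous A f x : C1_on A f -> A x -> {for x, continuous f}.
Proof. by move=> Cf /Cf[df _]; exact: differentiable_continuous. Qed.

Lemma C1_on_derivable A f x i : C1_on A f -> A x -> derivable f x (e_ i).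
Proof. by move=> Cf /Cf[df _]; exact: diff_derivable. Qed.

Lemma continuous_near_eq f g x : (\forall y \near x, f y = g y) ->
  {for x, continuous f} -> {for x, continuous g}.
Proof.
move=> fg cf; have gx := nbhs_singleton fg; rewrite /prop_for /continuous_at -gx.
by move=> P /cf; rewrite !nbhs_simpl/=; apply: filterS2 fg => y /= <-.
Qed.

Lemma partial_near_eq f g x i : (\forall y \near x, f y = g y) ->
  partial i f x = partial i g x.
Proof. exact: near_eq_derive. Qed.

Lemma near_eq_on A f g x : open A -> (forall y, A y -> f y = g y) -> A x ->
  \forall y \near x, f y = g y.
Proof.
move=> oA fg Ax; have : nbhs x A by exact: open_nbhs_nbhs.
by apply: filterS => y /fg.
Qed.

(** Continuity of the partial derivatives can be checked on any formula that
    they satisfy on [A]: only their values near the point matter. *)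
Lemma C1_on_of A f (df : 'I_n -> 'rV[R]_n -> R) : open A ->
  (forall x, A x -> differentiable f x) ->
  (forall i x, A x -> partial i f x = df i x) ->
  (forall i x, A x -> {for x, continuous (df i)}) ->
  C1_on A f.
Proof.
move=> oA dif E cdf x Ax; split; first exact: dif.
move=> i; apply: continuous_near_eq (cdf i x Ax).
by apply: near_eq_on oA _ Ax => y Ay; rewrite E.
Qed.

Lemma C1_on_ext A f g : open A -> (forall y, A y -> f y = g y) ->
  C1_on A f -> C1_on A g.
Proof.
move=> oA fg Cf.
have E i x : A x -> partial i g x = partial i f x.
  by move=> Ax; apply: partial_near_eq; apply: (near_eq_on oA) Ax => y /fg.
apply: (@C1_on_of _ _ (fun i => partial i f)) => //; last first.
  by move=> i x Ax; case: (Cf x Ax).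
move=> x Ax; apply: (@C1_differentiable R n); last first.
  move=> i; apply: continuous_near_eq ((Cf x Ax).2 i).
  by apply: near_eq_on oA _ Ax => y Ay; rewrite E.
have : nbhs x A by exact: open_nbhs_nbhs.
apply: filterS => y Ay i.
apply: (@near_eq_derivable _ _ _ f g y (e_ i) _ (C1_on_derivable Cf Ay)).
exact: near_eq_on oA fg Ay.
Qed.

Lemma smooth_on_C1 A f (s : seq 'I_n) : open A -> smooth_on A f ->
  C1_on A (iter_partial s f).
Proof.
move=> oA sf x Ax.
have c i y : A y -> {for y, continuous (partial i (iter_partial s f))}.
  by move=> Ay; have [] := sf (i :: s) y Ay.
split=> [|i]; last exact: c.
apply: C1_differentiable => [|i]; last exact: c.
have : nbhs x A by exact: open_nbhs_nbhs.
by apply: filterS => y Ay i; have [_] := sf s y Ay; exact.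
Qed.

Lemma C1_on_cst A (c : R) : C1_on A (fun=> c).
Proof.
move=> x _; split; first exact: differentiable_cst.
move=> i; rewrite (_ : partial i _ = fun=> 0); first exact: cst_continuous.
by apply/funext => y; rewrite /partial derive_cst.
Qed.

Lemma partial_cst (c : R) i x : partial i (fun=> c) x = 0.
Proof. exact: derive_cst. Qed.

Lemma partial_coord j i x : partial i (fun y => y 0 j) x = (j == i)%:R.
Proof.
rewrite /partial deriveE; last exact: differentiable_coord.
have lin : linear (fun y : 'rV[R]_n => y 0 j : R).
  by move=> k u v; rewrite !mxE.
pose l : {linear 'rV[R]_n -> R} := HB.pack (fun y : 'rV[R]_n => y 0 j : R)
  (GRing.isLinear.Build _ _ _ _ _ lin).
have -> := @diff_lin R 'rV[R]_n R l x (@coord_continuous R 1 n 0 j).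
by rewrite /= mxE eqxx.
Qed.

Lemma C1_on_coord A j : C1_on A (fun y => y 0 j).
Proof.
move=> x _; split; first exact: differentiable_coord.
move=> i; rewrite (_ : partial i _ = fun=> (j == i)%:R); first exact: cst_continuous.
by apply/funext => y; exact: partial_coord.
Qed.

Lemma partialD f g i x : differentiable f x -> differentiable g x ->
  partial i (fun y => f y + g y) x = partial i f x + partial i g x.
Proof. by move=> df dg; apply: deriveD; exact: diff_derivable. Qed.

Lemma partialM f g i x : differentiable f x -> differentiable g x ->
  partial i (fun y => f y * g y) x = f x * partial i g x + g x * partial i f x.
Proof. by move=> df dg; apply: deriveM; exact: diff_derivable. Qed.

Lemma partial_sum m (F : 'I_m -> 'rV[R]_n -> R) i x :
  (forall j, differentiable (F j) x) ->
  partial i (fun y => \sum_j F j y) x = \sum_j partial i (F j) x.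
Proof.
move=> dF; rewrite /partial (_ : (fun y => _) = \sum_(j < m) F j); last first.
  by apply/funext => y; rewrite fct_sumE.
by rewrite derive_sum// => j; exact: diff_derivable.
Qed.

Lemma C1_onD A f g : open A -> C1_on A f -> C1_on A g ->
  C1_on A (fun y => f y + g y).
Proof.
move=> oA Cf Cg.
apply: (@C1_on_of _ _ (fun i x => partial i f x + partial i g x)) => //.
- by move=> x Ax; apply: differentiableD; [case: (Cf x Ax)|case: (Cg x Ax)].
- by move=> i x Ax; apply: partialD; [case: (Cf x Ax)|case: (Cg x Ax)].
- by move=> i x Ax; apply: continuous_addr; [exact: ((Cf x Ax).2 i)|exact: ((Cg x Ax).2 i)].
Qed.

Lemma C1_onM A f g : open A -> C1_on A f -> C1_on A g ->
  C1_on A (fun y => f y * g y).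
Proof.
move=> oA Cf Cg.
apply: (@C1_on_of _ _ (fun i x => f x * partial i g x + g x * partial i f x)) => //.
- by move=> x Ax; apply: differentiableM; [case: (Cf x Ax)|case: (Cg x Ax)].
- by move=> i x Ax; apply: partialM; [case: (Cf x Ax)|case: (Cg x Ax)].
move=> i x Ax; apply: continuous_addr; apply: continuous_mulr.
- exact: C1_on_continuous Cf Ax.
- exact: ((Cg x Ax).2 i).
- exact: C1_on_continuous Cg Ax.
- exact: ((Cf x Ax).2 i).
Qed.

Lemma C1_on_sum A m (F : 'I_m -> 'rV[R]_n -> R) : open A ->
  (forall j, C1_on A (F j)) -> C1_on A (fun y => \sum_j F j y).
Proof.
move=> oA CF.
rewrite (_ : (fun y => _) = \sum_j F j); last by apply/funext => y; rewrite fct_sumE.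
elim/big_ind : _ => [|f g Cf Cg|j _]; [exact: C1_on_cst| |exact: CF].
exact: C1_onD.
Qed.

Lemma partial_comp_fun (phi : R -> R) f i x : derivable phi (f x) 1 ->
  differentiable f x ->
  partial i (phi \o f) x = derive1 phi (f x) * partial i f x.
Proof.
move=> /derivable1_diffP dphi df.
rewrite /partial !deriveE//; last exact: differentiable_comp.
rewrite diff_comp//= derive1E'// -[X in 'd _ _ X = _]mulr1.
by rewrite [LHS]linearZ mulrC.
Qed.

Lemma C1_on_comp_fun A (phi : R -> R) f : open A ->
  (forall t, derivable phi t 1) -> continuous (derive1 phi) ->
  C1_on A f -> C1_on A (phi \o f).
Proof.
move=> oA dphi cphi Cf.
apply: (@C1_on_of _ _ (fun i x => derive1 phi (f x) * partial i f x)) => //.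
- move=> x Ax; apply: differentiable_comp; first by case: (Cf x Ax).
  exact/derivable1_diffP.
- by move=> i x Ax; apply: partial_comp_fun => //; case: (Cf x Ax).
- move=> i x Ax; apply: continuous_mulr; last exact: ((Cf x Ax).2 i).
  apply: (@continuous_comp _ _ _ f (derive1 phi)); last exact: cphi.
  exact: C1_on_continuous Cf Ax.
Qed.

Lemma differentiable_row (w : 'I_n -> 'rV[R]_n -> R) x :
  (forall j, differentiable (w j) x) ->
  differentiable (fun y => \row_j w j y) x.
Proof.
move=> dw.
rewrite (_ : (fun y => _) = \sum_(j < n) (fun y => w j y *: e_ j)); last first.
  apply/funext => y; rewrite fct_sumE; apply/rowP => k.
  rewrite mxE summxE (bigD1 k)//= big1 => [|j jk]; last first.
    by rewrite !mxE eq_sym (negbTE jk) mulr0.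
  by rewrite !mxE !eqxx mulr1 addr0.
by apply: differentiable_sum => j; exact: differentiableZl.
Qed.

Lemma partial_comp_row f (w : 'I_n -> 'rV[R]_n -> R) i x :
  (forall j, differentiable (w j) x) ->
  differentiable f (\row_j w j x) ->
  partial i (fun y => f (\row_j w j y)) x =
  \sum_j partial j f (\row_j w j x) * partial i (w j) x.
Proof.
move=> dw df; pose W y := \row_j w j y : 'rV[R]_n.
have dW := differentiable_row dw.
rewrite /partial (_ : (fun y => _) = f \o W)// deriveE; last exact: differentiable_comp.
rewrite diff_comp//= -[X in 'd f _ X]deriveE//.
rewrite derive_mx; last exact: diff_derivable.
rewrite [X in 'd f _ X](_ : _ = \sum_j ('D_(e_ i) (w j) x) *: e_ j); last first.
  apply/rowP => k.
  rewrite mxE summxE (bigD1 k)//= big1 => [|j jk]; last first.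
    by rewrite !mxE eq_sym (negbTE jk) mulr0.
  rewrite !mxE !eqxx mulr1 addr0.
  by congr ('D_ _ _ _); apply/funext => y; rewrite mxE.
rewrite linear_sum; apply: eq_bigr => j _.
by rewrite linearZ [LHS]mulrC; congr (_ * _); rewrite [RHS]deriveE.
Qed.

Lemma C1_on_comp_row A f (w : 'I_n -> 'rV[R]_n -> R) : open A ->
  C1_on setT f -> (forall j, C1_on A (w j)) ->
  C1_on A (fun y => f (\row_j w j y)).
Proof.
move=> oA Cf Cw.
have dw x j : A x -> differentiable (w j) x by move=> Ax; case: (Cw j x Ax).
apply: (@C1_on_of _ _ (fun i x =>
  \sum_j partial j f (\row_j w j x) * partial i (w j) x)) => //.
- move=> x Ax.
  apply: (@differentiable_comp _ _ _ _ (fun y => \row_j w j y : 'rV[R]_n) f).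
    by apply: differentiable_row => j; exact: dw.
  by case: (Cf (\row_j w j x) I).
- move=> i x Ax; apply: partial_comp_row => [j|]; first exact: dw.
  by case: (Cf (\row_j w j x) I).
move=> i x Ax.
apply: continuous_sumr => j.
apply: continuous_mulr; last exact: ((Cw j x Ax).2 i).
apply: (@continuous_comp _ _ _ (fun y => \row_j w j y : 'rV[R]_n) (partial j f)).
  by apply/differentiable_continuous/differentiable_row => k; exact: dw.
exact: ((Cf _ I).2 j).
Qed.

(** A function of class C^1 on [A] that vanishes off a compact [K] inside [A]
    is of class C^1 on the whole space: every point is in [A] or in the open
    complement of [K].  This is what makes test functions built from [u]
    admissible although [u] is controlled on [A] only. *)
Lemma C1c_of_support A (K : set 'rV[R]_n) f : open A -> C1_on A f ->
  closed K -> bounded_set K -> K `<=` A -> (forall x, ~ K x -> f x = 0) ->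
  C1c f.
Proof.
move=> oA Cf cK bK KA f0.
have near0 x : ~ K x -> \forall y \near x, f y = 0.
  move=> Kx; have : nbhs x (~` K).
    by apply: open_nbhs_nbhs; split=> //; exact: closed_openC.
  by apply: filterS.
have near0' x i : ~ K x -> \forall y \near x, partial i f y = 0.
  move=> Kx; have : nbhs x (~` K).
    by apply: open_nbhs_nbhs; split=> //; exact: closed_openC.
  apply: filterS => y Ky.
  by rewrite (partial_near_eq (g := fun=> 0)) ?partial_cst//; exact: near0.
split.
- move=> x i; have [Ax|Kx] : A x \/ ~ K x.
  + by have [/KA|] := pselect (K x); [left|right].
  + exact: C1_on_derivable Cf Ax.
  + apply: (@near_eq_derivable _ _ _ (fun=> 0)); last exact: derivable_cst.
    by apply: filterS (near0 x Kx) => y ->.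
- move=> i x; have [Ax|Kx] : A x \/ ~ K x.
  + by have [/KA|] := pselect (K x); [left|right].
  + exact: ((Cf x Ax).2 i).
  + apply: (@continuous_near_eq (fun=> 0)); last exact: cst_continuous.
    by apply: filterS (near0' x i Kx) => y ->.
- move=> x; have [Ax|Kx] : A x \/ ~ K x.
  + by have [/KA|] := pselect (K x); [left|right].
  + exact: C1_on_continuous Cf Ax.
  + apply: (@continuous_near_eq (fun=> 0)); last exact: cst_continuous.
    by apply: filterS (near0 x Kx) => y ->.
have [M [Mr KM]] := bK.
exists (M + 1) => x xM; apply: f0 => Kx.
have /= := KM (M + 1) ltac:(by rewrite ltrDl) x Kx.
by rewrite leNgt xM.
Qed.

End C1_functions.

(** * Powers of the positive part *)

Section pospow.
Context {R : realType}.

Definition pos (t : R) := Num.max t 0.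

Lemma pos_ge0 t : 0 <= pos t. Proof. by rewrite le_max lexx orbT. Qed.

Lemma pos_mul t : t * pos t = pos t ^+ 2.
Proof. by rewrite /pos /Num.max; case: ltP => _; rewrite ?mulr0 ?expr0n//= expr2. Qed.

Lemma continuous_pos : continuous pos.
Proof. by move=> t; apply: continuous_max; [exact: cvg_id|exact: cvg_cst]. Qed.

(** The remainder is at most [h ^ 2] wherever [t] and [t + h] lie with respect to
    [0].  Higher powers follow by the product rule from
    [t * pos t = pos t ^ 2]. *)
Lemma is_derive_pos2 (t : R) : is_derive t 1 (fun s => pos s ^+ 2) (2 * pos t).
Proof.
have lim : h^-1 *: (pos (h *: 1 + t) ^+ 2 - pos t ^+ 2) @[h --> 0^'] --> 2 * pos t.
  apply/cvgrPdist_le => e e0; near=> h.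
  have h0 : h != 0 by near: h; exact: nbhs_dnbhs_neq.
  have he : `|h| <= e by near: h; exact: dnbhs0_le.
  have bnd : `|pos (h + t) ^+ 2 - pos t ^+ 2 - 2 * pos t * h| <= h ^+ 2.
    rewrite ler_norml /pos /Num.max; case: ltP => ht; case: ltP => tt;
      apply/andP; split; nra.
  rewrite [h *: 1]mulr1 -[_ *: _]/(h^-1 * _) distrC.
  rewrite (_ : _ - _ = h^-1 * (pos (h + t) ^+ 2 - pos t ^+ 2 - 2 * pos t * h)); last first.
    by field.
  rewrite normrM normfV ler_pdivrMl ?normr_gt0//.
  apply: le_trans bnd _; rewrite -real_normK ?num_real// expr2 ler_wpM2l//.
apply: DeriveDef; first by apply/cvg_ex; exists (2 * pos t).
exact: cvg_lim lim.
Unshelve. all: by end_near. Qed.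

Lemma is_derive_pospow k (t : R) :
  is_derive t 1 (fun s => pos s ^+ k.+2) (k.+2%:R * pos t ^+ k.+1).
Proof.
elim: k => [|k IH]; first by rewrite expr1; exact: is_derive_pos2.
have E : (fun s => pos s ^+ k.+3) = (fun s => s * pos s ^+ k.+2).
  by apply/funext => s; rewrite [in RHS]exprS mulrA pos_mul -exprD.
rewrite E.
have := @is_deriveM R R id (fun s => pos s ^+ k.+2) t 1 1 _ (is_derive_id _ _) IH.
move=> H; apply: is_derive_eq H _.
have P : t * pos t ^+ k.+1 = pos t ^+ k.+2 by rewrite exprS mulrA pos_mul -exprD.
transitivity (k.+2%:R * (t * pos t ^+ k.+1) + pos t ^+ k.+2).
  by congr (_ + _); [rewrite mulrCA|rewrite [LHS]mulr1].
have -> : k.+3%:R = k.+2%:R + 1 :> R by rewrite natr1.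
by rewrite P [RHS]mulrDl mul1r.
Qed.

Lemma derivable_pospow k (t : R) : derivable (fun s => pos s ^+ k.+2) t 1.
Proof. by have [] := is_derive_pospow k t. Qed.

Lemma derive1_pospow k (t : R) :
  derive1 (fun s => pos s ^+ k.+2) t = k.+2%:R * pos t ^+ k.+1.
Proof. by rewrite derive1E; have [] := is_derive_pospow k t. Qed.

Lemma continuous_derive1_pospow k : continuous (derive1 (fun s => pos s ^+ k.+2)).
Proof.
rewrite (_ : derive1 _ = fun t => k.+2%:R * pos t ^+ k.+1); last first.
  by apply/funext => t; exact: derive1_pospow.
move=> t; apply: cvgM; first exact: cst_continuous.
apply: (@continuous_comp _ _ _ pos (fun s => s ^+ k.+1)); first exact: continuous_pos.
exact: exprn_continuous.
Qed.

Lemma C1_on_pospow n (A : set 'rV[R]_n) f k : open A -> C1_on A f ->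
  C1_on A (fun y => pos (f y) ^+ k.+2).
Proof.
move=> oA Cf; apply: (@C1_on_comp_fun _ _ _ (fun s => pos s ^+ k.+2)) => //.
- by move=> t; exact: derivable_pospow.
- exact: continuous_derive1_pospow.
Qed.

Lemma partial_pospow n (f : 'rV[R]_n -> R) k i x : differentiable f x ->
  partial i (fun y => pos (f y) ^+ k.+2) x =
  k.+2%:R * pos (f x) ^+ k.+1 * partial i f x.
Proof.
move=> df; rewrite (partial_comp_fun (phi := fun s => pos s ^+ k.+2))//.
  by rewrite derive1_pospow.
exact: derivable_pospow.
Qed.

End pospow.

(** * Euclidean geometry and the pointwise energy estimate *)

Section euclid.
Context {R : realType} {n : nat}.
Implicit Types (x y z : 'rV[R]_n).

Lemma dotC x y : dot x y = dot y x.
Proof. by apply: eq_bigr => i _; rewrite mulrC. Qed.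

Lemma dotDl x y z : dot (x + y) z = dot x z + dot y z.
Proof. by rewrite -big_split/=; apply: eq_bigr => i _; rewrite mxE mulrDl. Qed.

Lemma dotZl (c : R) x y : dot (c *: x) y = c * dot x y.
Proof. by rewrite mulr_sumr; apply: eq_bigr => i _; rewrite mxE mulrA. Qed.

Lemma dot0r x : dot x 0 = 0.
Proof. by rewrite dotC -(scale0r 0) dotZl mul0r. Qed.

Lemma dot_ge0 x : 0 <= dot x x.
Proof. by apply: sumr_ge0 => i _; rewrite -expr2 sqr_ge0. Qed.

Lemma enorm_ge0 x : 0 <= enorm x. Proof. exact: sqrtr_ge0. Qed.

Lemma enorm_sqr x : enorm x ^+ 2 = dot x x.
Proof. by rewrite sqr_sqrtr// dot_ge0. Qed.

Lemma dot_eq0 x : dot x x = 0 -> x = 0.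
Proof.
move=> /eqP; rewrite psumr_eq0 => [|i _]; last by rewrite -expr2 sqr_ge0.
move=> /allP h; apply/rowP => i; rewrite mxE; apply/eqP.
by have := h i (mem_index_enum _); rewrite /= mulf_eq0 orbb.
Qed.

Lemma dot_sqr_le x y : dot x y ^+ 2 <= dot x x * dot y y.
Proof.
have [/dot_eq0 ->|y0] := eqVneq (dot y y) 0.
  by rewrite !dot0r expr0n mulr0.
have yy0 : 0 < dot y y by rewrite lt0r y0 dot_ge0.
have := dot_ge0 (dot y y *: x + (- dot x y) *: y).
rewrite !dotDl ![dot _ (_ + _)]dotC !dotDl !dotZl ![dot _ (_ *: _)]dotC !dotZl.
rewrite (dotC y x) => h.
have : 0 <= dot y y * (dot x x * dot y y - dot x y ^+ 2) by move: h; nra.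
by rewrite pmulr_rge0// subr_ge0.
Qed.

Lemma dot_le x y : `|dot x y| <= enorm x * enorm y.
Proof.
rewrite -(ler_pXn2r (n := 2))// ?nnegrE ?mulr_ge0 ?enorm_ge0//.
by rewrite exprMn !enorm_sqr real_normK ?num_real// dot_sqr_le.
Qed.

Lemma ler_enormD x y : enorm (x + y) <= enorm x + enorm y.
Proof.
rewrite -(ler_pXn2r (n := 2))// ?nnegrE ?addr_ge0 ?enorm_ge0//.
rewrite enorm_sqr dotDl ![dot _ (_ + _)]dotC !dotDl sqrrD -!enorm_sqr (dotC y x).
by have := le_trans (ler_norm _) (dot_le x y); lra.
Qed.

Lemma enormZ (c : R) x : enorm (c *: x) = `|c| * enorm x.
Proof.
by rewrite /enorm dotZl dotC dotZl mulrA -expr2 sqrtrM ?sqr_ge0// sqrtr_sqr.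
Qed.

Lemma coord_le_enorm x i : `|x 0 i| <= enorm x.
Proof.
rewrite -(ler_pXn2r (n := 2))// ?nnegrE ?enorm_ge0// enorm_sqr real_normK ?num_real//.
rewrite /dot (bigD1 i)//= -expr2 lerDl sumr_ge0// => j _.
by rewrite -expr2 sqr_ge0.
Qed.

Lemma norm_le_enorm x : `|x| <= enorm x.
Proof. by apply: norm_le_coord => [|i]; [exact: enorm_ge0|exact: coord_le_enorm]. Qed.

Lemma mx_formE (A : 'M[R]_n) x y :
  mx_form A x y = \sum_i \sum_j A i j * x 0 j * y 0 i.
Proof.
rewrite /mx_form /dot; apply: eq_bigr => i _; rewrite mxE mulr_suml.
by apply: eq_bigr => j _; rewrite mxE (mulrC (A i j)).
Qed.

Lemma mx_formDr (A : 'M[R]_n) x y z : mx_form A x (y + z) = mx_form A x y + mx_form A x z.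
Proof. by rewrite /mx_form dotC dotDl !(dotC _ (x *m _)). Qed.

Lemma mx_formZr (A : 'M[R]_n) (c : R) x y : mx_form A x (c *: y) = c * mx_form A x y.
Proof. by rewrite /mx_form dotC dotZl (dotC _ (x *m _)). Qed.

Lemma mx_form_sumr (A : 'M[R]_n) x m (F : 'I_m -> 'rV[R]_n) :
  mx_form A x (\sum_k F k) = \sum_k mx_form A x (F k).
Proof.
elim/big_rec2 : _ => [|k a b _ IH]; last by rewrite mx_formDr IH.
by rewrite -(scale0r (0 : 'rV[R]_n)) mx_formZr mul0r.
Qed.

End euclid.

Section pointwise_energy.
Context {R : realType} {n : nat}.
Variables (A : 'M[R]_n) (p de dv : 'rV[R]_n) (b : 'I_n -> 'rV[R]_n).
Variables (eta s f V lo hi : R).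
Hypothesis lo0 : 0 < lo.
Hypothesis s0 : 0 <= s.
Hypothesis eta0 : 0 <= eta.
Hypothesis sV : s <= V.
Hypothesis pV : enorm p ^+ 2 <= V.
Hypothesis dvE : dv = 2 *: \sum_k p 0 k *: b k.
Hypothesis ell : forall z, lo * enorm z ^+ 2 <= mx_form A z z.
Hypothesis bnd : forall z w, `|mx_form A z w| <= hi * enorm z * enorm w.

Let X := enorm dv.
Let Y := enorm de.
Let B2 := \sum_k enorm (b k) ^+ 2.

(** The divergence of the vector field used for the energy inequality, written
    at one point: [A] stands for the Hessian of [E] at [grad u], [p] for
    [grad u], [de] and [dv] for the gradients of the cutoff function [eta] and
    of [v = |grad u|^2], [b k] for the gradient of [d_k u], and [s] for the
    excess [(v - l)_+]. *)
Definition energy_density : R :=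
  \sum_k (2 * eta * s ^+ 2 * p 0 k * mx_form A de (b k) +
          2 * eta ^+ 2 * s * p 0 k * mx_form A dv (b k) +
          eta ^+ 2 * s ^+ 2 * mx_form A (b k) (b k)) +
  f * \sum_k (2 * eta * s ^+ 2 * p 0 k * de 0 k +
          2 * eta ^+ 2 * s * p 0 k * dv 0 k +
          eta ^+ 2 * s ^+ 2 * b k 0 k).

Let mx_form_dv z : mx_form A z dv = 2 * \sum_k p 0 k * mx_form A z (b k).
Proof.
rewrite dvE mx_formZr mx_form_sumr; congr (_ * _).
by apply: eq_bigr => k _; rewrite mx_formZr.
Qed.

Let densityE : energy_density =
  eta * s ^+ 2 * mx_form A de dv + eta ^+ 2 * s * mx_form A dv dv +
  eta ^+ 2 * s ^+ 2 * \sum_k mx_form A (b k) (b k) +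
  f * (2 * eta * s ^+ 2 * dot p de + 2 * eta ^+ 2 * s * dot p dv +
       eta ^+ 2 * s ^+ 2 * \sum_k b k 0 k).
Proof.
rewrite /energy_density !mx_form_dv; congr (_ + f * _).
  rewrite !mulr_sumr -!big_split/=; apply: eq_bigr => k _; ring.
rewrite /dot !mulr_sumr -!big_split/=; apply: eq_bigr => k _; ring.
Qed.

Let trace_le : (\sum_k b k 0 k) ^+ 2 <= n%:R * B2.
Proof.
have := @dot_sqr_le R n (\row_k b k 0 k) (const_mx 1).
rewrite /dot (eq_bigr (fun k => b k 0 k)); last by move=> k _; rewrite !mxE mulr1.
move=> h; apply: le_trans h _; rewrite mulrC ler_pM//.
- by apply: sumr_ge0 => i _; rewrite !mxE mulr1.
- by apply: sumr_ge0 => i _; rewrite -expr2 sqr_ge0.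
- rewrite (eq_bigr (fun=> 1)); last by move=> k _; rewrite !mxE mulr1.
  by rewrite sumr_const card_ord.
apply: ler_sum => k _; rewrite mxE -expr2.
rewrite -real_normK ?num_real// ler_pXn2r ?nnegrE ?enorm_ge0//.
exact: coord_le_enorm.
Qed.

(** Summed over [k], the products [p_k A dv . b_k] and [p_k A de . b_k] become
    [A dv . dv / 2] and [A de . dv / 2], because [dv = 2 sum_k p_k b_k].
    Ellipticity gives the two positive quantities [lo eta^2 s |dv|^2] and
    [lo eta^2 s^2 sum_k |b_k|^2].  The first one absorbs, up to half of it, the
    cross term with [de] and the term [f p . dv]; the second one absorbs
    [f eta^2 s^2 sum_k b_kk].  What remains carries a factor [s^3 |de|^2] or
    [f^2]. *)
Lemma energy_density_ge :
  lo / 2 * eta ^+ 2 * s * enorm dv ^+ 2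
  - ((hi ^+ 2 / lo + lo) * s ^+ 3 * enorm de ^+ 2 +
     (5 + n%:R / 4) / lo * f ^+ 2 * eta ^+ 2 * V * s) <= energy_density.
Proof.
rewrite densityE.
have X0 : 0 <= X := enorm_ge0 _.
have Y0 : 0 <= Y := enorm_ge0 _.
have B0 : 0 <= B2 by apply: sumr_ge0 => k _; rewrite sqr_ge0.
have V0 : 0 <= V by apply: le_trans pV; rewrite sqr_ge0.
have es0 : 0 <= eta * s ^+ 2 by rewrite mulr_ge0 ?sqr_ge0.
have ees0 : 0 <= eta ^+ 2 * s by rewrite mulr_ge0 ?sqr_ge0.
have eess0 : 0 <= eta ^+ 2 * s ^+ 2 by rewrite mulr_ge0 ?sqr_ge0.
have lov : lo^-1 * lo = 1 by rewrite mulVf// gt_eqF.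
have lov0 : 0 < lo^-1 by rewrite invr_gt0.
pose r := Num.sqrt V.
have r0 : 0 <= r := sqrtr_ge0 _.
have rV : r ^+ 2 = V by rewrite sqr_sqrtr.
have pr : enorm p <= r.
  by rewrite -(ler_pXn2r (n := 2))// ?nnegrE ?enorm_ge0// rV.
(* Each of [T1], [F1], [F2] is Young's inequality: the difference of the two
   sides is a multiple of the square displayed.  The shares [1/4] and [1/4] of
   [lo eta^2 s |dv|^2] given up in [T1] and [F2] leave one half. *)
have T1 : - (s * (lo / 4 * (eta * X) ^+ 2 + hi ^+ 2 / lo * (s * Y) ^+ 2)) <=
    eta * s ^+ 2 * mx_form A de dv.
  have h1 : - (hi * Y * X) <= mx_form A de dv.
    by have := bnd de dv; rewrite ler_norml => /andP[].
  apply: (@le_trans _ _ (eta * s ^+ 2 * - (hi * Y * X))); last by rewrite ler_wpM2l.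
  rewrite -subr_ge0.
  have -> : eta * s ^+ 2 * - (hi * Y * X) -
     - (s * (lo / 4 * (eta * X) ^+ 2 + hi ^+ 2 / lo * (s * Y) ^+ 2)) =
     s / lo * (lo / 2 * (eta * X) - hi * (s * Y)) ^+ 2.
    by field; rewrite gt_eqF.
  by rewrite mulr_ge0 ?sqr_ge0// divr_ge0// ltW.
have T2 : eta ^+ 2 * s * (lo * X ^+ 2) <= eta ^+ 2 * s * mx_form A dv dv.
  by rewrite ler_wpM2l// ell.
have T3 : eta ^+ 2 * s ^+ 2 * (lo * B2) <=
    eta ^+ 2 * s ^+ 2 * \sum_k mx_form A (b k) (b k).
  by rewrite ler_wpM2l// /B2 mulr_sumr; apply: ler_sum => k _; exact: ell.
have dle (w : 'rV[R]_n) (c : R) : 0 <= c ->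
    - (c * (`|f| * (r * enorm w))) <= f * (c * dot p w).
  move=> c0; rewrite -mulrN (mulrCA f) ler_wpM2l//.
  have : `|f * dot p w| <= `|f| * (r * enorm w).
    rewrite normrM ler_wpM2l// (le_trans (dot_le _ _))//.
    by rewrite ler_wpM2r// enorm_ge0.
  by rewrite ler_norml => /andP[].
have ff : `|f| ^+ 2 = f ^+ 2 by rewrite real_normK ?num_real.
have F1 : - (s * (lo * (s * Y) ^+ 2 + f ^+ 2 * eta ^+ 2 * V / lo)) <=
    f * (2 * eta * s ^+ 2 * dot p de).
  apply: le_trans (dle de (2 * eta * s ^+ 2) _); last by rewrite -mulrA mulr_ge0.
  rewrite -subr_ge0 -rV -ff -/Y.
  have -> : - (2 * eta * s ^+ 2 * (`|f| * (r * Y))) -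
     - (s * (lo * (s * Y) ^+ 2 + `|f| ^+ 2 * eta ^+ 2 * r ^+ 2 / lo)) =
     s / lo * (lo * (s * Y) - `|f| * eta * r) ^+ 2.
    by field; rewrite gt_eqF.
  by rewrite mulr_ge0 ?sqr_ge0// divr_ge0// ltW.
have F2 : - (s * (lo / 4 * (eta * X) ^+ 2 + 4 * f ^+ 2 * eta ^+ 2 * V / lo)) <=
    f * (2 * eta ^+ 2 * s * dot p dv).
  apply: le_trans (dle dv (2 * eta ^+ 2 * s) _); last by rewrite -mulrA mulr_ge0.
  rewrite -subr_ge0 -rV -ff -/X.
  have -> : - (2 * eta ^+ 2 * s * (`|f| * (r * X))) -
     - (s * (lo / 4 * (eta * X) ^+ 2 + 4 * `|f| ^+ 2 * eta ^+ 2 * r ^+ 2 / lo)) =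
     s / lo * (lo / 2 * (eta * X) - 2 * `|f| * eta * r) ^+ 2.
    by field; rewrite gt_eqF.
  by rewrite mulr_ge0 ?sqr_ge0// divr_ge0// ltW.
pose t := \sum_k b k 0 k.
have F3 : - (eta ^+ 2 * s ^+ 2 * (lo * B2)) - s * (n%:R / 4 * f ^+ 2 * eta ^+ 2 * V / lo) <=
    f * (eta ^+ 2 * s ^+ 2 * t).
  have h1 : - (lo * B2) - n%:R / 4 * f ^+ 2 / lo <= f * t.
    have [n0|n0] := eqVneq (n%:R : R) 0.
      have t0 : t = 0.
        by apply/eqP; rewrite -sqrf_eq0 eq_le sqr_ge0 andbT (le_trans trace_le)// n0 mul0r.
      by rewrite t0 n0 !mul0r mulr0 subr0 oppr_le0 mulr_ge0// ltW.
    have n1 : 0 < n%:R :> R by rewrite lt0r n0 ler0n.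
    have h2 : t ^+ 2 / n%:R <= B2 by rewrite ler_pdivrMr// mulrC; exact: trace_le.
    have h3 : lo * (t ^+ 2 / n%:R) <= lo * B2 by rewrite ler_pM2l.
    have h4 : 0 <= lo / n%:R * (t + n%:R / 2 * f / lo) ^+ 2.
      by rewrite mulr_ge0 ?sqr_ge0// divr_ge0// ltW.
    have h5 : lo / n%:R * (t + n%:R / 2 * f / lo) ^+ 2 =
        lo * (t ^+ 2 / n%:R) + f * t + n%:R / 4 * f ^+ 2 / lo.
      by field; rewrite n0 gt_eqF.
    by rewrite h5 in h4; lra.
  have h6 : eta ^+ 2 * s ^+ 2 * (- (lo * B2) - n%:R / 4 * f ^+ 2 / lo) <=
     eta ^+ 2 * s ^+ 2 * (f * t) by rewrite ler_wpM2l.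
  have h7 : eta ^+ 2 * s * (n%:R / 4 * f ^+ 2 / lo) * s <=
     eta ^+ 2 * s * (n%:R / 4 * f ^+ 2 / lo) * V.
    have h8 : 0 <= n%:R / 4 * f ^+ 2 / lo.
      apply: mulr_ge0; last exact: ltW.
      by apply: mulr_ge0; [rewrite divr_ge0|exact: sqr_ge0].
    by rewrite ler_wpM2l// mulr_ge0.
  rewrite (_ : f * _ = eta ^+ 2 * s ^+ 2 * (f * t)); last by ring.
  apply: le_trans h6; rewrite -subr_ge0.
  rewrite [X in 0 <= X](_ : _ = eta ^+ 2 * s * (n%:R / 4 * f ^+ 2 / lo) * V -
    eta ^+ 2 * s * (n%:R / 4 * f ^+ 2 / lo) * s) ?subr_ge0//.
  by field; rewrite gt_eqF.
rewrite -/t -/X -/Y.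
rewrite !(mulrDr f).
move: T1 T2 T3 F1 F2 F3; rewrite -!/X -!/Y -!/t.
move: X Y B2 t (mx_form A de dv) (mx_form A dv dv) (dot p de) (dot p dv)
  (\sum_k mx_form A (b k) (b k)).
by move=> *; lra.
Qed.

End pointwise_energy.

(** * The energy inequality *)

Section supported.
Context {R : realType} {n : nat}.
Local Notation T := (n.-tuple (measurableTypeR R)).
Local Notation row := (@tuple_to_row R n).

Lemma measurable_supported (U K : set 'rV[R]_n) (g : 'rV[R]_n -> R) :
  open U -> closed K -> K `<=` U -> (forall x, U x -> {for x, continuous g}) ->
  (forall x, ~ K x -> g x = 0) -> measurable_fun setT (g \o row).
Proof.
move=> oU cK KU cg g0.
have mK := measurable_closed_row cK.
rewrite (_ : g \o row = (g \o row) \_ (row @^-1` K)).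
  apply/(measurable_restrictT _ mK).
  by apply: (measurable_fun_row oU mK) => // t Kt; exact: KU.
apply/funext => t; rewrite patchE; case: ifPn => // /negP tK /=.
by rewrite g0// => Kt; apply: tK; rewrite inE.
Qed.

Lemma C1_on_partial_comm (A : set 'rV[R]_n) (g : 'rV[R]_n -> R) i j x : open A ->
  C1_on A g -> (forall k, C1_on A (partial k g)) -> A x ->
  partial i (partial j g) x = partial j (partial i g) x.
Proof.
move=> oA Cg Cdg Ax; apply: (@partial_comm _ _ A) => //.
- by move=> y Ay; split; exact: C1_on_derivable Cg Ay.
- by move=> y Ay; split; [exact: C1_on_derivable (Cdg i) Ay|exact: C1_on_derivable (Cdg j) Ay].
- exact: (Cdg j x Ax).2.
- exact: (Cdg i x Ax).2.
Qed.

End supported.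

Section cutoff.
Context {R : realType} {n : nat}.
Variables (x0 : 'rV[R]_n) (b : R).
Implicit Types (x y : 'rV[R]_n).

Definition sqdist y : R := dot (y - x0) (y - x0).

(** A cutoff for the ball of squared radius [b], polynomial inside it.  The
    square makes it of class C^1; working with squared distances avoids the
    square root at the centre. *)
Definition cutoff y : R := pos (b - sqdist y) ^+ 2.

Lemma sqdist_ge0 y : 0 <= sqdist y. Proof. exact: dot_ge0. Qed.

Lemma C1_on_sqdist A : open A -> C1_on A sqdist.
Proof.
move=> oA; rewrite (_ : sqdist = fun y => \sum_i (y 0 i + - x0 0 i) * (y 0 i + - x0 0 i)).
  have C1c j := C1_onD oA (@C1_on_coord R n A j) (@C1_on_cst R n A (- x0 0 j)).
  exact: (C1_on_sum oA (fun j => C1_onM oA (C1c j) (C1c j))).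
by apply/funext => y; apply: eq_bigr => i _; rewrite !mxE.
Qed.

Lemma partial_sqdist i y : partial i sqdist y = 2 * (y 0 i - x0 0 i).
Proof.
have dif j (z : 'rV[R]_n) : differentiable (fun y : 'rV[R]_n => y 0 j + - x0 0 j) z.
  by case: (C1_onD openT (C1_on_coord j) (C1_on_cst (- x0 0 j)) (x := z) I).
rewrite (_ : sqdist = fun y => \sum_i (y 0 i + - x0 0 i) * (y 0 i + - x0 0 i)); last first.
  by apply/funext => z; apply: eq_bigr => j _; rewrite !mxE.
rewrite partial_sum; last by move=> j; apply: differentiableM.
have E j : partial i (fun y : 'rV[R]_n => y 0 j + - x0 0 j) y = (j == i)%:R.
  have d1 : differentiable (fun y : 'rV[R]_n => y 0 j : R) y by exact: differentiable_coord.
  have d2 : differentiable (fun=> - x0 0 j : R) y by exact: differentiable_cst.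
  by rewrite (partialD i d1 d2) partial_cst addr0 partial_coord.
rewrite (bigD1 i)//= big1 ?addr0 => [|j ji].
  by rewrite partialM// E eqxx mulr1; ring.
by rewrite partialM// E (negbTE ji) mulr0 addr0.
Qed.

Lemma C1_on_b_sqdist A : open A -> C1_on A (fun y => b + -1 * sqdist y).
Proof.
move=> oA; apply: C1_onD => //; first exact: C1_on_cst.
by apply: C1_onM => //; [exact: C1_on_cst|exact: C1_on_sqdist].
Qed.

Lemma partial_b_sqdist i y :
  partial i (fun y => b + -1 * sqdist y) y = -2 * (y 0 i - x0 0 i).
Proof.
have dN : differentiable sqdist y by case: (C1_on_sqdist openT (x := y) I).
have dc (c : R) : differentiable (fun=> c : R) y by exact: differentiable_cst.
have dm : differentiable (fun y => -1 * sqdist y) y := differentiableM (dc (-1)) dN.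
rewrite (partialD i (dc b) dm) partial_cst add0r (partialM i (dc (-1)) dN).
by rewrite partial_cst mulr0 addr0 partial_sqdist; ring.
Qed.

Let cutoff_powE k : (fun y => pos (b - sqdist y) ^+ k) =
  (fun y => pos (b + -1 * sqdist y) ^+ k).
Proof. by apply/funext => y; rewrite mulN1r. Qed.

Lemma C1_on_cutoff_pow A k : open A -> C1_on A (fun y => pos (b - sqdist y) ^+ k.+2).
Proof. by move=> oA; rewrite cutoff_powE; apply: C1_on_pospow => //; exact: C1_on_b_sqdist. Qed.

Lemma partial_cutoff_pow k i y : partial i (fun y => pos (b - sqdist y) ^+ k.+2) y =
  k.+2%:R * pos (b - sqdist y) ^+ k.+1 * (-2 * (y 0 i - x0 0 i)).
Proof.
rewrite cutoff_powE partial_pospow ?partial_b_sqdist ?mulN1r//.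
by case: (C1_on_b_sqdist openT (x := y) I).
Qed.

Lemma grad_cutoffE y : grad cutoff y = (- 4 * pos (b - sqdist y)) *: (y - x0).
Proof.
by apply/rowP => i; rewrite !mxE /cutoff (partial_cutoff_pow 0) expr1; ring.
Qed.

Lemma grad_cutoff_sqr y :
  enorm (grad cutoff y) ^+ 2 = 16 * pos (b - sqdist y) ^+ 2 * sqdist y.
Proof.
by rewrite grad_cutoffE enorm_sqr dotZl dotC dotZl /sqdist; ring.
Qed.

Definition support_ball := [set y | sqdist y <= b].

Lemma cutoff_out y : ~ support_ball y -> pos (b - sqdist y) = 0.
Proof.
by move=> /negP; rewrite -ltNge => h; apply/max_idPr; rewrite subr_le0 ltW.
Qed.

Lemma continuous_sqdist : continuous sqdist.
Proof. by move=> y; apply: (C1_on_continuous (C1_on_sqdist openT)). Qed.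

Lemma closed_support_ball : closed support_ball.
Proof.
rewrite (_ : support_ball = sqdist @^-1` [set t | t <= b])//.
apply: closed_comp => [y _|]; first exact: continuous_sqdist.
exact: closed_le.
Qed.

Lemma measurable_support_ball :
  measurable (@tuple_to_row R n @^-1` support_ball : set (n.-tuple (measurableTypeR R))).
Proof. exact: measurable_closed_row closed_support_ball. Qed.

Lemma bounded_support_ball : bounded_set support_ball.
Proof.
exists (`|x0| + Num.sqrt b); split; first exact: num_real.
move=> M xM y yb; rewrite /= -(subrK x0 y) (le_trans (ler_normD _ _))//.
apply: le_trans (ltW xM); rewrite addrC lerD2l.
apply: le_trans (norm_le_enorm _) _.
by rewrite /enorm ler_wsqrtr.
Qed.

End cutoff.

Lemma support_ball_le (R : realType) (n : nat) (x0 : 'rV[R]_n) (b b' : R) : b <= b' ->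
  support_ball x0 b `<=` support_ball x0 b'.
Proof. by move=> bb y /le_trans; apply. Qed.

Ltac pring :=
  repeat match goal with
  | |- context [partial ?i ?f ?x] =>
      let z := fresh "z" in set z := (partial i f x); clearbody z
  end; ring.

(** The algebra behind the divergence identity, with [t] a test vector, [T] its
    derivatives, [F] the derivatives of the flux, [D] their divergences and [g]
    the gradient of [f]: the terms [t k * g k] cancel, so that no derivative of
    [f] survives. *)
Lemma divergence_rearrange (R : comNzRingType) n (t g : 'I_n -> R) (f : R)
    (D F T : 'I_n -> 'I_n -> R) : (forall k, \sum_i D i k = - g k) ->
  \sum_i (\sum_k (t k * D i k) + \sum_k (F k i * T i k) +
           (f * T i i + t i * g i)) =
  \sum_k (\sum_i F k i * T i k) + f * \sum_k T k k.
Proof.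
move=> Dg; rewrite !big_split/= exchange_big/=.
rewrite (eq_bigr (fun k => - (t k * g k))); last first.
  by move=> k _; rewrite -mulr_sumr Dg mulrN.
rewrite sumrN (exchange_big _ _ _ _ _ (fun i k => F k i * T i k))/= -mulr_sumr.
ring.
Qed.

Section equation.
Context {R : realType} {n : nat}.
Local Notation T := (n.-tuple (measurableTypeR R)).
Local Notation mu := (@lebesgue_tuple R n).
Local Notation row := (@tuple_to_row R n).
Variables (U : set 'rV[R]_n) (f E u : 'rV[R]_n -> R).
Hypothesis oU : open U.
Hypothesis su : smooth_on U u.
Hypothesis sE : smooth_on setT E.
Hypothesis sf : smooth_on U f.
Hypothesis equation : forall x, U x ->
  - divergence (fun y => grad E (grad u y)) x = f x.

Definition speed2 y : R := enorm (grad u y) ^+ 2.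

Definition flux i y : R := partial i E (grad u y).

Lemma C1_u1 k : C1_on U (partial k u). Proof. exact: (smooth_on_C1 [:: k] oU su). Qed.
Lemma C1_u2 j k : C1_on U (partial j (partial k u)).
Proof. exact: (smooth_on_C1 [:: j; k] oU su). Qed.
Lemma C1_f : C1_on U f. Proof. exact: (smooth_on_C1 [::] oU sf). Qed.
Lemma C1_E1 i : C1_on setT (partial i E). Proof. exact: (smooth_on_C1 [:: i] openT sE). Qed.
Lemma C1_E2 j i : C1_on setT (partial j (partial i E)).
Proof. exact: (smooth_on_C1 [:: j; i] openT sE). Qed.

Lemma hessian_sym_u i j x : U x -> partial i (partial j u) x = partial j (partial i u) x.
Proof.
apply: (@C1_on_partial_comm _ _ U) => //; last by move=> k; exact: C1_u1.
exact: (smooth_on_C1 [::] oU su).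
Qed.

Lemma C1_flux i : C1_on U (flux i).
Proof. by apply: C1_on_comp_row => // [|j]; [exact: C1_E1|exact: C1_u1]. Qed.

Lemma partial_flux k i x : U x -> partial k (flux i) x =
  \sum_j partial j (partial i E) (grad u x) * partial k (partial j u) x.
Proof.
move=> Ux; apply: partial_comp_row => [j|]; first by case: (C1_u1 j Ux).
by case: (C1_E1 i (x := grad u x) I).
Qed.

Lemma C1_partial_flux k i : C1_on U (partial k (flux i)).
Proof.
apply: (@C1_on_ext _ _ _ (fun x => \sum_j
  partial j (partial i E) (grad u x) * partial k (partial j u) x)) => //.
  by move=> y Uy; rewrite partial_flux.
exact: (C1_on_sum oU (fun j =>
  C1_onM oU (C1_on_comp_row oU (C1_E2 j i) C1_u1) (C1_u2 k j))).
Qed.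

Lemma differentiated_equation k x : U x ->
  \sum_i partial i (partial k (flux i)) x = - partial k f x.
Proof.
move=> Ux.
transitivity (partial k (fun y => \sum_i partial i (flux i) y) x).
  rewrite partial_sum => [|i]; last by case: (C1_partial_flux i i Ux).
  apply: eq_bigr => i _.
  apply: (@C1_on_partial_comm _ _ U) => //; first exact: C1_flux.
  by move=> j; exact: C1_partial_flux.
have C1N : differentiable (fun y => -1 * f y) x.
  by apply: differentiableM; [exact: differentiable_cst|case: (C1_f Ux)].
have -> : - partial k f x = partial k (fun y => -1 * f y) x.
  rewrite partialM; [|exact: differentiable_cst|by case: (C1_f Ux)].
  by rewrite partial_cst mulr0 addr0 mulN1r.
apply: partial_near_eq; apply: (near_eq_on oU) Ux => y Uy.
rewrite -(equation Uy) mulN1r opprK /divergence.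
apply: eq_bigr => i _; congr (partial i _ y); apply/funext => z.
by rewrite mxE.
Qed.

Lemma C1_speed2 : C1_on U speed2.
Proof.
rewrite (_ : speed2 = fun y => \sum_k partial k u y * partial k u y).
  exact: (C1_on_sum oU (fun k => C1_onM oU (C1_u1 k) (C1_u1 k))).
by apply/funext => y; rewrite /speed2 enorm_sqr; apply: eq_bigr => k _; rewrite !mxE.
Qed.

Lemma partial_speed2 i x : U x ->
  partial i speed2 x = 2 * \sum_k partial k u x * partial k (partial i u) x.
Proof.
move=> Ux; rewrite (_ : speed2 = fun y => \sum_k partial k u y * partial k u y); last first.
  by apply/funext => y; rewrite /speed2 enorm_sqr; apply: eq_bigr => k _; rewrite !mxE.
have d k : differentiable (partial k u) x by case: (C1_u1 k Ux).
rewrite partial_sum; last by move=> k; apply: differentiableM.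
rewrite mulr_sumr; apply: eq_bigr => k _.
by rewrite (partialM i (d k) (d k)) (hessian_sym_u i k Ux); pring.
Qed.

Section energy.
Variables (x0 : 'rV[R]_n) (b l V lo hi : R).
Hypothesis KU : support_ball x0 b `<=` U.
Hypothesis vV : forall y, support_ball x0 b y -> speed2 y <= V.
Hypothesis l0 : 0 <= l.
Hypothesis V0 : 0 <= V.
Hypothesis lo0 : 0 < lo.
Hypothesis ell : forall y, support_ball x0 b y -> l < speed2 y ->
  forall z, lo * enorm z ^+ 2 <= mx_form (hessian E (grad u y)) z z.
Hypothesis bnd : forall y, support_ball x0 b y -> l < speed2 y ->
  forall z w, `|mx_form (hessian E (grad u y)) z w| <= hi * enorm z * enorm w.

Let eta := cutoff x0 b.

(** The power [s ^ 2] that enters the test functions is of class C^1, unlike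
    the excess itself. *)
Definition excess y : R := pos (speed2 y - l).

Let s := excess.

Let c y := pos (b - sqdist x0 y).
(* [c ^ 4] is the square of the cutoff function.  [Z] combines the differentiated
   equation, tested with [test k], and [f]; its divergence is [density]. *)
Let test k y := c y ^+ 4 * s y ^+ 2 * partial k u y.
Let Z i y := \sum_k partial k (flux i) y * test k y + f y * test i y.

Let C1_v_l : C1_on U (fun y => speed2 y + - l).
Proof. by apply: C1_onD => //; [exact: C1_speed2|exact: C1_on_cst]. Qed.

Let C1_s k : C1_on U (fun y => s y ^+ k.+2).
Proof. exact: C1_on_pospow. Qed.

Let C1_test k : C1_on U (test k).
Proof.
exact: (C1_onM oU (C1_onM oU (C1_on_cutoff_pow x0 b 2 oU) (C1_s 0)) (C1_u1 k)).
Qed.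

Let C1_Z i : C1_on U (Z i).
Proof.
exact: (C1_onD oU
  (C1_on_sum oU (fun k => C1_onM oU (C1_partial_flux k i) (C1_test k)))
  (C1_onM oU C1_f (C1_test i))).
Qed.

Let Z_out i y : ~ support_ball x0 b y -> Z i y = 0.
Proof.
move=> yb.
have t0 k : test k y = 0 by rewrite /test /c cutoff_out// expr0n !mul0r.
by rewrite /Z t0 mulr0 addr0 big1// => k _; rewrite t0 mulr0.
Qed.

Let C1c_Z i : C1c (Z i).
Proof.
exact: (C1c_of_support oU (C1_Z i) (@closed_support_ball _ _ x0 b)
  (@bounded_support_ball _ _ x0 b) KU (@Z_out i)).
Qed.

Let partial_Z_out i x : ~ support_ball x0 b x -> partial i (Z i) x = 0.
Proof.
move=> xb; rewrite -(partial_cst (0 : R) i x); apply: partial_near_eq.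
have : nbhs x (~` support_ball x0 b).
  apply: open_nbhs_nbhs; split=> //; apply: closed_openC.
  exact: closed_support_ball.
by apply: filterS => y; exact: Z_out.
Qed.

Let partial_test i k x : U x -> partial i (test k) x =
  2 * eta x * partial i eta x * s x ^+ 2 * partial k u x +
  2 * eta x ^+ 2 * s x * partial i speed2 x * partial k u x +
  eta x ^+ 2 * s x ^+ 2 * partial k (partial i u) x.
Proof.
move=> Ux.
have d1 : differentiable (fun y => c y ^+ 4) x by case: (C1_on_cutoff_pow x0 b 2 oU Ux).
have d2 : differentiable (fun y => s y ^+ 2) x by case: (C1_s 0 Ux).
have d3 : differentiable (partial k u) x by case: (C1_u1 k Ux).
have d4 : differentiable (fun y => speed2 y + - l) x by case: (C1_v_l Ux).
have d5 : differentiable speed2 x by case: (C1_speed2 Ux).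
have d6 : differentiable (fun=> - l : R) x by exact: differentiable_cst.
have d12 : differentiable (fun y => c y ^+ 4 * s y ^+ 2) x := differentiableM d1 d2.
rewrite /test (partialM i d12 d3) (partialM i d1 d2).
rewrite (partial_pospow 0 i d4) (partialD i d5 d6) partial_cst addr0.
rewrite (partial_cutoff_pow x0 b 2) /eta (partial_cutoff_pow x0 b 0).
rewrite (hessian_sym_u i k Ux) /cutoff /s /excess /c; pring.
Qed.

Let divergence_Z x : U x -> \sum_i partial i (Z i) x =
  \sum_k (\sum_i partial k (flux i) x * partial i (test k) x) +
  f x * \sum_k partial k (test k) x.
Proof.
move=> Ux.
have dt k : differentiable (test k) x by case: (C1_test k Ux).
have dfl k i : differentiable (partial k (flux i)) x by case: (C1_partial_flux k i Ux).
have df : differentiable f x by case: (C1_f Ux).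
have E1 i : partial i (Z i) x =
   \sum_k (test k x * partial i (partial k (flux i)) x) +
   \sum_k (partial k (flux i) x * partial i (test k) x) +
   (f x * partial i (test i) x + test i x * partial i f x).
  have dm k : differentiable (fun y => partial k (flux i) y * test k y) x :=
    differentiableM (dfl k i) (dt k).
  have ds : differentiable (fun y => \sum_k partial k (flux i) y * test k y) x.
    by apply: differentiable_sumr => k; exact: dm.
  have dft : differentiable (fun y => f y * test i y) x := differentiableM df (dt i).
  rewrite /Z (partialD i ds dft) (partialM i df (dt i)) (partial_sum i dm).
  congr (_ + _); rewrite -big_split/=; apply: eq_bigr => k _.
  by rewrite (partialM i (dfl k i) (dt k)); pring.
rewrite (eq_bigr _ (fun i _ => E1 i)).
apply: divergence_rearrange => k; exact: differentiated_equation.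
Qed.

Let density x : R := energy_density (hessian E (grad u x)) (grad u x)
  (grad eta x) (grad speed2 x) (fun k => \row_j partial k (partial j u) x)
  (eta x) (s x) (f x).

Let flux_form k x (w : 'rV[R]_n) : U x ->
  \sum_i partial k (flux i) x * w 0 i =
  mx_form (hessian E (grad u x)) w (\row_j partial k (partial j u) x).
Proof.
move=> Ux; rewrite mx_formE exchange_big/=; apply: eq_bigr => i _.
rewrite partial_flux// mulr_suml; apply: eq_bigr => j _.
by rewrite !mxE; pring.
Qed.

Let divergence_density x : U x -> \sum_i partial i (Z i) x = density x.
Proof.
move=> Ux; rewrite divergence_Z// /density /energy_density; congr (_ + f x * _).
  apply: eq_bigr => k _; rewrite -!flux_form// !mulr_sumr -!big_split/=.
  by apply: eq_bigr => i _; rewrite partial_test// !mxE; pring.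
apply: eq_bigr => k _; rewrite partial_test// !mxE; pring.
Qed.

Definition energy_lhs y := lo / 2 * eta y ^+ 2 * s y * enorm (grad speed2 y) ^+ 2.
Definition energy_rhs y := (hi ^+ 2 / lo + lo) * s y ^+ 3 * enorm (grad eta y) ^+ 2 +
     (5 + n%:R / 4) / lo * f y ^+ 2 * eta y ^+ 2 * V * s y.

Let energy_out x : ~ support_ball x0 b x -> energy_lhs x = 0 /\ energy_rhs x = 0.
Proof.
move=> xb; have c0 : pos (b - sqdist x0 x) = 0 by exact: cutoff_out.
have e0 : eta x = 0 by rewrite /eta /cutoff c0 expr0n.
split; first by rewrite /energy_lhs e0 expr0n/= mulr0 !mul0r.
by rewrite /energy_rhs /eta grad_cutoff_sqr -/eta e0 c0 !expr0n/= !(mulr0, mul0r) addr0.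
Qed.

Let density_ge x : U x -> energy_lhs x - energy_rhs x <= density x.
Proof.
move=> Ux.
have [xb|xb] := pselect (support_ball x0 b x); last first.
  have e0 : eta x = 0 by rewrite /eta /cutoff cutoff_out// expr0n.
  have [L0 R0] := energy_out xb.
  have D0 : density x = 0.
    rewrite /density /energy_density e0 !big1 ?mulr0 ?addr0//.
      by move=> k _; rewrite expr0n/= !(mulr0, mul0r) !addr0.
    by move=> k _; rewrite expr0n/= !(mulr0, mul0r) !addr0.
  by rewrite L0 R0 D0 subr0.
have [s0|s0] := eqVneq (s x) 0.
  have L0 : energy_lhs x = 0 by rewrite /energy_lhs s0 mulr0 mul0r.
  have R0 : energy_rhs x = 0.
    by rewrite /energy_rhs s0 expr0n/= mulr0 mul0r mulr0 addr0.
  have D0 : density x = 0.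
    rewrite /density /energy_density s0 !big1 ?mulr0 ?addr0//.
      by move=> k _; rewrite expr0n/= !(mulr0, mul0r) !addr0.
    by move=> k _; rewrite expr0n/= !(mulr0, mul0r) !addr0.
  by rewrite L0 R0 D0 subr0.
have lv : l < speed2 x.
  rewrite ltNge; apply/negP => vl; move: s0; rewrite /s /excess /pos => /eqP; apply.
  by apply/max_idPr; rewrite subr_le0.
apply: energy_density_ge => //.
- exact: pos_ge0.
- by rewrite /eta /cutoff sqr_ge0.
- rewrite /s /excess /pos /Num.max; case: ifP => _.
    by apply: le_trans (vV xb); rewrite /speed2 sqr_ge0.
  by rewrite (le_trans _ (vV xb))// gerBl.
- exact: vV.
- apply/rowP => i; rewrite !mxE partial_speed2// summxE; congr (_ * _).
  by apply: eq_bigr => k _; rewrite !mxE.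
- exact: ell.
- exact: bnd.
Qed.

Lemma continuous_grad_norm (g : 'rV[R]_n -> R) x : (forall i, {for x, continuous (partial i g)}) ->
  {for x, continuous (fun y => enorm (grad g y) ^+ 2)}.
Proof.
move=> cg; rewrite (_ : (fun y => _) = fun y => \sum_i partial i g y * partial i g y).
  by apply: continuous_sumr => i; apply: continuous_mulr.
by apply/funext => y; rewrite enorm_sqr; apply: eq_bigr => i _; rewrite !mxE.
Qed.

Lemma continuous_powr (g : 'rV[R]_n -> R) k x : {for x, continuous g} ->
  {for x, continuous (fun y => g y ^+ k)}.
Proof.
move=> cg; apply: (@continuous_comp _ _ _ g (fun t => t ^+ k)) => //.
exact: exprn_continuous.
Qed.

Lemma continuous_excess x : U x -> {for x, continuous excess}.
Proof.
move=> Ux; apply: (@continuous_comp _ _ _ (fun y => speed2 y + - l) pos).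
  exact: C1_on_continuous C1_v_l Ux.
exact: continuous_pos.
Qed.

Lemma continuous_cutoff x : {for x, continuous eta}.
Proof. exact: C1_on_continuous (C1_on_cutoff_pow x0 b 0 openT) I. Qed.

Let cont_cst (k : R) (x : 'rV[R]_n) : {for x, continuous (fun=> k)}.
Proof. exact: cst_continuous. Qed.

Lemma measurable_energy_lhs : measurable_fun setT (energy_lhs \o row).
Proof.
apply: (measurable_supported oU (@closed_support_ball _ _ x0 b) KU); last first.
  by move=> y /energy_out[].
move=> x Ux; apply: continuous_mulr; last first.
  by apply: continuous_grad_norm => i; exact: (C1_speed2 Ux).2.
apply: continuous_mulr; last exact: continuous_excess.
apply: continuous_mulr; first exact: cont_cst.
apply: continuous_powr; exact: continuous_cutoff.
Qed.

Lemma measurable_energy_rhs : measurable_fun setT (energy_rhs \o row).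
Proof.
apply: (measurable_supported oU (@closed_support_ball _ _ x0 b) KU); last first.
  by move=> y /energy_out[].
move=> x Ux; apply: continuous_addr.
  apply: continuous_mulr; last first.
    by apply: continuous_grad_norm => i; exact: (C1_on_cutoff_pow x0 b 0 openT (x := x) I).2.
  apply: continuous_mulr; first exact: cont_cst.
  by apply: continuous_powr; exact: continuous_excess.
apply: continuous_mulr; last exact: continuous_excess.
apply: continuous_mulr; last exact: cont_cst.
apply: continuous_mulr; last by apply: continuous_powr; exact: continuous_cutoff.
apply: continuous_mulr; first exact: cont_cst.
by apply: continuous_powr; exact: C1_on_continuous C1_f Ux.
Qed.

(** Caccioppoli's inequality for [v] above the level [l].  It is the integral of
    [energy_density_ge], the integral of the divergence of [Z] being zero.
    Where [v <= l] the excess vanishes, and with it all the quantities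
    compared, so ellipticity above the level suffices. *)
Lemma energy_inequality :
  (\int[mu]_t (energy_lhs (row t))%:E <= \int[mu]_t (energy_rhs (row t))%:E)%E.
Proof.
apply: (le_integral_divergence C1c_Z measurable_energy_lhs measurable_energy_rhs).
- move=> x; rewrite /energy_lhs mulr_ge0 ?sqr_ge0// mulr_ge0 ?pos_ge0//.
  by rewrite mulr_ge0 ?sqr_ge0// divr_ge0// ltW.
- move=> x; rewrite /energy_rhs addr_ge0//.
    rewrite mulr_ge0 ?sqr_ge0// mulr_ge0 ?exprn_ge0 ?pos_ge0//.
    by rewrite addr_ge0 ?divr_ge0 ?sqr_ge0// ltW.
  rewrite mulr_ge0 ?pos_ge0// mulr_ge0// mulr_ge0 ?sqr_ge0// mulr_ge0 ?sqr_ge0//.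
  by rewrite divr_ge0 ?addr_ge0 ?divr_ge0// ltW.
move=> x; have [xb|xb] := pselect (support_ball x0 b x).
  by rewrite divergence_density ?density_ge//; exact: KU.
have [-> ->] := energy_out xb.
by rewrite subr0 big1// => i _; exact: partial_Z_out.
Qed.

End energy.
End equation.

(** * One step of the De Giorgi iteration *)

(** The argument of the absolute value is a partial derivative of
    [eta^2 s^3] when [d] and [w] are those of [eta] and [s].  The first term on
    the right, summed over [n] directions, is half of [eta^2 s^3] and can be
    absorbed. *)
Lemma young_gradient_product (R : realType) (n : nat) (L eta s d w : R) : (0 < n)%N ->
  0 <= L -> 0 <= s -> 0 <= eta ->
  L * `|2 * eta * d * s ^+ 3 + 3 * eta ^+ 2 * s ^+ 2 * w| <=
  (2 * n%:R)^-1 * (eta ^+ 2 * s ^+ 3) +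
  L ^+ 2 * (4 * n%:R * (d ^+ 2 * s ^+ 3) + 9 * n%:R * (eta ^+ 2 * s * w ^+ 2)).
Proof.
move=> n0 L0 s0 e0; have n1 : 0 < n%:R :> R by rewrite ltr0n.
apply: (@le_trans _ _ (L * (2 * eta * `|d| * s ^+ 3 + 3 * eta ^+ 2 * s ^+ 2 * `|w|))).
  rewrite ler_wpM2l// (le_trans (ler_normD _ _))// lerD//.
    rewrite (normrM _ (s ^+ 3)) (normrM _ d) (ger0_norm (exprn_ge0 3 s0)).
    by rewrite ger0_norm ?mulr_ge0.
  by rewrite (normrM _ w) ger0_norm// !mulr_ge0 ?exprn_ge0.
rewrite -[d ^+ 2]real_normK ?num_real// -[w ^+ 2]real_normK ?num_real//.
rewrite -subr_ge0; move: `|d| `|w| => D W.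
have -> : (2 * n%:R)^-1 * (eta ^+ 2 * s ^+ 3) +
  L ^+ 2 * (4 * n%:R * (D ^+ 2 * s ^+ 3) + 9 * n%:R * (eta ^+ 2 * s * W ^+ 2)) -
  L * (2 * eta * D * s ^+ 3 + 3 * eta ^+ 2 * s ^+ 2 * W) =
  (4 * n%:R)^-1 * (s ^+ 3 * (eta - 4 * n%:R * L * D) ^+ 2 +
                   s * eta ^+ 2 * (s - 6 * n%:R * L * W) ^+ 2).
  by field; rewrite gt_eqF.
rewrite mulr_ge0 ?invr_ge0 ?mulr_ge0 ?ler0n//.
by rewrite addr_ge0// mulr_ge0 ?sqr_ge0 ?exprn_ge0// mulr_ge0 ?sqr_ge0.
Qed.

(** Splitting according to [x <= a] or not.  It replaces Hoelder's inequality
    for the source term: [a] is chosen later to balance the two parts. *)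
Lemma sqr_le_powR_split (R : realType) (x a q : R) : 0 < a -> 2 <= q -> 0 <= x ->
  x ^+ 2 <= a ^+ 2 + a `^ (2 - q) * x `^ q.
Proof.
move=> a0 q2 x0; have [xa|ax] := leP x a.
  by rewrite ler_wpDr ?mulr_ge0 ?powR_ge0// ler_pXn2r ?nnegrE// ltW.
have x1 : 0 < x := lt_trans a0 ax.
rewrite ler_wpDl ?sqr_ge0//.
have -> : x ^+ 2 = x `^ (2 - q) * x `^ q.
  by rewrite -powRD ?subrK ?powR_mulrn ?ltW// gt_eqF// implybT.
rewrite ler_wpM2r ?powR_ge0//.
rewrite -(opprB q 2) !powRN lef_pV2 ?posrE ?powR_gt0//.
by rewrite ge0_ler_powR ?nnegrE ?subr_ge0// ltW.
Qed.

Lemma nbhs_superlevel (R : realType) (n : nat) (U : set 'rV[R]_n) (u : 'rV[R]_n -> R)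
    (x0 y : 'rV[R]_n) (r k : R) : open U -> smooth_on U u -> U y ->
  sqdist x0 y < r -> k < speed2 u y ->
  nbhs y [set z | sqdist x0 z < r /\ k < speed2 u z].
Proof.
move=> oU su Uy yr ky; apply: filterI.
  have : {for y, continuous (sqdist x0)} by exact: continuous_sqdist.
  by move=> /(_ [set t | t < r]); apply; apply: open_nbhs_nbhs; split=> //; exact: open_lt.
have := C1_on_continuous (C1_speed2 oU su) Uy.
by move=> /(_ [set t | k < t]); apply; apply: open_nbhs_nbhs; split=> //; exact: open_gt.
Qed.

Section degiorgi_step.
Context {R : realType} {n : nat}.
Local Notation T := (n.-tuple (measurableTypeR R)).
Local Notation mu := (@lebesgue_tuple R n).
Local Notation row := (@tuple_to_row R n).
Variables (U : set 'rV[R]_n) (f E u : 'rV[R]_n -> R).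
Hypothesis n0 : (0 < n)%N.
Hypothesis oU : open U.
Hypothesis su : smooth_on U u.
Hypothesis sE : smooth_on setT E.
Hypothesis sf : smooth_on U f.
Hypothesis equation : forall x, U x ->
  - divergence (fun y => grad E (grad u y)) x = f x.
Variables (x0 : 'rV[R]_n) (b l V lo hi : R).
Hypothesis b0 : 0 <= b.
Hypothesis KU : support_ball x0 b `<=` U.
Hypothesis vV : forall y, support_ball x0 b y -> speed2 u y <= V.
Hypothesis l0 : 0 <= l.
Hypothesis V0 : 0 <= V.
Hypothesis lo0 : 0 < lo.
Hypothesis ell : forall y, support_ball x0 b y -> l < speed2 u y ->
  forall z, lo * enorm z ^+ 2 <= mx_form (hessian E (grad u y)) z z.
Hypothesis bnd : forall y, support_ball x0 b y -> l < speed2 u y ->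
  forall z w, `|mx_form (hessian E (grad u y)) z w| <= hi * enorm z * enorm w.
Variables (q a Fq L : R).
Hypothesis q2 : 2 <= q.
Hypothesis a0 : 0 < a.
Hypothesis fq : (\int[mu]_(t in row @^-1` support_ball x0 b) (`|f (row t)| `^ q)%:E <= Fq%:E)%E.
Hypothesis L0 : 0 < L.

Definition superlevel (r k : R) : set T :=
  row @^-1` [set y | sqdist x0 y < r /\ k < speed2 u y].

Hypothesis small : (mu (superlevel b l) < (L ^+ n)%:E)%E.

Lemma measurable_superlevel r k : r <= b -> measurable (superlevel r k).
Proof.
move=> rb; apply: measurable_open_row; rewrite openE => y [yr ky].
have Uy : U y by apply: KU; rewrite /support_ball/= (le_trans (ltW yr)).
exact: nbhs_superlevel oU su Uy yr ky.
Qed.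

Let eta := cutoff x0 b.
Let c y := pos (b - sqdist x0 y).
Let s := excess u l.
(* The function to which the Faber-Krahn inequality is applied; it vanishes off
   [superlevel b l]. *)
Let z y := c y ^+ 4 * s y ^+ 3.

Let C1_v_l : C1_on U (fun y => speed2 u y + - l).
Proof. by apply: C1_onD => //; [exact: (C1_speed2 oU su)|exact: C1_on_cst]. Qed.

Let C1_z : C1_on U z.
Proof.
exact: (C1_onM oU (C1_on_cutoff_pow x0 b 2 oU) (C1_on_pospow 1 oU C1_v_l)).
Qed.

Let z_out y : ~ support_ball x0 b y -> z y = 0.
Proof. by move=> yb; rewrite /z /c cutoff_out// expr0n mul0r. Qed.

Let C1c_z : C1c z.
Proof.
exact: (C1c_of_support oU C1_z (@closed_support_ball _ _ x0 b)
  (@bounded_support_ball _ _ x0 b) KU z_out).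
Qed.

Let z_ge0 y : 0 <= z y.
Proof. by rewrite mulr_ge0 ?exprn_ge0 ?pos_ge0. Qed.

Let zE y : z y = eta y ^+ 2 * s y ^+ 3.
Proof. by rewrite /z /eta /cutoff /c; ring. Qed.

Let partial_z i y : U y -> partial i z y =
  2 * eta y * partial i eta y * s y ^+ 3 +
  3 * eta y ^+ 2 * s y ^+ 2 * partial i (speed2 u) y.
Proof.
move=> Uy.
have d1 : differentiable (fun y => c y ^+ 4) y by case: (C1_on_cutoff_pow x0 b 2 oU Uy).
have d2 : differentiable (fun y => s y ^+ 3) y by case: (C1_on_pospow 1 oU C1_v_l Uy).
have d4 : differentiable (fun y => speed2 u y + - l) y by case: (C1_v_l Uy).
have d5 : differentiable (speed2 u) y by case: (C1_speed2 oU su Uy).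
have d6 : differentiable (fun=> - l : R) y by exact: differentiable_cst.
rewrite /z (partialM i d1 d2) (partial_pospow 1 i d4) (partialD i d5 d6) partial_cst addr0.
rewrite (partial_cutoff_pow x0 b 2) /eta (partial_cutoff_pow x0 b 0).
rewrite /cutoff /s /excess /c; pring.
Qed.

Let main y := 4 * n%:R * (enorm (grad eta y) ^+ 2 * s y ^+ 3).
Let lhs := energy_lhs u x0 b l lo.
Let rhs := energy_rhs f u x0 b l V lo hi.

Let main_ge0 y : 0 <= main y.
Proof.
apply: mulr_ge0; first by rewrite mulr_ge0 ?ler0n.
by apply: mulr_ge0; [exact: sqr_ge0|rewrite exprn_ge0 ?pos_ge0].
Qed.

Let lhs_ge0 y : 0 <= lhs y.
Proof.
rewrite /lhs /energy_lhs mulr_ge0 ?sqr_ge0// mulr_ge0 ?pos_ge0//.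
by rewrite mulr_ge0 ?sqr_ge0// divr_ge0// ltW.
Qed.

Let rhs_ge0 y : 0 <= rhs y.
Proof.
rewrite /rhs /energy_rhs addr_ge0//.
  rewrite mulr_ge0 ?sqr_ge0// mulr_ge0 ?exprn_ge0 ?pos_ge0//.
  by rewrite addr_ge0 ?divr_ge0 ?sqr_ge0// ltW.
rewrite mulr_ge0 ?pos_ge0// mulr_ge0// mulr_ge0 ?sqr_ge0// mulr_ge0 ?sqr_ge0//.
by rewrite divr_ge0 ?addr_ge0 ?divr_ge0// ltW.
Qed.

Let K9 := 18 * n%:R / lo.

Let K9_ge0 : 0 <= K9.
Proof. by rewrite divr_ge0 ?mulr_ge0// ltW. Qed.

Let gradient_bound y : L * \sum_i `|partial i z y| <=
  2^-1 * z y + L ^+ 2 * (main y + K9 * lhs y).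
Proof.
have [yb|yb] := pselect (support_ball x0 b y); last first.
  rewrite big1 ?mulr0 => [|i _].
    apply: addr_ge0; first by rewrite mulr_ge0.
    apply: mulr_ge0; first exact: sqr_ge0.
    apply: addr_ge0; first exact: main_ge0.
    exact: mulr_ge0 K9_ge0 (lhs_ge0 y).
  rewrite (_ : partial i z y = 0) ?normr0//.
  rewrite -(partial_cst (0 : R) i y); apply: partial_near_eq.
  have : nbhs y (~` support_ball x0 b).
    apply: open_nbhs_nbhs; split=> //; apply: closed_openC.
    exact: closed_support_ball.
  by apply: filterS => w; exact: z_out.
have Uy := KU yb.
have -> : 2^-1 * z y + L ^+ 2 * (main y + K9 * lhs y) =
   \sum_(i < n) ((2 * n%:R)^-1 * (eta y ^+ 2 * s y ^+ 3) +
     L ^+ 2 * (4 * n%:R * (partial i eta y ^+ 2 * s y ^+ 3) +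
               9 * n%:R * (eta y ^+ 2 * s y * partial i (speed2 u) y ^+ 2))).
  rewrite big_split/= sumr_const card_ord -mulr_natl; congr (_ + _).
    by rewrite zE; field; rewrite pnatr_eq0 -lt0n.
  rewrite -mulr_sumr big_split/= -!mulr_sumr -mulr_suml; congr (_ * (_ + _)).
    rewrite /main enorm_sqr /dot; congr (_ * (_ * _)).
    by apply: eq_bigr => i _; rewrite !mxE.
  rewrite /K9 /lhs /energy_lhs enorm_sqr -/eta -/s.
  have -> : dot (grad (speed2 u) y) (grad (speed2 u) y) = \sum_i partial i (speed2 u) y ^+ 2.
    by apply: eq_bigr => i _; rewrite !mxE.
  by move: (\sum_i _) => D; field; rewrite gt_eqF.
rewrite mulr_sumr; apply: ler_sum => i _; rewrite partial_z//.
by apply: young_gradient_product => //; [exact: ltW|exact: pos_ge0|exact: sqr_ge0].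
Qed.

Let mz : measurable_fun setT (z \o row).
Proof. by apply: measurable_continuous_row; case: C1c_z. Qed.

Let mpz i : measurable_fun setT (partial i z \o row).
Proof. by apply: measurable_continuous_row; case: C1c_z. Qed.

Let mmain : measurable_fun setT (main \o row).
Proof.
apply: (measurable_supported oU (@closed_support_ball _ _ x0 b) KU); last first.
  by move=> y yb; rewrite /main /eta grad_cutoff_sqr cutoff_out// expr0n/= mulr0 !mul0r mulr0.
move=> y Uy; apply: continuous_mulr; first exact: cst_continuous.
apply: continuous_mulr; last by apply: continuous_powr; exact: (continuous_excess oU su).
by apply: continuous_grad_norm => i; exact: (C1_on_cutoff_pow x0 b 0 openT (x := y) I).2.
Qed.

Let mlhs : measurable_fun setT (lhs \o row).
Proof. exact: (@measurable_energy_lhs _ _ U f u oU su x0 b l V lo hi KU). Qed.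

Let mrhs : measurable_fun setT (rhs \o row).
Proof. exact: (@measurable_energy_rhs _ _ U f u oU su sf x0 b l V lo hi KU). Qed.

Let iz := (\int[mu]_t (z (row t))%:E)%E.

Let iz_fin : iz \is a fin_num.
Proof.
rewrite ge0_fin_numE; last by apply: integral_ge0 => t _; rewrite lee_fin.
have [_ _ cz sz] := C1c_z.
have := integral_compact_support_lty cz sz.
by under eq_integral do rewrite ger0_norm//.
Qed.

Lemma support_z : (mu [set t | z (row t) != 0%R] < (L ^+ n)%:E)%E.
Proof.
apply: le_lt_trans small; apply: le_measure; rewrite ?inE.
- rewrite -[X in measurable X]setTI.
  have mz' : measurable_fun setT (EFin \o (z \o row)) by exact/measurable_EFinP.
  have := emeasurable_neq measurableT mz' 0%E.
  by under eq_set do rewrite /= eqe.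
- exact: measurable_superlevel.
move=> t /=; rewrite /z => zt; split; rewrite ltNge; apply: contra zt => h.
  by rewrite /c /pos (max_idPr _) ?expr0n ?mul0r// subr_le0.
by rewrite /s /excess /pos (max_idPr _) ?expr0n ?mulr0// subr_le0.
Qed.

(** The Faber-Krahn inequality, after absorbing half of the left-hand side; the
    energy inequality then trades the gradient of [v] for [rhs].  If the
    integral of [rhs] is infinite there is nothing to prove, and that of [z] is
    finite, so the absorption is legitimate. *)
Lemma integral_z_le : (iz <= (2 * L ^+ 2)%:E *
  ((\int[mu]_t (main (row t))%:E) + K9%:E * (\int[mu]_t (rhs (row t))%:E)))%E.
Proof.
have h1 := le_integral_volume_partial L0 C1c_z support_z.
have h2 : (iz <= \int[mu]_t ((2^-1)%:E * (z (row t))%:E +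
   (L ^+ 2)%:E * ((main (row t))%:E + K9%:E * (lhs (row t))%:E)))%E.
  have -> : iz = (\int[mu]_t (`|z (row t)|)%:E)%E.
    by apply: eq_integral => t _; rewrite ger0_norm.
  apply: le_trans h1 _.
  have mp i : measurable_fun setT (fun t : T => (`|partial i z (row t)|)%:E).
    by apply/measurable_EFinP; exact: measurableT_comp (mpz i).
  have ms : measurable_fun setT (fun t : T => \sum_(i < n) (`|partial i z (row t)|)%:E)%E.
    by apply: emeasurable_sum => i; exact: mp.
  have ps t : (0 <= \sum_(i < n) (`|partial i z (row t)|)%:E)%E.
    by apply: sume_ge0 => i _; rewrite lee_fin.
  have L0e : (0 <= L%:E)%E by rewrite lee_fin ltW.
  rewrite -ge0_integral_sum//.
  rewrite -ge0_integralZl//.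
  apply: ge0_le_integral => //.
  - by move=> t _; rewrite mule_ge0.
  - exact: measurable_funeM.
  - apply: emeasurable_funD; first by apply: measurable_funeM; exact/measurable_EFinP.
    apply: measurable_funeM; apply: emeasurable_funD; first exact/measurable_EFinP.
    by apply: measurable_funeM; exact/measurable_EFinP.
  move=> t _; rewrite sumEFin -!(EFinM, EFinD) lee_fin.
  exact: gradient_bound.
have h3 : (\int[mu]_t ((2^-1)%:E * (z (row t))%:E +
   (L ^+ 2)%:E * ((main (row t))%:E + K9%:E * (lhs (row t))%:E)) =
   (2^-1)%:E * iz + (L ^+ 2)%:E * ((\int[mu]_t (main (row t))%:E) +
     K9%:E * (\int[mu]_t (lhs (row t))%:E)))%E.
  have e1 : measurable_fun setT (fun t => (z (row t))%:E) by exact/measurable_EFinP.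
  have e2 : measurable_fun setT (fun t => (main (row t))%:E) by exact/measurable_EFinP.
  have e3 : measurable_fun setT (fun t => (lhs (row t))%:E) by exact/measurable_EFinP.
  have e4 : measurable_fun setT (fun t => K9%:E * (lhs (row t))%:E)%E by exact: measurable_funeM.
  have e5 : measurable_fun setT (fun t => (main (row t))%:E + K9%:E * (lhs (row t))%:E)%E.
    exact: emeasurable_funD.
  have p4 t : (0 <= K9%:E * (lhs (row t))%:E)%E by rewrite mule_ge0 ?lee_fin.
  have p5 t : (0 <= (main (row t))%:E + K9%:E * (lhs (row t))%:E)%E.
    by apply: adde_ge0; [rewrite lee_fin|exact: p4].
  have p1 t : (0 <= (z (row t))%:E)%E by rewrite lee_fin.
  have p2 t : (0 <= (main (row t))%:E)%E by rewrite lee_fin.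
  have p3 t : (0 <= (lhs (row t))%:E)%E by rewrite lee_fin.
  have hh : (0 <= (2^-1 : R)%:E)%E by rewrite lee_fin.
  have hL : (0 <= (L ^+ 2)%:E)%E by rewrite lee_fin sqr_ge0.
  have hK : (0 <= K9%:E)%E by rewrite lee_fin.
  have e6 : measurable_fun setT (fun t => (2^-1)%:E * (z (row t))%:E)%E by exact: measurable_funeM.
  have e7 : measurable_fun setT (fun t => (L ^+ 2)%:E *
    ((main (row t))%:E + K9%:E * (lhs (row t))%:E))%E by exact: measurable_funeM.
  have p6 t : (0 <= (2^-1)%:E * (z (row t))%:E)%E by rewrite mule_ge0.
  have p7 t : (0 <= (L ^+ 2)%:E * ((main (row t))%:E + K9%:E * (lhs (row t))%:E))%E.
    by rewrite mule_ge0.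
  rewrite ge0_integralD// ge0_integralZl// ge0_integralZl// ge0_integralD//.
  by rewrite ge0_integralZl.
have h4 : (\int[mu]_t (lhs (row t))%:E <= \int[mu]_t (rhs (row t))%:E)%E.
  exact: (energy_inequality oU su sE sf equation KU vV l0 V0 lo0 ell bnd).
rewrite h3 in h2.
set X := (\int[mu]_t (main (row t))%:E + K9%:E * \int[mu]_t (rhs (row t))%:E)%E.
have h5 : (iz <= (2^-1)%:E * iz + (L ^+ 2)%:E * X)%E.
  apply: le_trans h2 _; apply: leeD => //; apply: lee_wpmul2l; first by rewrite lee_fin sqr_ge0.
  by apply: leeD => //; apply: lee_wpmul2l; rewrite ?lee_fin.
have X0 : (0 <= X)%E.
  apply: adde_ge0; first by apply: integral_ge0 => t _; rewrite lee_fin.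
  by rewrite mule_ge0 ?lee_fin//; apply: integral_ge0 => t _; rewrite lee_fin.
move: h5 iz_fin X0; case: iz => [r| |]//; case: X => [x| |]//.
  by rewrite -!EFinM -EFinD !lee_fin => h _ _; lra.
by move=> _ _ _; rewrite gt0_muley ?leey// lte_fin mulr_gt0 ?exprn_gt0.
Qed.

(** Bounds for the coefficients of [1] and of [f ^ 2] in [main + K9 * rhs] on
    the ball, where [s <= V], [eta <= b ^ 2] and
    [|grad eta| ^ 2 <= 16 b ^ 3]. *)
Definition step_c1 := 16 * b ^+ 3 * V ^+ 3 * (4 * n%:R + K9 * (hi ^+ 2 / lo + lo)).
Definition step_c2 := K9 * ((5 + n%:R / 4) / lo) * b ^+ 4 * V ^+ 2.

Let c2_ge0 : 0 <= step_c2.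
Proof.
rewrite /step_c2 mulr_ge0 ?sqr_ge0// mulr_ge0 ?exprn_ge0// mulr_ge0//.
by rewrite divr_ge0 ?addr_ge0 ?divr_ge0// ltW.
Qed.

Let s_le y : support_ball x0 b y -> s y <= V.
Proof.
move=> yb.
by rewrite /s /excess /pos ge_max V0 andbT lerBlDr (le_trans (vV yb))// lerDl.
Qed.

Let c_le y : c y <= b.
Proof.
by rewrite /c /pos ge_max b0 andbT lerBlDr lerDl sqdist_ge0.
Qed.

Let rhs_bound_real y : support_ball x0 b y ->
  main y + K9 * rhs y <= step_c1 + step_c2 * f y ^+ 2.
Proof.
move=> yb.
have c0 : 0 <= c y := pos_ge0 _.
have s0 : 0 <= s y := pos_ge0 _.
have cb := c_le y; have sV := s_le yb.
have G16 : enorm (grad eta y) ^+ 2 <= 16 * b ^+ 3.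
  rewrite grad_cutoff_sqr -/(c y) -mulrA ler_wpM2l// (exprSr b 2).
  by rewrite ler_pM ?sqr_ge0 ?sqdist_ge0// ler_pXn2r ?nnegrE.
have s3 : s y ^+ 3 <= V ^+ 3 by rewrite ler_pXn2r ?nnegrE.
have e4 : eta y ^+ 2 <= b ^+ 4.
  rewrite /eta /cutoff -/(c y) -exprM ler_pXn2r ?nnegrE//.
have Gs : enorm (grad eta y) ^+ 2 * s y ^+ 3 <= 16 * b ^+ 3 * V ^+ 3.
  by apply: ler_pM => //; [exact: sqr_ge0|exact: exprn_ge0].
have es : eta y ^+ 2 * s y <= b ^+ 4 * V.
  by apply: ler_pM => //; exact: sqr_ge0.
have h1 : main y <= 4 * n%:R * (16 * b ^+ 3 * V ^+ 3).
  by rewrite /main ler_wpM2l// mulr_ge0.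
have hl0 : 0 <= hi ^+ 2 / lo + lo.
  by rewrite addr_ge0 ?divr_ge0 ?sqr_ge0// ltW.
have n5 : 0 <= (5 + n%:R / 4) / lo.
  by rewrite divr_ge0 ?addr_ge0 ?divr_ge0// ltW.
have h2 : rhs y <= (hi ^+ 2 / lo + lo) * (16 * b ^+ 3 * V ^+ 3) +
    (5 + n%:R / 4) / lo * b ^+ 4 * V ^+ 2 * f y ^+ 2.
  rewrite /rhs /energy_rhs -/eta -/s; apply: lerD.
    by rewrite -mulrA (mulrC (s y ^+ 3)) ler_wpM2l.
  have -> : (5 + n%:R / 4) / lo * f y ^+ 2 * eta y ^+ 2 * V * s y =
     (5 + n%:R / 4) / lo * (f y ^+ 2 * V) * (eta y ^+ 2 * s y) by ring.
  have -> : (5 + n%:R / 4) / lo * b ^+ 4 * V ^+ 2 * f y ^+ 2 =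
     (5 + n%:R / 4) / lo * (f y ^+ 2 * V) * (b ^+ 4 * V) by ring.
  apply: ler_wpM2l es; apply: mulr_ge0 => //; apply: mulr_ge0 => //; exact: sqr_ge0.
have h3 : K9 * rhs y <= K9 * ((hi ^+ 2 / lo + lo) * (16 * b ^+ 3 * V ^+ 3) +
    (5 + n%:R / 4) / lo * b ^+ 4 * V ^+ 2 * f y ^+ 2) by rewrite ler_wpM2l.
apply: le_trans (lerD h1 h3) _.
by rewrite le_eqVlt; apply/orP; left; apply/eqP; rewrite /step_c1 /step_c2; ring.
Qed.

Let mS : measurable (superlevel b l). Proof. exact: measurable_superlevel. Qed.

Let c1_ge0 : 0 <= step_c1.
Proof.
rewrite /step_c1 mulr_ge0//.
  by apply: mulr_ge0; [apply: mulr_ge0 => //; exact: exprn_ge0|exact: exprn_ge0].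
apply: addr_ge0; first by rewrite mulr_ge0.
by apply: mulr_ge0 => //; rewrite addr_ge0 ?divr_ge0 ?sqr_ge0// ltW.
Qed.

Let fpart : T -> \bar R :=
  (fun t => (`|f (row t)| `^ q)%:E) \_ (row @^-1` support_ball x0 b).

Let fpart_ge0 t : (0 <= fpart t)%E.
Proof.
by rewrite /fpart patchE; case: ifP => // _; rewrite lee_fin powR_ge0.
Qed.

Let rhs_bound (t : T) : ((main (row t))%:E + K9%:E * (rhs (row t))%:E <=
  (step_c1 + step_c2 * a ^+ 2)%:E * (\1_(superlevel b l) t)%:E +
  (step_c2 * a `^ (2 - q))%:E * fpart t)%E.
Proof.
rewrite indicE; have [/set_mem[yb ly]|/negP tS] := boolP (t \in superlevel b l).
  have yb' : support_ball x0 b (row t) by exact: ltW.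
  rewrite mule1 /fpart patchE mem_set// -!(EFinM, EFinD) lee_fin.
  apply: le_trans (rhs_bound_real yb') _.
  have h := sqr_le_powR_split a0 q2 (normr_ge0 (f (row t))).
  rewrite real_normK ?num_real// in h.
  have := ler_wpM2l c2_ge0 h; rewrite mulrDr !mulrA; lra.
have [m0 r0] : main (row t) = 0 /\ rhs (row t) = 0.
  have [c0|c0] := eqVneq (c (row t)) 0.
    rewrite /main /rhs /energy_rhs -/eta grad_cutoff_sqr -/(c _) c0.
    rewrite /eta /cutoff -/(c _) c0 !expr0n/=.
    by split; rewrite !(mulr0, mul0r) ?addr0.
  have [s0|s0] := eqVneq (s (row t)) 0.
    rewrite /main /rhs /energy_rhs -/s s0 expr0n/=.
    by split; rewrite !(mulr0, mul0r) ?addr0.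
  exfalso; apply: tS; rewrite inE; split; rewrite ltNge; apply/negP => h.
    by move/eqP: c0; apply; rewrite /c /pos (max_idPr _)// subr_le0.
  by move/eqP: s0; apply; rewrite /s /excess /pos (max_idPr _)// subr_le0.
rewrite m0 r0 !mule0 !add0e mule_ge0// lee_fin.
by rewrite mulr_ge0 ?powR_ge0.
Qed.

(** From below, [eta^2 s^3 >= (b - b')^4 (l' - l)^3] on [superlevel b' l'].
    From above, [integral_z_le] with the integrand supported in
    [superlevel b l], whose measure is less than [L ^ n], and the source split
    at height [a]. *)
Lemma degiorgi_step (b' l' : R) : b' <= b -> l <= l' ->
  (((b - b') ^+ 4 * (l' - l) ^+ 3)%:E * mu (superlevel b' l') <=
   (2 * L ^+ 2 * ((step_c1 + step_c2 * a ^+ 2) * L ^+ n +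
                  step_c2 * a `^ (2 - q) * Fq))%:E)%E.
Proof.
move=> bb' ll'.
have k0 : 0 <= (b - b') ^+ 4 * (l' - l) ^+ 3 by rewrite mulr_ge0// exprn_ge0// subr_ge0.
have mS' : measurable (superlevel b' l') by exact: measurable_superlevel.
have mK := measurable_support_ball x0 b.
have mf := measurable_powR_norm_on q oU KU mK
  (fun y Uy => C1_on_continuous (C1_f oU sf) Uy).
have mfpart : measurable_fun setT fpart by exact/(measurable_restrictT _ mK).
have ifpart : (\int[mu]_t fpart t <= Fq%:E)%E by rewrite -integral_mkcond.
pose C1 := step_c1 + step_c2 * a ^+ 2.
pose C2 := step_c2 * a `^ (2 - q).
have C10 : 0 <= C1 := addr_ge0 c1_ge0 (mulr_ge0 c2_ge0 (sqr_ge0 a)).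
have C20 : 0 <= C2 := mulr_ge0 c2_ge0 (powR_ge0 _ _).
have lower : (((b - b') ^+ 4 * (l' - l) ^+ 3)%:E * mu (superlevel b' l') <= iz)%E.
  have <- : (\int[mu]_t (\1_(superlevel b' l') t)%:E = mu (superlevel b' l'))%E.
    by rewrite integral_indic// setIT.
  have i1 : measurable_fun setT (fun t : T => (\1_(superlevel b' l') t)%:E : \bar R).
    exact: measurableT_comp.
  have j1 (t : T) : (0 <= (\1_(superlevel b' l') t)%:E :> \bar R)%E by rewrite lee_fin.
  rewrite -ge0_integralZl//.
  apply: ge0_le_integral => //.
  - by move=> t _; rewrite mule_ge0 ?lee_fin.
  - exact: measurable_funeM.
  - exact/measurable_EFinP.
  move=> t _; rewrite -EFinM lee_fin indicE.
  have [/set_mem[yb ly]|_] := boolP (t \in superlevel b' l'); last by rewrite mulr0.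
  rewrite mulr1; apply: ler_pM; rewrite ?exprn_ge0 ?subr_ge0//.
    rewrite ler_pXn2r ?nnegrE ?subr_ge0 ?pos_ge0// /c le_max; apply/orP; left.
    by rewrite lerD2l lerN2 ltW.
  rewrite ler_pXn2r ?nnegrE ?subr_ge0 ?pos_ge0// /s /excess le_max; apply/orP; left.
  by rewrite lerD2r ltW.
apply: le_trans lower _; apply: le_trans integral_z_le _.
rewrite (EFinM (2 * L ^+ 2)); apply: lee_wpmul2l; first by rewrite lee_fin mulr_ge0 ?sqr_ge0.
have e2 : measurable_fun setT (fun t => (main (row t))%:E) by exact/measurable_EFinP.
have e3 : measurable_fun setT (fun t => (rhs (row t))%:E) by exact/measurable_EFinP.
have e4 : measurable_fun setT (fun t => K9%:E * (rhs (row t))%:E)%E by exact: measurable_funeM.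
have p2 t : (0 <= (main (row t))%:E)%E by rewrite lee_fin.
have p3 t : (0 <= (rhs (row t))%:E)%E by rewrite lee_fin.
have p4 t : (0 <= K9%:E * (rhs (row t))%:E)%E by rewrite mule_ge0 ?lee_fin.
rewrite -ge0_integralZl//.
rewrite -ge0_integralD//.
have i1 : measurable_fun setT (fun t : T => (\1_(superlevel b l) t)%:E : \bar R).
  exact: measurableT_comp.
have i2 : measurable_fun setT (fun t : T => C1%:E * (\1_(superlevel b l) t)%:E)%E.
  exact: measurable_funeM.
have i3 : measurable_fun setT (fun t => C2%:E * fpart t)%E by exact: measurable_funeM.
have j1 (t : T) : (0 <= (\1_(superlevel b l) t)%:E :> \bar R)%E by rewrite lee_fin.
have j2 t : (0 <= C1%:E * (\1_(superlevel b l) t)%:E)%E by rewrite mule_ge0 ?lee_fin.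
have j3 t : (0 <= C2%:E * fpart t)%E by rewrite mule_ge0 ?lee_fin.
apply: (@le_trans _ _ (\int[mu]_t (C1%:E * (\1_(superlevel b l) t)%:E + C2%:E * fpart t))%E).
  apply: ge0_le_integral => //.
  - by move=> t _; rewrite adde_ge0.
  - exact: emeasurable_funD.
  - exact: emeasurable_funD.
rewrite ge0_integralD// ge0_integralZl//.
rewrite ge0_integralZl//.
rewrite integral_indic// setIT (EFinD (C1 * L ^+ n) (C2 * Fq)); apply: leeD.
  by rewrite (EFinM C1); apply: lee_wpmul2l; [rewrite lee_fin|exact: ltW].
by rewrite (EFinM C2); apply: lee_wpmul2l; rewrite ?lee_fin.
Qed.

End degiorgi_step.

(** * The numerical recursion *)

Section arithmetic.
Context {R : realType}.
Implicit Types (rho h k M La F t sg q K g : R).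

Lemma powR_range (r w e : R) : 1 <= r -> r <= w ->
  (w `^ `|e|)^-1 <= r `^ e /\ r `^ e <= w `^ `|e|.
Proof.
move=> r1 rw; have w1 := le_trans r1 rw.
have r0 : 0 < r by exact: lt_le_trans r1.
have w0 : 0 < w by exact: lt_le_trans w1.
have h1 : r `^ `|e| <= w `^ `|e| by rewrite ge0_ler_powR ?nnegrE// ltW.
split.
  apply: (@le_trans _ _ ((r `^ `|e|)^-1)); first by rewrite lef_pV2 ?posrE ?powR_gt0.
  by rewrite -powRN ler_powR// -lerN2 opprK -normrN ler_norm.
by apply: le_trans h1; rewrite ler_powR// ler_norm.
Qed.

(** In the iteration the measures decay like [(rho tau sg^j)^n].  Step [j] loses
    seven powers of [2^j], four through the radii and three through the levels,
    and gains [(tau sg^j)^g] with [g > 0].  The rate [sg = 2^(-7/g)] makes the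
    gain compensate the loss for all [j], and [tau] absorbs the constant. *)
Lemma decay_rates (n : nat) K g : 0 < K -> 0 < g ->
  exists tau sg : R, [/\ 0 < tau <= 1, 0 < sg < 1 &
    forall j, 2 ^+ 12 * K * (tau * sg ^+ j) `^ g < (2 ^- j) ^+ 7 * sg ^+ n].
Proof.
move=> K0 g0; pose sg : R := 2 `^ (- (7 / g)).
have sg0 : 0 < sg by rewrite powR_gt0.
have sgg : sg `^ g = 2 ^- 7.
  by rewrite -powRrM mulNr divfK ?gt_eqF// powRN powR_mulrn.
have sg1 : sg < 1.
  rewrite /sg powRN invf_lt1 ?powR_gt0//.
  have := @gt0_ltr_powR R (7 / g) ltac:(by rewrite divr_gt0) 1 2.
  by rewrite powR1; apply; rewrite ?nnegrE// ltr1n.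
pose m := Num.min 1 (sg ^+ n / (2 ^+ 13 * K)).
have K13 : 0 < 2 ^+ 13 * K by rewrite mulr_gt0 ?exprn_gt0.
have m0 : 0 < m by rewrite lt_min ltr01 divr_gt0 ?exprn_gt0.
have m1 : m <= 1 by rewrite ge_min lexx.
exists (m `^ g^-1), sg; split.
- rewrite powR_gt0//=; have := @ge0_ler_powR R g^-1 ltac:(by rewrite invr_ge0 ltW) m 1.
  by rewrite powR1; apply; rewrite ?nnegrE// ltW.
- by rewrite sg0.
move=> j; rewrite powRM ?powR_ge0 ?exprn_ge0 ?(ltW sg0)//.
rewrite -powRrM mulVf ?gt_eqF// powRr1 ?(ltW m0)//.
have -> : (sg ^+ j) `^ g = (2 ^- j) ^+ 7.
  rewrite -powR_mulrn ?(ltW sg0)// powRAC sgg powR_mulrn ?invr_ge0 ?exprn_ge0//.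
  by rewrite -!exprVn -!exprM mulnC.
rewrite mulrA (mulrC _ (sg ^+ n)) ltr_pM2r; last by rewrite exprn_gt0// invr_gt0 exprn_gt0.
have : m <= sg ^+ n / (2 ^+ 13 * K) by rewrite ge_min lexx orbT.
rewrite ler_pdivlMr//.
have : 0 < sg ^+ n by rewrite exprn_gt0.
have K12 : 0 < 2 ^+ 12 * K * m by rewrite !mulr_gt0 ?exprn_gt0.
rewrite (_ : m * _ = 2 * (2 ^+ 12 * K * m)); last by rewrite (exprS 2 12); ring.
by move=> h1 h2; apply: lt_le_trans h2; rewrite mulr_natl mulr2n ltrDl.
Qed.

(** The bound of [degiorgi_step], at radii [rho (1 + h) / 2] and
    [rho (1 + h / 2) / 2] and levels [k (2 - h)] and [k (2 - h / 2)], is smaller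
    than the measure wanted at the next step.  The height [a] is such that
    [a^(2 - q) F^q = a^2 L^n], which balances the two parts of the source; then
    [a^2 = F^2 L^(-2n/q)], and with the factor [L^2] this leaves
    [L^(2 - 2n/q)], a positive power of [t].  The hypothesis on [F] says that
    the source has at most the size of the homogeneous part. *)
Lemma degiorgi_arith (n : nat) rho h k M k1 k2 La F t sg q :
  0 < rho <= 1 -> 0 < h <= 1 -> 0 < k -> 1 <= M -> 0 <= k1 -> 0 <= k2 ->
  0 < La -> 0 < F -> F ^+ 2 <= k * La ^+ 2 -> 0 < t <= 1 -> n%:R < q -> 0 < sg ->
  2 ^+ 12 * (16 * M ^+ 3 * k1 + 2 * k2 * M ^+ 2) * t `^ (2 - 2 * (n%:R / q)) <
    h ^+ 7 * sg ^+ n ->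
  let L := rho * t in
  let a := F * L `^ (- (n%:R / q)) in
  let b := (rho * (1 + h) / 2) ^+ 2 in
  let b' := (rho * (1 + h / 2) / 2) ^+ 2 in
  is_true (2 * L ^+ 2 * ((16 * b ^+ 3 * (M * k) ^+ 3 * k1 +
                 (k2 / La ^+ 2 * b ^+ 4 * (M * k) ^+ 2) * a ^+ 2) * L ^+ n +
                (k2 / La ^+ 2 * b ^+ 4 * (M * k) ^+ 2) * a `^ (2 - q) * F `^ q) <
  (b - b') ^+ 4 * (k * h / 2) ^+ 3 * (L * sg) ^+ n).
Proof.
move=> /andP[rho0 rho1] /andP[h0 h1] k0 M1 k10 k20 La0 F0 FL /andP[t0 t1] nq sg0 H L a b b'.
have q0 : 0 < q by apply: le_lt_trans nq.
pose e := n%:R / q; pose g := 2 - 2 * e.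
have e0 : 0 <= e by rewrite divr_ge0// ltW.
have e1 : e < 1 by rewrite ltr_pdivrMr// mul1r.
have g0 : 0 <= g by rewrite /g; lra.
have g2 : g <= 2 by rewrite /g; lra.
have L0 : 0 < L by rewrite mulr_gt0.
have Ln0 : 0 < L ^+ n by rewrite exprn_gt0.
pose X := L `^ (- (2 * e)).
have X0 : 0 < X by rewrite powR_gt0.
have a2 : a ^+ 2 = F ^+ 2 * X.
  rewrite /a exprMn; congr (_ * _).
  by rewrite -powR_mulrn ?powR_ge0// -powRrM /X /e; congr (_ `^ _); ring.
have aq : a `^ (2 - q) * F `^ q = F ^+ 2 * X * L ^+ n.
  rewrite /a powRM ?powR_ge0 ?(ltW F0)// mulrAC -powRD; last by rewrite (gt_eqF F0) implybT.
  rewrite subrK powR_mulrn ?(ltW F0)// -mulrA; congr (_ * _).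
  rewrite -powRrM -(powR_mulrn n (ltW L0)) /X -powRD; last by rewrite (gt_eqF L0) implybT.
  by congr (_ `^ _); rewrite /e; field; rewrite gt_eqF.
have LX : L ^+ 2 * X <= t `^ g.
  have -> : L ^+ 2 * X = L `^ g.
    rewrite -powR_mulrn ?(ltW L0)// /X -powRD//; last by rewrite (gt_eqF L0) implybT.
  by rewrite ge0_ler_powR ?nnegrE ?(ltW L0) ?(ltW t0)// ler_piMl// ltW.
have Lt : L ^+ 2 <= rho ^+ 2 * t `^ g.
  rewrite /L exprMn ler_wpM2l ?sqr_ge0//.
  by rewrite -powR_mulrn ?(ltW t0)// ger_powR ?t0.
have tg0 : 0 < t `^ g by rewrite powR_gt0.
have b0 : 0 <= b by exact: sqr_ge0.
have brho : b <= rho ^+ 2.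
  have i1 : 0 <= rho * (1 + h) / 2 by rewrite divr_ge0// mulr_ge0 ?(ltW rho0)//; lra.
  have i2 : rho * (1 + h) / 2 <= rho by nra.
  by rewrite /b ler_pXn2r ?nnegrE ?(ltW rho0).
have rho2 : 0 <= rho ^+ 2 := sqr_ge0 _.
have b3 : b ^+ 3 <= rho ^+ 6 by rewrite (exprM rho 2 3) ler_pXn2r ?nnegrE.
have b4 : b ^+ 4 <= rho ^+ 8 by rewrite (exprM rho 2 4) ler_pXn2r ?nnegrE.
have M0 : 0 < M by exact: lt_le_trans M1.
have FLa : F ^+ 2 / La ^+ 2 <= k by rewrite ler_pdivrMr ?exprn_gt0.
pose P := M ^+ 3 * k ^+ 3 * k1; pose Q := k2 * M ^+ 2 * k ^+ 2.
have P0 : 0 <= P by rewrite mulr_ge0// mulr_ge0// exprn_ge0// ltW.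
have Q0 : 0 <= Q by rewrite mulr_ge0 ?sqr_ge0// mulr_ge0// sqr_ge0.
have -> : 2 * L ^+ 2 * ((16 * b ^+ 3 * (M * k) ^+ 3 * k1 +
    (k2 / La ^+ 2 * b ^+ 4 * (M * k) ^+ 2) * a ^+ 2) * L ^+ n +
    (k2 / La ^+ 2 * b ^+ 4 * (M * k) ^+ 2) * a `^ (2 - q) * F `^ q) =
  2 * L ^+ n * (16 * P * (b ^+ 3 * L ^+ 2) +
                2 * Q * (b ^+ 4 * ((F ^+ 2 / La ^+ 2) * (L ^+ 2 * X)))).
  rewrite -[X in _ = X]addr0 -[_ * F `^ q]mulrA aq a2 /P /Q.
  by move: (L ^+ n) (La ^+ 2)^-1 => y z; ring.
have bd1 : b ^+ 3 * L ^+ 2 <= rho ^+ 8 * t `^ g.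
  apply: (@le_trans _ _ (rho ^+ 6 * (rho ^+ 2 * t `^ g))).
    by apply: ler_pM => //; [exact: exprn_ge0|exact: sqr_ge0].
  by rewrite mulrA -exprD.
have bd2 : b ^+ 4 * ((F ^+ 2 / La ^+ 2) * (L ^+ 2 * X)) <= rho ^+ 8 * (k * t `^ g).
  apply: ler_pM => //; first exact: exprn_ge0.
    by rewrite mulr_ge0 ?divr_ge0 ?sqr_ge0// mulr_ge0 ?sqr_ge0// ltW.
  apply: ler_pM => //; first by rewrite divr_ge0 ?sqr_ge0.
  by rewrite mulr_ge0 ?sqr_ge0// ltW.
have bd3 : 2 * L ^+ n * (16 * P * (b ^+ 3 * L ^+ 2) +
     2 * Q * (b ^+ 4 * ((F ^+ 2 / La ^+ 2) * (L ^+ 2 * X)))) <=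
     2 * L ^+ n * (16 * P * (rho ^+ 8 * t `^ g) + 2 * Q * (rho ^+ 8 * (k * t `^ g))).
  rewrite ler_wpM2l//; first by rewrite mulr_ge0// ltW.
  by apply: lerD; rewrite ler_wpM2l// mulr_ge0.
apply: le_lt_trans bd3 _.
have bb : rho ^+ 2 * h / 4 <= b - b'.
  rewrite /b /b' -subr_ge0.
  have -> : (rho * (1 + h) / 2) ^+ 2 - (rho * (1 + h / 2) / 2) ^+ 2 - rho ^+ 2 * h / 4 =
    rho ^+ 2 * (h ^+ 2 * 3 / 16) by field.
  exact: (mulr_ge0 rho2 (divr_ge0 (mulr_ge0 (sqr_ge0 h) (ler0n _ 3)) (ler0n _ 16))).
have bq0 : 0 <= rho ^+ 2 * h / 4 := divr_ge0 (mulr_ge0 rho2 (ltW h0)) (ler0n _ 4).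
have bb4 : (rho ^+ 2 * h / 4) ^+ 4 <= (b - b') ^+ 4.
  by rewrite ler_pXn2r// nnegrE// (le_trans bq0).
apply: (@lt_le_trans _ _ ((rho ^+ 2 * h / 4) ^+ 4 * (k * h / 2) ^+ 3 * (L * sg) ^+ n)); last first.
  rewrite ler_wpM2r ?exprn_ge0 ?(ltW (mulr_gt0 L0 sg0))// ler_wpM2r// exprn_ge0//.
  by rewrite divr_ge0// mulr_ge0// ltW.
rewrite (exprMn n L sg).
pose W := 2 * L ^+ n * rho ^+ 8 * k ^+ 3 / 2 ^+ 12.
have W0 : 0 < W by rewrite divr_gt0 ?exprn_gt0// !mulr_gt0 ?exprn_gt0.
have := H; rewrite -(ltr_pM2l W0) -/e -/g.
have -> : W * (2 ^+ 12 * (16 * M ^+ 3 * k1 + 2 * k2 * M ^+ 2) * t `^ g) =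
  2 * L ^+ n * (16 * P * (rho ^+ 8 * t `^ g) + 2 * Q * (rho ^+ 8 * (k * t `^ g))).
  by rewrite /W /P /Q; move: (L ^+ n) (t `^ g) => y z; field.
have -> : W * (h ^+ 7 * sg ^+ n) =
  (rho ^+ 2 * h / 4) ^+ 4 * (k * h / 2) ^+ 3 * (L ^+ n * sg ^+ n).
  by rewrite /W; move: (L ^+ n) (sg ^+ n) => y z; field.
by [].
Qed.

End arithmetic.

(** * Pointwise bound from a small superlevel set *)

Section decay.
Context {R : realType} {n : nat}.
Local Notation T := (n.-tuple (measurableTypeR R)).
Local Notation mu := (@lebesgue_tuple R n).
Local Notation row := (@tuple_to_row R n).

(** If [v > k] at the centre, then by continuity the superlevel set contains a
    cube, and its measure is not [0]. *)
Lemma speed2_le_of_superlevel (u : 'rV[R]_n -> R) (U : set 'rV[R]_n) x0 b :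
  open U -> smooth_on U u -> support_ball x0 b `<=` U -> (0 < n)%N ->
  forall r k (d : nat -> R), 0 < r -> r <= b ->
  (forall j, (mu (superlevel u x0 r k) < (d j ^+ n)%:E)%E) ->
  (forall j, 0 < d j) -> d j @[j --> \oo] --> 0 ->
  speed2 u x0 <= k.
Proof.
move=> oU su KU n0 r k d r0 rb md d0 dlim; rewrite leNgt; apply/negP => kx.
have [c cx] := row_surj x0.
have Ux : U x0 by apply: KU; rewrite /support_ball/= /sqdist subrr dot0r (le_trans (ltW r0)).
have N0 : nbhs x0 [set y | sqdist x0 y < r /\ k < speed2 u y].
  by apply: (nbhs_superlevel oU su Ux) => //; rewrite /sqdist subrr dot0r.
move/nbhs_ballP : N0 => [e /= e0 eO].
have h : tuple_box c e `<=` superlevel u x0 r k.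
  by move=> t /(tuple_box_ball c t e0); rewrite cx => /eO.
have hm : (mu (tuple_box c e) <= mu (superlevel u x0 r k))%E.
  by apply: le_measure; rewrite ?inE//; [exact: measurable_tuple_box|
    exact: (measurable_superlevel oU su KU)].
have e20 : 0 < 2 * e by rewrite mulr_gt0.
have [j /= je] : exists j, d j < 2 * e.
  have : \forall j \near \oo, d j < 2 * e.
    have := dlim; move/cvgrPdist_lt => /(_ _ e20); apply: filterS => j.
    by rewrite sub0r normrN gtr0_norm.
  by case=> N _ /(_ N (leqnn N)); exists N.
have := le_lt_trans hm (md j).
rewrite lebesgue_tuple_box_pow// lte_fin ltNge; apply/negP; rewrite negbK.
by rewrite ler_pXn2r ?nnegrE ?ltW.
Qed.

(** On the relevant part of the ball [|grad u|^2] lies between [k] and a multiple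
    of [k], so the weight of the ellipticity condition is comparable to that of
    [k].  This is where degenerate and singular [p] are treated alike. *)
Lemma powR_weight_range (p M k s : R) : 0 < k -> 1 <= M -> k <= s -> s <= M * k ->
  let La := k `^ (p / 2 - 1) in
  let W := M `^ `|p / 2 - 1| in
  La / W <= s `^ (p / 2 - 1) /\ is_true (s `^ (p / 2 - 1) <= La * W).
Proof.
move=> k0 M1 ks sM La W.
have r1 : 1 <= s / k by rewrite ler_pdivlMr ?mul1r.
have rM : s / k <= M by rewrite ler_pdivrMr.
have -> : s `^ (p / 2 - 1) = La * (s / k) `^ (p / 2 - 1).
  rewrite -powRM ?(ltW k0) ?(le_trans ler01)//.
  by rewrite (mulrC k) divfK ?gt_eqF.
have La0 : 0 < La by rewrite powR_gt0.
have [h1 h2] := powR_range (p / 2 - 1) r1 rM.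
by rewrite !ler_pM2l.
Qed.

Section superlevel_decay.
Variables (p q C1 C2 M : R).
Hypothesis n0 : (0 < n)%N.
Hypothesis qn : n%:R < q.
Hypothesis q2 : 2 <= q.
Hypothesis C10 : 0 < C1.
Hypothesis M1 : 1 <= M.

Let W := (M + 1) `^ `|p / 2 - 1|.
(** The constants [step_c1] and [step_c2] for [lo = C1 La / W],
    [hi = C2 La W] and [V = M k], up to the powers of [b], [M k] and [La]. *)
Definition decay_k1 := 4 * n%:R + 18 * n%:R * ((C2 / C1) ^+ 2 * W ^+ 4 + 1).
Definition decay_k2 := 18 * n%:R * (5 + n%:R / 4) * W ^+ 2 / C1 ^+ 2.
Definition decay_K := 16 * M ^+ 3 * decay_k1 + 2 * decay_k2 * M ^+ 2.

Let W0 : 0 < W. Proof. by rewrite /W powR_gt0// ltr_wpDl// (le_trans ler01). Qed.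

Let k1_gt0 : 0 < decay_k1.
Proof.
apply: ltr_pwDl; first by rewrite mulr_gt0 ?ltr0n.
have h : 0 <= (C2 / C1) ^+ 2 * W ^+ 4.
  exact: (mulr_ge0 (sqr_ge0 _) (exprn_ge0 4 (ltW W0))).
by apply: mulr_ge0; [rewrite mulr_ge0|exact: addr_ge0].
Qed.

Let k2_ge0 : 0 <= decay_k2.
Proof.
have h : 0 <= 18 * n%:R * (5 + n%:R / 4) :> R.
  by apply: mulr_ge0; rewrite ?mulr_ge0 ?addr_ge0 ?divr_ge0.
exact: (divr_ge0 (mulr_ge0 h (sqr_ge0 W)) (sqr_ge0 C1)).
Qed.

Lemma decay_K_gt0 : 0 < decay_K.
Proof.
apply: ltr_pwDl.
  by apply: mulr_gt0 k1_gt0; rewrite mulr_gt0 ?exprn_gt0// (lt_le_trans ltr01).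
by apply: mulr_ge0; [exact: mulr_ge0|exact: sqr_ge0].
Qed.

Variables (U : set 'rV[R]_n) (f E u : 'rV[R]_n -> R) (eps : R).
Hypothesis oU : open U.
Hypothesis su : smooth_on U u.
Hypothesis sE : smooth_on setT E.
Hypothesis sf : smooth_on U f.
Hypothesis equation : forall x, U x ->
  - divergence (fun y => grad E (grad u y)) x = f x.
Hypothesis eps01 : 0 < eps <= 1.
Hypothesis ellE : forall z0 zeta, 1 <= enorm z0 ->
  C1 * (eps ^+ 2 + enorm z0 ^+ 2) `^ (p / 2 - 1) * enorm zeta ^+ 2
  <= mx_form (hessian E z0) zeta zeta.
Hypothesis bndE : forall z0 zeta omega, 1 <= enorm z0 ->
  `|mx_form (hessian E z0) zeta omega|
  <= C2 * (eps ^+ 2 + enorm z0 ^+ 2) `^ (p / 2 - 1) * enorm zeta * enorm omega.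
Hypothesis C20 : 0 < C2.
Variables (x0 : 'rV[R]_n) (rho k F : R).
Hypothesis rho01 : 0 < rho <= 1.
Hypothesis KU : support_ball x0 (rho ^+ 2) `<=` U.
Hypothesis k1 : 1 <= k.
Hypothesis vM : forall y, support_ball x0 (rho ^+ 2) y -> speed2 u y <= M * k.
Hypothesis F0 : 0 < F.
Hypothesis Fk : F ^+ 2 <= k `^ (p - 1).
Hypothesis fF : (\int[mu]_(t in row @^-1` support_ball x0 (rho ^+ 2))
  (`|f (row t)| `^ q)%:E <= (F `^ q)%:E)%E.

Let La := k `^ (p / 2 - 1).

(** [degiorgi_step] with the ellipticity constants of the level [k].  They do
    not depend on the step, because [v] lies between [k] and [M k] on all the
    superlevel sets considered. *)
Lemma superlevel_shrink (h t sg : R) : 0 < h <= 1 -> 0 < t <= 1 -> 0 < sg ->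
  2 ^+ 12 * decay_K * t `^ (2 - 2 * (n%:R / q)) < h ^+ 7 * sg ^+ n ->
  (mu (superlevel u x0 ((rho * (1 + h) / 2) ^+ 2) (k * (2 - h))) < ((rho * t) ^+ n)%:E ->
   mu (superlevel u x0 ((rho * (1 + h / 2) / 2) ^+ 2) (k * (2 - h / 2))) <
     ((rho * t * sg) ^+ n)%:E)%E.
Proof.
move=> h01 t01 sg0 H small.
have [/andP[h0 h1] /andP[t0 t1] /andP[rho0 rho1]] := And3 h01 t01 rho01.
have k0 : 0 < k := lt_le_trans ltr01 k1.
have La0 : 0 < La by rewrite powR_gt0.
have M0 : 0 < M := lt_le_trans ltr01 M1.
have L0 : 0 < rho * t by rewrite mulr_gt0.
pose b := (rho * (1 + h) / 2) ^+ 2; pose b' := (rho * (1 + h / 2) / 2) ^+ 2.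
pose a := F * (rho * t) `^ (- (n%:R / q)).
have a0 : 0 < a by rewrite mulr_gt0 ?powR_gt0.
have i1 : 0 <= rho * (1 + h / 2) / 2 by nra.
have i2 : rho * (1 + h / 2) / 2 <= rho * (1 + h) / 2 by nra.
have i3 : rho * (1 + h) / 2 <= rho by nra.
have bb' : b' <= b by rewrite /b /b' ler_pXn2r ?nnegrE// (le_trans i1).
have brho : b <= rho ^+ 2.
  by rewrite /b ler_pXn2r ?nnegrE// ?(ltW rho0)// (le_trans i1).
have Kb := support_ball_le (x0 := x0) brho.
have b0 : 0 <= b := sqr_ge0 _.
have kl : k <= k * (2 - h) by rewrite ler_peMr ?(ltW k0)//; lra.
have ll' : k * (2 - h) <= k * (2 - h / 2) by rewrite ler_pM2l//; lra.
have range y : support_ball x0 b y -> k * (2 - h) < speed2 u y ->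
    [/\ 1 <= enorm (grad u y),
     La / W <= (eps ^+ 2 + enorm (grad u y) ^+ 2) `^ (p / 2 - 1) &
     (eps ^+ 2 + enorm (grad u y) ^+ 2) `^ (p / 2 - 1) <= La * W].
  move=> yb ky; have kv : k <= speed2 u y by rewrite (le_trans kl)// ltW.
  have [/andP[e0 e1]] := eps01.
  have e2 : eps ^+ 2 <= 1 by rewrite expr_le1// ltW.
  have vMk : speed2 u y <= M * k by apply: vM; exact: Kb.
  have [] := @powR_weight_range p (M + 1) k (eps ^+ 2 + speed2 u y).
  - by [].
  - by rewrite lerDr ltW.
  - by rewrite (le_trans kv)// lerDr sqr_ge0.
  - by rewrite mulrDl mul1r addrC lerD// (le_trans e2).
  move=> w1 w2; split=> //.
  have : 1 <= speed2 u y by rewrite (le_trans k1).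
  by rewrite /speed2 -{1}(expr1n R 2) ler_pXn2r ?nnegrE ?enorm_ge0.
have lo0 : 0 < C1 * (La / W) by rewrite mulr_gt0// divr_gt0.
have step := @degiorgi_step R n U f E u n0 oU su sE sf equation x0 b (k * (2 - h))
  (M * k) (C1 * (La / W)) (C2 * (La * W)) b0 (subset_trans Kb KU)
  (fun y yb => vM (Kb y yb)) (le_trans (ltW k0) kl) (ltW (mulr_gt0 M0 k0)) lo0.
have ell y : support_ball x0 b y -> k * (2 - h) < speed2 u y ->
    forall z, C1 * (La / W) * enorm z ^+ 2 <= mx_form (hessian E (grad u y)) z z.
  move=> yb ky z; have [g1 w1 _] := range y yb ky.
  apply: le_trans (ellE z g1); apply: ler_wpM2r; first exact: sqr_ge0.
  by rewrite ler_pM2l.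
have bnd y : support_ball x0 b y -> k * (2 - h) < speed2 u y ->
    forall z w, `|mx_form (hessian E (grad u y)) z w| <= C2 * (La * W) * enorm z * enorm w.
  move=> yb ky z w; have [g1 _ w1] := range y yb ky.
  apply: le_trans (bndE z w g1) _; apply: ler_wpM2r; first exact: enorm_ge0.
  apply: ler_wpM2r; first exact: enorm_ge0.
  by rewrite ler_pM2l.
have fb : (\int[mu]_(t in row @^-1` support_ball x0 b) (`|f (row t)| `^ q)%:E <=
    (F `^ q)%:E)%E.
  apply: le_trans fF; apply: ge0_subset_integral.
  - exact: measurable_support_ball.
  - exact: measurable_support_ball.
  - apply: (measurable_powR_norm_on q oU KU); first exact: measurable_support_ball.
    by move=> y Uy; exact: C1_on_continuous (C1_f oU sf) Uy.
  - by move=> s _; rewrite lee_fin powR_ge0.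
  - by move=> s; exact: Kb.
have {step} := step ell bnd q a (F `^ q) (rho * t) q2 a0 fb L0 small b' _ bb' ll'.
have -> : @step_c1 R n b (M * k) (C1 * (La / W)) (C2 * (La * W)) =
    16 * b ^+ 3 * (M * k) ^+ 3 * decay_k1.
  rewrite /step_c1 /decay_k1; congr (_ * (_ + _)).
  by field; rewrite !gt_eqF.
have -> : @step_c2 R n b (M * k) (C1 * (La / W)) =
    decay_k2 / La ^+ 2 * b ^+ 4 * (M * k) ^+ 2.
  rewrite /step_c2 /decay_k2; congr (_ * _ * _).
  by field; rewrite !gt_eqF.
have FLa : F ^+ 2 <= k * La ^+ 2.
  rewrite (le_trans Fk)// /La -powR_mulrn ?powR_ge0// -powRrM.
  rewrite -{2}(powRr1 (ltW k0)) -powRD ?(gt_eqF k0) ?implybT//.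
  by rewrite le_eqVlt; apply/orP; left; apply/eqP; congr (_ `^ _); field.
have arith := degiorgi_arith rho01 h01 k0 M1 (ltW k1_gt0) k2_ge0 La0 F0 FLa t01 qn sg0 H.
have -> : k * (2 - h / 2) - k * (2 - h) = k * h / 2 by field.
have cc : 0 < (b - b') ^+ 4 * (k * h / 2) ^+ 3.
  apply: mulr_gt0; last by rewrite exprn_gt0// divr_gt0// mulr_gt0.
  rewrite exprn_gt0// subr_gt0 /b /b' ltr_pXn2r ?nnegrE ?(le_trans i1)//; nra.
move=> hle; rewrite -(@lte_pmul2l _ ((b - b') ^+ 4 * (k * h / 2) ^+ 3)%:E)//.
by apply: le_lt_trans hle _; rewrite -EFinM lte_fin.
Qed.

(** Iterate [superlevel_shrink] with [h = 2^-j] and [t = tau sg^j]; in the limit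
    [{v > 2 k}] is null in the ball of half the radius. *)
Lemma speed2_le_of_small_superlevel (tau sg : R) : 0 < tau <= 1 -> 0 < sg < 1 ->
  (forall j, 2 ^+ 12 * decay_K * (tau * sg ^+ j) `^ (2 - 2 * (n%:R / q)) <
     (2 ^- j) ^+ 7 * sg ^+ n) ->
  (mu (superlevel u x0 (rho ^+ 2) k) < ((rho * tau) ^+ n)%:E)%E ->
  speed2 u x0 <= k * 2.
Proof.
move=> /andP[tau0 tau1] /andP[sg0 sg1] rates small.
have [/andP[rho0 _]] := rho01.
have k0 : 0 < k := lt_le_trans ltr01 k1.
pose h j : R := 2 ^- j.
have h0 j : 0 < h j by rewrite invr_gt0 exprn_gt0.
have h1 j : h j <= 1 by rewrite invf_le1 ?exprn_gt0// exprn_ege1// ler1n.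
have P j : (mu (superlevel u x0 ((rho * (1 + h j) / 2) ^+ 2) (k * (2 - h j))) <
    ((rho * (tau * sg ^+ j)) ^+ n)%:E)%E.
  elim: j => [|j IH].
    have -> : (rho * (1 + h 0%N) / 2) = rho by rewrite /h; field.
    have -> : k * (2 - h 0%N) = k by rewrite /h; field.
    by rewrite mulr1.
  have -> : h j.+1 = h j / 2 by rewrite /h exprSr invfM mulrC.
  have -> : rho * (tau * sg ^+ j.+1) = rho * (tau * sg ^+ j) * sg by rewrite exprSr; ring.
  have tj : 0 < tau * sg ^+ j <= 1.
    have sj0 : 0 < sg ^+ j by rewrite exprn_gt0.
    by rewrite mulr_gt0//= mulr_ile1 ?(ltW tau0) ?(ltW sj0)// exprn_ile1 ?ltW.
  have hj : 0 < h j <= 1 by rewrite h0 h1.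
  exact: (superlevel_shrink hj tj sg0 (rates j) IH).
have r1 : (rho / 2) ^+ 2 <= rho ^+ 2.
  by rewrite ler_pXn2r ?nnegrE ?divr_ge0 ?(ltW rho0)//; lra.
apply: (speed2_le_of_superlevel oU su KU n0 _ r1 (d := fun j => rho * (tau * sg ^+ j))).
- by rewrite exprn_gt0// divr_gt0.
- move=> j; apply: le_lt_trans (P j); apply: le_measure; rewrite ?inE.
  + exact: (measurable_superlevel oU su KU).
  + apply: (measurable_superlevel oU su KU).
    have hj1 := h1 j; have hj0 := h0 j.
    by rewrite ler_pXn2r ?nnegrE ?(ltW rho0)//; nra.
  move=> t [t1 t2]; split.
    apply: lt_le_trans t1 _; have hj0 := h0 j.
    by rewrite ler_pXn2r ?nnegrE//; nra.
  by apply: le_lt_trans t2; rewrite ler_pM2l// lerBlDr lerDl ltW.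
- by move=> j; rewrite !mulr_gt0 ?exprn_gt0.
rewrite -(mulr0 rho); apply: cvgMr; rewrite -(mulr0 tau); apply: cvgMr.
by apply: cvg_expr; rewrite gtr0_norm.
Qed.

End superlevel_decay.
End decay.

(** * The gradient at the centre of a ball *)

Section center.
Context {R : realType} {n : nat}.
Local Notation T := (n.-tuple (measurableTypeR R)).
Local Notation mu := (@lebesgue_tuple R n).
Local Notation row := (@tuple_to_row R n).

Lemma support_ballE (x0 : 'rV[R]_n) (r : R) : 0 <= r ->
  support_ball x0 (r ^+ 2) = closed_eball x0 r.
Proof.
move=> r0; apply/seteqP; split=> y;
  by rewrite /support_ball /closed_eball /= /sqdist -enorm_sqr ler_pXn2r ?nnegrE ?enorm_ge0.
Qed.

Lemma measurable_closed_eball (x0 : 'rV[R]_n) (r : R) : 0 <= r ->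
  measurable (row @^-1` closed_eball x0 r : set T).
Proof. by move=> r0; rewrite -support_ballE//; exact: measurable_support_ball. Qed.

Lemma compact_closed_eball (x0 : 'rV[R]_n) (r : R) : 0 <= r ->
  compact (closed_eball x0 r).
Proof.
move=> r0; rewrite -support_ballE//; apply: bounded_closed_compact.
  exact: bounded_support_ball.
exact: closed_support_ball.
Qed.

Lemma closed_eball_sub (x0 x : 'rV[R]_n) (r s : R) : enorm (x - x0) + s <= r ->
  closed_eball x s `<=` closed_eball x0 r.
Proof.
move=> xs y; rewrite /closed_eball/= => ys; apply: le_trans xs.
rewrite -(subrKA x) addrC; apply: le_trans (ler_enormD _ _) _.
by rewrite lerD2l.
Qed.

Lemma continuous_enorm_grad (U : set 'rV[R]_n) (u : 'rV[R]_n -> R) :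
  open U -> smooth_on U u -> forall x, U x -> {for x, continuous (fun y => enorm (grad u y))}.
Proof.
move=> oU su x Ux.
rewrite (_ : (fun y => enorm (grad u y)) = Num.sqrt \o speed2 u); last first.
  by apply/funext => y /=; rewrite /speed2 sqrtr_sqr ger0_norm// enorm_ge0.
apply: continuous_comp; first exact: (C1_on_continuous (C1_speed2 oU su) Ux).
exact: sqrt_continuous.
Qed.

Lemma continuous_enorm_sub (x0 : 'rV[R]_n) : continuous (fun y : 'rV[R]_n => enorm (y - x0)).
Proof.
move=> x; rewrite (_ : (fun y : 'rV[R]_n => enorm (y - x0)) = Num.sqrt \o sqdist x0); last first.
  by apply/funext => y.
by apply: continuous_comp; [exact: continuous_sqdist|exact: sqrt_continuous].
Qed.

Lemma weighted_maximum (x0 : 'rV[R]_n) (r : R) (g : 'rV[R]_n -> R) : 0 < r ->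
  (forall x, closed_eball x0 r x -> {for x, continuous g}) ->
  exists2 x, closed_eball x0 r x & forall y, closed_eball x0 r y ->
    (r - enorm (y - x0)) ^+ n * g y <= (r - enorm (x - x0)) ^+ n * g x.
Proof.
move=> r0 cg.
have B0 : closed_eball x0 r !=set0.
  by exists x0; rewrite /closed_eball/= subrr /enorm dot0r sqrtr0 ltW.
pose h (y : 'rV[R]_n) := (r - enorm (y - x0)) ^+ n * g y.
have ch : {within closed_eball x0 r, continuous h}.
  apply: continuous_in_subspaceT => x /set_mem xB.
  apply: continuous_mulr; last exact: cg.
  apply: continuous_powr; apply: (@continuousB _ _ _ (fun=> r) (fun y : 'rV[R]_n => enorm (y - x0))).
    exact: cst_continuous.
  exact: continuous_enorm_sub.
have [c] := compact_EVT_max B0 (compact_closed_eball (ltW r0)) ch.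
by rewrite inE => cB cmax; exists c => // y yB; apply: cmax; rewrite inE.
Qed.

Lemma chebyshev_powR (U D : set 'rV[R]_n) (g : 'rV[R]_n -> R) (p c : R) (S : set T) :
  open U -> D `<=` U -> measurable (row @^-1` D : set T) ->
  (forall x, U x -> {for x, continuous g}) -> 0 <= p -> 0 <= c ->
  measurable S -> S `<=` row @^-1` D -> (forall t, S t -> c <= `|g (row t)|) ->
  ((c `^ p)%:E * mu S <= \int[mu]_(t in row @^-1` D) (`|g (row t)| `^ p)%:E)%E.
Proof.
move=> oU DU mD cg p0 c0 mS SD Sc.
have mg := measurable_powR_norm_on p oU DU mD cg.
have pos t : (0 <= (`|g (row t)| `^ p)%:E)%E by rewrite lee_fin powR_ge0.
rewrite -integral_cst//.
apply: (@le_trans _ _ (\int[mu]_(t in S) (`|g (row t)| `^ p)%:E)%E); last first.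
  by apply: ge0_subset_integral => // t _; exact: pos.
apply: ge0_le_integral => //.
- by move=> t _; rewrite lee_fin powR_ge0.
- exact: measurable_funS SD mg.
by move=> t St; rewrite lee_fin ge0_ler_powR ?nnegrE// Sc.
Qed.

Section gradient_at_center.
Variables (p q C1 C2 : R).
Hypothesis n0 : (0 < n)%N.
Hypothesis qn : n%:R < q.
Hypothesis q2 : 2 <= q.
Hypothesis p1 : 1 < p.
Hypothesis C10 : 0 < C1.
Hypothesis C20 : 0 < C2.
Variables (U : set 'rV[R]_n) (f E u : 'rV[R]_n -> R) (eps : R).
Hypothesis oU : open U.
Hypothesis su : smooth_on U u.
Hypothesis sE : smooth_on setT E.
Hypothesis sf : smooth_on U f.
Hypothesis equation : forall x, U x ->
  - divergence (fun y => grad E (grad u y)) x = f x.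
Hypothesis eps01 : 0 < eps <= 1.
Hypothesis ellE : forall z0 zeta, 1 <= enorm z0 ->
  C1 * (eps ^+ 2 + enorm z0 ^+ 2) `^ (p / 2 - 1) * enorm zeta ^+ 2
  <= mx_form (hessian E z0) zeta zeta.
Hypothesis bndE : forall z0 zeta omega, 1 <= enorm z0 ->
  `|mx_form (hessian E z0) zeta omega|
  <= C2 * (eps ^+ 2 + enorm z0 ^+ 2) `^ (p / 2 - 1) * enorm zeta * enorm omega.
Variables (tau sg : R).
Hypothesis tau01 : 0 < tau <= 1.
Hypothesis sg01 : 0 < sg < 1.
Hypothesis rates : forall j,
  2 ^+ 12 * @decay_K R n p C1 C2 (4 ^+ n.+1) * (tau * sg ^+ j) `^ (2 - 2 * (n%:R / q)) <
     (2 ^- j) ^+ 7 * sg ^+ n.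

(** Let [x] maximize [(r - |y - x0|)^n |grad u (y)|] and [d = r - |x - x0|], so
    that [r^n |grad u (x0)| <= d^n |grad u (x)|].  The scale-invariant exponent
    would be [n / p]; the exponent [n] is larger, and the excess power of
    [d <= r] is given back at the end.  Being a natural number, it keeps the
    maximized function continuous for trivial reasons. *)
Lemma gradient_at_center (x0 : 'rV[R]_n) (r F G : R) : 0 < r <= 1 ->
  closed_eball x0 r `<=` U -> 1 <= F -> 0 <= G ->
  (\int[mu]_(t in row @^-1` closed_eball x0 r) (`|f (row t)| `^ q)%:E <= (F `^ q)%:E)%E ->
  (\int[mu]_(t in row @^-1` closed_eball x0 r) (`|enorm (grad u (row t))| `^ p)%:E <=
     (G `^ p)%:E)%E ->
  enorm (grad u x0) <=
    2 * (2 / tau) `^ (n%:R / p) * (F `^ (p - 1)^-1 + r `^ (- (n%:R / p)) * G).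
Proof.
move=> r01 BU F1 G0 fF uG.
have [/andP[r0 r1] /andP[tau0 tau1]] := conj r01 tau01.
have p0 : 0 < p := lt_trans ltr01 p1.
have pm1 : 0 < p - 1 by rewrite subr_gt0.
have F0 : 0 < F := lt_le_trans ltr01 F1.
have np0 : 0 <= n%:R / p by rewrite divr_ge0// ltW.
have np1 : n%:R / p <= n%:R by rewrite ler_pdivrMr// ler_peMr// ltW.
pose A := (2 / tau) `^ (n%:R / p).
have A1 : 1 <= A.
  have t2 : 1 <= 2 / tau by rewrite ler_pdivlMr// mul1r (le_trans tau1)// ler1n.
  by rewrite -(powRr0 (2 / tau)) ler_powR.
have A0 : 0 < A := lt_le_trans ltr01 A1.
have Fp1 : 1 <= F `^ (p - 1)^-1.
  by rewrite -{1}(powRr0 F) ler_powR// invr_ge0 ltW.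
have rG : 0 <= r `^ (- (n%:R / p)) * G by rewrite mulr_ge0 ?powR_ge0.
have cgu y : U y -> {for y, continuous (fun z => enorm (grad u z))}.
  by move=> Uy; exact: (continuous_enorm_grad oU su Uy).
have [x xB xmax] := weighted_maximum r0 (fun y yB => cgu y (BU y yB)).
pose a := enorm (grad u x); pose d := r - enorm (x - x0).
have d0 : 0 <= d by rewrite subr_ge0.
have dr : d <= r by rewrite lerBlDr lerDl enorm_ge0.
have a0 : 0 <= a := enorm_ge0 _.
have cmax : r ^+ n * enorm (grad u x0) <= d ^+ n * a.
  have x0B : closed_eball x0 r x0.
    by rewrite /closed_eball/= subrr /enorm dot0r sqrtr0 ltW.
  have := xmax _ x0B.
  by rewrite subrr {1}/enorm dot0r sqrtr0 subr0.
have rn0 : 0 < r ^+ n by rewrite exprn_gt0.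
have dn0 : 0 <= d ^+ n by rewrite exprn_ge0.
have dnr : d ^+ n <= r ^+ n by rewrite ler_pXn2r ?nnegrE// ltW.
have ga : enorm (grad u x0) <= a.
  rewrite -(ler_pM2l rn0); apply: le_trans cmax _; exact: ler_wpM2r.
(* The two cases in which [|grad u|] is controlled directly at [x]. *)
have easy B : a <= 2 * B -> B <= F `^ (p - 1)^-1 -> enorm (grad u x0) <=
    2 * A * (F `^ (p - 1)^-1 + r `^ (- (n%:R / p)) * G).
  move=> aB BF; apply: le_trans ga _; apply: le_trans aB _.
  rewrite -mulrA ler_pM2l//; apply: le_trans BF _.
  apply: (@le_trans _ _ (A * F `^ (p - 1)^-1)).
    by rewrite ler_peMl ?powR_ge0.
  by rewrite ler_pM2l// lerDl.
have [a2|a2] := leP a 2; first by apply: easy (1) _ _ => //; rewrite mulr1.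
have [aF|aF] := leP a (2 * F `^ (p - 1)^-1); first exact: (easy _ aF).
have a_gt0 : 0 < a by rewrite (lt_trans _ a2).
have [d_eq0|d_neq0] := eqVneq d 0.
  apply: (@le_trans _ _ 0); last first.
    by rewrite mulr_ge0 ?addr_ge0 ?powR_ge0// mulr_ge0 ?powR_ge0.
  by rewrite -(ler_pM2l rn0) (le_trans cmax)// d_eq0 expr0n gtn_eqF//= mul0r mulr0.
have d_gt0 : 0 < d by rewrite lt_neqAle eq_sym d_neq0.
pose rho := d / 2; pose k := (a / 2) ^+ 2.
have rho0 : 0 < rho by rewrite divr_gt0.
have rho01 : 0 < rho <= 1.
  by rewrite rho0/= ler_pdivrMr// mul1r (le_trans dr)// (le_trans r1)// ler1n.
have xr : closed_eball x rho `<=` closed_eball x0 r.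
  apply: closed_eball_sub; rewrite -lerBrDl -/d /rho ler_pdivrMr// ler_peMr//.
  by rewrite ler1n.
have xU : support_ball x (rho ^+ 2) `<=` U.
  by rewrite (support_ballE _ (ltW rho0)); exact: subset_trans xr BU.
have a21 : 1 <= a / 2 by rewrite ler_pdivlMr// mul1r ltW.
have k1 : 1 <= k by exact: exprn_ege1.
have vM y : support_ball x (rho ^+ 2) y -> speed2 u y <= 4 ^+ n.+1 * k.
  rewrite (support_ballE _ (ltW rho0)) => yx.
  have h1 : rho ^+ n * enorm (grad u y) <= d ^+ n * a.
    apply: le_trans (xmax y (xr y yx)); apply: ler_wpM2r; first exact: enorm_ge0.
    have h2 : rho <= r - enorm (y - x0).
      rewrite lerBrDr addrC -lerBrDr.
      have -> : r - rho = enorm (x - x0) + rho by rewrite /rho /d; field.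
      rewrite -(subrKA x) addrC; apply: le_trans (ler_enormD _ _) _.
      by rewrite lerD2l.
    by rewrite ler_pXn2r ?nnegrE ?(ltW rho0)// (le_trans (ltW rho0)).
  have h3 : enorm (grad u y) <= 2 ^+ n * a.
    rewrite -(ler_pM2l (exprn_gt0 n rho0)); apply: le_trans h1 _.
    by rewrite mulrA -(exprMn n rho 2) divfK.
  have -> : 4 ^+ n.+1 * k = (2 ^+ n * a) ^+ 2.
    have e4 : 2 ^+ 2 = 4 :> R by ring.
    by rewrite /k exprS (exprMn 2 (2 ^+ n)) exprAC e4; field.
  by rewrite /speed2 ler_pXn2r ?nnegrE ?enorm_ge0// mulr_ge0 ?exprn_ge0.
have Fk : F ^+ 2 <= k `^ (p - 1).
  have h1 : F `^ (p - 1)^-1 <= a / 2 by rewrite ler_pdivlMr// mulrC ltW.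
  have a20 : 0 <= a / 2 := le_trans ler01 a21.
  have h2 : F <= (a / 2) `^ (p - 1).
    have <- : (F `^ (p - 1)^-1) `^ (p - 1) = F.
      by rewrite -powRrM mulVf ?gt_eqF// powRr1// ltW.
    by rewrite ge0_ler_powR ?nnegrE ?powR_ge0// ltW.
  rewrite /k -(powR_mulrn 2 a20) powRAC powR_mulrn ?powR_ge0//.
  by rewrite ler_pXn2r ?nnegrE ?powR_ge0// ltW.
have rMn : 1 <= 4 ^+ n.+1 :> R by rewrite exprn_ege1// ler1n.
have fF' : (\int[mu]_(t in row @^-1` support_ball x (rho ^+ 2))
    (`|f (row t)| `^ q)%:E <= (F `^ q)%:E)%E.
  apply: le_trans fF; apply: ge0_subset_integral.
  - exact: measurable_support_ball.
  - exact: measurable_closed_eball (ltW r0).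
  - apply: (measurable_powR_norm_on q oU BU); first exact: measurable_closed_eball (ltW r0).
    by move=> y Uy; exact: C1_on_continuous (C1_f oU sf) Uy.
  - by move=> s _; rewrite lee_fin powR_ge0.
  - by rewrite (support_ballE _ (ltW rho0)) => s; exact: xr.
pose S := superlevel u x (rho ^+ 2) k.
have mS : measurable S by exact: (measurable_superlevel oU su xU).
have large : (((rho * tau) ^+ n)%:E <= mu S)%E.
  rewrite leNgt; apply/negP => small.
  have := speed2_le_of_small_superlevel n0 qn q2 C10 rMn oU su sE sf equation eps01
    ellE bndE C20 rho01 xU k1 vM F0 Fk fF' tau01 sg01 rates small.
  rewrite /speed2 -/a /k; apply/negP; rewrite -ltNge expr_div_n.
  by have a2_gt0 : 0 < a ^+ 2 by [rewrite exprn_gt0]; lra.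
have cheb : ((a / 2) `^ p * (rho * tau) ^+ n <= G `^ p).
  rewrite -lee_fin EFinM; apply: le_trans uG.
  apply: (@le_trans _ _ (((a / 2) `^ p)%:E * mu S)%E).
    by apply: lee_wpmul2l large; rewrite lee_fin powR_ge0.
  have mB := measurable_closed_eball x0 (ltW r0).
  apply: (@chebyshev_powR U (closed_eball x0 r) (fun y => enorm (grad u y)) p (a / 2) S
    oU BU mB cgu (ltW p0) _ mS).
  - exact: le_trans ler01 a21.
  - move=> t [t1 _]; apply: xr; rewrite -(support_ballE _ (ltW rho0)); exact: ltW.
  move=> t [_ t2]; rewrite (ger0_norm (enorm_ge0 _)).
  have := ltW t2; rewrite /k /speed2 ler_pXn2r ?nnegrE ?enorm_ge0//.
  exact: le_trans ler01 a21.
have rt0 : 0 < rho * tau by rewrite mulr_gt0.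
(* Chebyshev's inequality raised to the power [1 / p]. *)
have root : a / 2 * (rho * tau) `^ (n%:R / p) <= G.
  have a20 : 0 <= a / 2 := le_trans ler01 a21.
  have -> : a / 2 * (rho * tau) `^ (n%:R / p) = ((a / 2) `^ p * (rho * tau) ^+ n) `^ p^-1.
    rewrite (powRM _ (powR_ge0 _ _) (exprn_ge0 n (ltW rt0))).
    rewrite -(powRrM (a / 2)) divff ?gt_eqF// powRr1//; congr (_ * _).
    by rewrite -powR_mulrn ?(ltW rt0)// -powRrM.
  have -> : G = (G `^ p) `^ p^-1 by rewrite -powRrM divff ?gt_eqF// powRr1.
  rewrite ge0_ler_powR ?nnegrE ?powR_ge0 ?invr_ge0 ?(ltW p0)//.
  by rewrite mulr_ge0 ?powR_ge0 ?exprn_ge0 ?(ltW rt0).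
have scale : (rho * tau) `^ (n%:R / p) * A = d `^ (n%:R / p).
  rewrite /A -powRM ?(ltW rt0) ?divr_ge0 ?(ltW tau0)//.
  by congr (_ `^ _); rewrite /rho; field; rewrite gt_eqF.
have aG : d `^ (n%:R / p) * a <= 2 * A * G.
  rewrite -scale; have := ler_wpM2l (mulr_ge0 (ler0n R 2) (ltW A0)) root.
  by apply: le_trans; rewrite le_eqVlt; apply/orP; left; apply/eqP; field.
have split_pow s : 0 < s -> s ^+ n = s `^ (n%:R - n%:R / p) * s `^ (n%:R / p).
  by move=> s0; rewrite -powRD ?(gt_eqF s0) ?implybT// subrK powR_mulrn// ltW.
have key : r ^+ n * enorm (grad u x0) <= r `^ (n%:R - n%:R / p) * (2 * A * G).
  apply: le_trans cmax _; rewrite (split_pow d d_gt0) -mulrA.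
  apply: ler_pM => //; first exact: powR_ge0.
    by rewrite mulr_ge0 ?powR_ge0.
  by rewrite ge0_ler_powR ?nnegrE ?subr_ge0 ?(ltW r0).
have last_step : enorm (grad u x0) <= 2 * A * (r `^ (- (n%:R / p)) * G).
  rewrite -(ler_pM2l rn0); apply: le_trans key _.
  rewrite le_eqVlt; apply/orP; left; apply/eqP.
  rewrite powRD ?(gt_eqF r0) ?implybT// powR_mulrn ?(ltW r0)//.
  by ring.
apply: le_trans last_step _; rewrite ler_pM2l ?mulr_gt0// lerDr.
by rewrite (le_trans ler01).
Qed.

End gradient_at_center.
End center.

(** * The norms, and the final estimate *)

Section norms.
Context {R : realType} {n : nat}.
Local Notation T := (n.-tuple (measurableTypeR R)).
Local Notation mu := (@lebesgue_tuple R n).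
Local Notation row := (@tuple_to_row R n).

Lemma poweR_Lnorm_on (B : set 'rV[R]_n) (g : 'rV[R]_n -> R) (p : R) : 0 < p ->
  (Lnorm_on B p%:E g `^ p = \int[mu]_(t in row @^-1` B) (`|g (row t)| `^ p)%:E)%E.
Proof.
move=> p0; rewrite /Lnorm_on (poweR_Lnorm _ _ (lt0r_neq0 p0)) [RHS]integral_mkcond.
apply: eq_integral => t _; rewrite /= !patchE.
have -> : (t \in row @^-1` B) = (row t \in B) by apply/idP/idP; rewrite !inE.
by case: ifP => _ //; rewrite normr0 powR0// gt_eqF.
Qed.

Lemma integral_powR_Lnorm_on (B : set 'rV[R]_n) (g : 'rV[R]_n -> R) (p : R) : 0 < p ->
  (Lnorm_on B p%:E g < +oo)%E ->
  (\int[mu]_(t in row @^-1` B) (`|g (row t)| `^ p)%:E =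
     (fine (Lnorm_on B p%:E g) `^ p)%:E)%E.
Proof.
move=> p0 fin; rewrite -poweR_Lnorm_on// -poweR_EFin fineK// ge0_fin_numE//.
exact: Lnorm_ge0.
Qed.

Lemma lebesgue_setT_gt0 : (0 < mu [set: T])%E.
Proof.
have [c _] := @row_surj R n 0.
apply: (@lt_le_trans _ _ (mu (tuple_box c 1))).
  by rewrite lebesgue_tuple_box_pow// lte_fin exprn_gt0// mulr1.
by apply: le_measure; rewrite ?inE//; exact: measurable_tuple_box.
Qed.

Lemma lebesgue_closed_eball_le (x0 : 'rV[R]_n) (r : R) : 0 <= r < 2 ->
  (mu (row @^-1` closed_eball x0 r) <= (4 ^+ n)%:E)%E.
Proof.
move=> /andP[r0 r2]; have [c cx] := row_surj x0.
have -> : (4 ^+ n)%:E = mu (tuple_box c 2).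
  by rewrite lebesgue_tuple_box_pow// -natrM.
apply: le_measure; rewrite ?inE.
- exact: measurable_closed_eball.
- exact: measurable_tuple_box.
move=> t; rewrite /closed_eball/= -cx => tB i; apply: le_lt_trans r2.
apply: le_trans tB; rewrite distrC.
have := coord_le_enorm (row t - row c) i.
by rewrite !mxE.
Qed.

(** Reduction to a finite exponent.  For [q = oo] take [q' = 2 n], which is
    greater than [n] and at least [2]: the ball lies in a cube of side [4], of
    measure [4^n = 2^(q')], whence the factor [2] in front of the norm. *)
Lemma Lnorm_on_finite_exponent (q : \bar R) : (2 <= n)%N -> (n%:R%:E < q)%E ->
  exists q' : R, [/\ n%:R < q', 2 <= q' &
    forall (U : set 'rV[R]_n) (g : 'rV[R]_n -> R) (x0 : 'rV[R]_n) (r : R),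
    open U -> (forall x, U x -> {for x, continuous g}) ->
    0 <= r < 2 -> closed_eball x0 r `<=` U ->
    (Lnorm_on (closed_eball x0 r) q g < +oo)%E ->
    (\int[mu]_(t in row @^-1` closed_eball x0 r) (`|g (row t)| `^ q')%:E <=
      ((2 * fine (Lnorm_on (closed_eball x0 r) q g)) `^ q')%:E)%E].
Proof.
move=> n2; have n2R : 2 <= n%:R :> R by rewrite (ler_nat R 2).
case: q => [q||]//.
  rewrite lte_fin => qn; exists q; split=> //; first by rewrite (le_trans n2R)// ltW.
  move=> U g x0 r oU cg r01 BU fin.
  have q0 : 0 < q by apply: le_lt_trans qn.
  rewrite integral_powR_Lnorm_on// lee_fin.
  have N0 : 0 <= fine (Lnorm_on (closed_eball x0 r) q%:E g).
    by apply: fine_ge0; exact: Lnorm_ge0.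
  by rewrite ge0_ler_powR ?nnegrE ?(ltW q0) ?mulr_ge0// ler_peMl// ler1n.
move=> _; exists (2 * n%:R); split; first by lra.
  by lra.
move=> U g x0 r oU cg r01 BU fin.
have /andP[r0 _] := r01.
set N := fine _.
have N0 : 0 <= N by apply: fine_ge0; exact: Lnorm_ge0.
have mB := measurable_closed_eball x0 r0.
have bound : {ae mu, forall t : T, (row @^-1` closed_eball x0 r) t ->
    ((`|g (row t)| `^ (2 * n%:R))%:E <= (N `^ (2 * n%:R))%:E)%E}.
  have := ess_sup_ge mu (abse \o (EFin \o (g \_ (closed_eball x0 r)) \o row)).
  apply: filterS => t ht Bt; rewrite lee_fin ge0_ler_powR ?nnegrE ?mulr_ge0//.
  rewrite -lee_fin /N fineK; last first.
    by rewrite ge0_fin_numE//; exact: Lnorm_ge0.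
  rewrite /Lnorm_on unlock lebesgue_setT_gt0; apply: le_trans ht.
  by rewrite /= patchE mem_set.
apply: (@le_trans _ _ (\int[mu]_(t in row @^-1` closed_eball x0 r)
    (cst (N `^ (2 * n%:R))%:E t))%E).
  apply: ae_ge0_le_integral => //.
  - exact: (measurable_powR_norm_on _ oU BU mB cg).
  - by move=> t _; rewrite lee_fin powR_ge0.
rewrite (integral_cst mu mB) (powRM _ (ler0n R 2) N0) (EFinM (2 `^ _)) muleC.
apply: lee_wpmul2r; first by rewrite lee_fin powR_ge0.
apply: le_trans (lebesgue_closed_eball_le x0 r01) _.
by rewrite lee_fin powRrM powR_mulrn ?powR_ge0// powR_mulrn// expr2 -natrM.
Qed.

End norms.

(** Both cases of the theorem at once: the power of [1 - theta] may be any
    number at least [n / p], because [1 - theta < 1].  If one of the norms is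
    infinite, so is the right-hand side. *)
Lemma interior_gradient_estimate (R : realType) (n : nat) (p : R) (q : \bar R)
    (C1 C2 al : R) : (2 <= n)%N -> 1 < p -> (n%:R%:E < q)%E -> 0 < C1 -> C1 <= C2 ->
  n%:R / p <= al ->
  exists C : R, forall (U : set 'rV[R]_n) (f : 'rV[R]_n -> R) (E u : R -> 'rV[R]_n -> R),
    open U -> smooth_on U f -> regularized_energies p C1 C2 E ->
    classical_solutions U f E u ->
    forall (eps : R) (x0 : 'rV[R]_n) (rad theta : R),
      0 < eps <= 1 -> 0 < rad <= 1 -> 0 < theta < 1 ->
      closed_eball x0 rad `<=` U ->
      (sup_grad (closed_eball x0 (theta * rad)) (u eps)
       <= (C / (1 - theta) `^ al)%:E *
          (1 + Lnorm_on (closed_eball x0 rad) q f `^ (p - 1)^-1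
             + (rad `^ (- (n%:R / p)))%:E *
               Lnorm_on (closed_eball x0 rad) p%:E
                 (fun x => enorm (grad (u eps) x))))%E.
Proof.
move=> n2 p1 qn C10 C12 npal.
have n0 : (0 < n)%N := ltnW n2.
have C20 : 0 < C2 := lt_le_trans C10 C12.
have p0 : 0 < p := lt_trans ltr01 p1.
have s0 : 0 < (p - 1)^-1 by rewrite invr_gt0 subr_gt0.
have [q' [qn' q2' reduce]] := Lnorm_on_finite_exponent n2 qn.
have q0' : 0 < q' by rewrite (lt_le_trans _ q2').
have g0 : 0 < 2 - 2 * (n%:R / q').
  by rewrite subr_gt0 gtr_pMr// ltr_pdivrMr// mul1r.
have M1 : 1 <= 4 ^+ n.+1 :> R by rewrite exprn_ege1// ler1n.
have [tau [sg [tau01 sg01 rates]]] :=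
  decay_rates n (decay_K_gt0 p C1 C2 n0 M1) g0.
have /andP[tau0 _] := tau01.
pose K := 2 * (2 / tau) `^ (n%:R / p).
have K0 : 0 < K by rewrite mulr_gt0 ?powR_gt0 ?divr_gt0.
pose C := K * 2 `^ (p - 1)^-1.
have C0 : 0 < C by rewrite mulr_gt0 ?powR_gt0.
exists C => U f E u oU sf hE hu eps x0 rad theta eps01 rad01 /andP[th0 th1] BU.
have [sE _ ellE bndE] := hE eps eps01.
have [su equation] := hu eps eps01.
have /andP[rad0 rad1] := rad01.
have th' : 0 < 1 - theta by rewrite subr_gt0.
have Cth : 0 < C / (1 - theta) `^ al by rewrite divr_gt0 ?powR_gt0.
set Nf := Lnorm_on _ q f; set Nu := Lnorm_on _ p%:E _.
have Nf0 : (0 <= Nf)%E := Lnorm_ge0 _ _ _.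
have Nu0 : (0 <= Nu)%E := Lnorm_ge0 _ _ _.
have [Nfoo|] := eqVneq Nf +oo%E.
  rewrite Nfoo poweRyr ?gt_eqF// addeC addeA.
  have h : (0 <= (rad `^ (- (n%:R / p)))%:E * Nu + 1)%E.
    by apply: adde_ge0 => //; rewrite mule_ge0 ?lee_fin ?powR_ge0.
  by rewrite addey ?gt0_muley ?leey ?lte_fin// gt_eqF// (lt_le_trans _ h)// ltNy0.
rewrite -ltey => Nflt.
have [Nuoo|] := eqVneq Nu +oo%E.
  have h : (0 <= 1 + Nf `^ (p - 1)^-1)%E by apply: adde_ge0 => //; exact: poweR_ge0.
  rewrite Nuoo gt0_muley ?lte_fin ?powR_gt0// addey; last by rewrite gt_eqF// (lt_le_trans _ h)// ltNy0.
  by rewrite gt0_muley ?leey ?lte_fin.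
rewrite -ltey => Nult.
have NfE : Nf = (fine Nf)%:E by rewrite fineK// ge0_fin_numE.
have NuE : Nu = (fine Nu)%:E by rewrite fineK// ge0_fin_numE.
have fNf0 : 0 <= fine Nf by exact: fine_ge0.
have fNu0 : 0 <= fine Nu by exact: fine_ge0.
apply: ge_ereal_sup => _ [x xB <-].
pose d := (1 - theta) * rad.
have d0 : 0 < d by rewrite mulr_gt0.
have d01 : 0 < d <= 1.
  by rewrite d0/= mulr_ile1 ?(ltW th') ?(ltW rad0)// lerBlDr lerDl ltW.
have xd : closed_eball x d `<=` closed_eball x0 rad.
  apply: closed_eball_sub; apply: (@le_trans _ _ (theta * rad + d)).
    by rewrite lerD2r.
  by rewrite -mulrDl addrC subrK mul1r.
pose F := Num.max 1 (2 * fine Nf).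
have F1 : 1 <= F by rewrite le_max lexx.
have mono (g : 'rV[R]_n -> R) (s : R) : (forall y, U y -> {for y, continuous g}) ->
    (\int[@lebesgue_tuple R n]_(t in @tuple_to_row R n @^-1` closed_eball x d)
       (`|g (tuple_to_row t)| `^ s)%:E <=
     \int[@lebesgue_tuple R n]_(t in @tuple_to_row R n @^-1` closed_eball x0 rad)
       (`|g (tuple_to_row t)| `^ s)%:E)%E.
  move=> cg; apply: ge0_subset_integral.
  - exact: measurable_closed_eball (ltW d0).
  - exact: measurable_closed_eball (ltW rad0).
  - exact: (measurable_powR_norm_on s oU BU (measurable_closed_eball x0 (ltW rad0)) cg).
  - by move=> t _; rewrite lee_fin powR_ge0.
  - by move=> t; exact: xd.
have cf y (Uy : U y) := C1_on_continuous (C1_f oU sf) Uy.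
have cu := continuous_enorm_grad oU su.
have rad02 : 0 <= rad < 2 by rewrite (ltW rad0)/= (le_lt_trans rad1)// ltr1n.
have fF : (\int[@lebesgue_tuple R n]_(t in @tuple_to_row R n @^-1` closed_eball x d)
       (`|f (tuple_to_row t)| `^ q')%:E <= (F `^ q')%:E)%E.
  apply: le_trans (mono f q' cf) _; apply: le_trans (reduce U f x0 rad oU cf rad02 BU Nflt) _.
  rewrite lee_fin ge0_ler_powR ?nnegrE ?(ltW q0') ?mulr_ge0// ?(le_trans ler01 F1)//.
  by rewrite le_max lexx orbT.
have uG : (\int[@lebesgue_tuple R n]_(t in @tuple_to_row R n @^-1` closed_eball x d)
       (`|enorm (grad (u eps) (tuple_to_row t))| `^ p)%:E <= (fine Nu `^ p)%:E)%E.
  apply: le_trans (mono _ p cu) _.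
  by rewrite (integral_powR_Lnorm_on p0 Nult).
have center := gradient_at_center n0 qn' q2' p1 C10 C20 oU su sE sf equation eps01
  ellE bndE tau01 sg01 rates d01 (subset_trans xd BU) F1 fNu0 fF uG.
rewrite NfE NuE poweR_EFin lee_fin.
apply: le_trans center _; rewrite -/K.
have th1' : 1 - theta <= 1 by rewrite lerBlDr lerDl ltW.
have Fs : F `^ (p - 1)^-1 <= 2 `^ (p - 1)^-1 * (1 + fine Nf `^ (p - 1)^-1).
  rewrite /F; have [h|h] := leP 1 (2 * fine Nf).
    by rewrite powRM// ler_wpM2l ?powR_ge0// lerDr.
  rewrite powR1 mulrDr mulr1 ler_wpDr ?mulr_ge0 ?powR_ge0//.
  by rewrite -[leLHS](powRr0 2) ler_powR ?ler1n// ltW.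
have two_s : 1 <= 2 `^ (p - 1)^-1 :> R.
  by rewrite -[leLHS](powRr0 2) ler_powR ?ler1n// ltW.
pose Th := ((1 - theta) `^ al)^-1.
have Th1 : 1 <= Th.
  rewrite /Th invf_ge1 ?powR_gt0// -[leRHS](powRr0 (1 - theta)) ger_powR ?th' ?th1'//.
  by rewrite (le_trans _ npal)// divr_ge0// ltW.
have dth : d `^ (- (n%:R / p)) <= Th * rad `^ (- (n%:R / p)).
  rewrite /d powRM ?(ltW th') ?(ltW rad0)// ler_wpM2r ?powR_ge0//.
  by rewrite powRN lef_pV2 ?posrE ?powR_gt0// ger_powR ?th'.
apply: (@le_trans _ _ (K * (Th * (2 `^ (p - 1)^-1 * (1 + fine Nf `^ (p - 1)^-1)) +
    Th * (2 `^ (p - 1)^-1 * (rad `^ (- (n%:R / p)) * fine Nu))))).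
  rewrite ler_pM2l//; apply: lerD.
    apply: le_trans Fs _; rewrite ler_peMl// mulr_ge0 ?addr_ge0 ?powR_ge0//.
  apply: (@le_trans _ _ (Th * (rad `^ (- (n%:R / p)) * fine Nu))).
    by rewrite mulrA ler_wpM2r.
  rewrite ler_wpM2l ?(le_trans ler01 Th1)// ler_peMl// mulr_ge0 ?powR_ge0//.
rewrite le_eqVlt; apply/orP; left; apply/eqP; rewrite /C /Th.
by move: (_^-1) => z; ring.
Qed.
Theorem proposition2 (R : realType) (n : nat) (p : R) (q : \bar R) (C1 C2 : R)
    (n_ge2 : (2 <= n)%N) (p_gt1 : 1 < p) (q_gtn : (n%:R%:E < q)%E)
    (C1_gt0 : 0 < C1) (C1_le_C2 : C1 <= C2) :
  ((3 <= n)%N ->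
    exists C : R,
      forall (Omega U : set 'rV[R]_n) (f : 'rV[R]_n -> R)
             (E u : R -> 'rV[R]_n -> R),
        bounded_lipschitz_domain Omega ->
        bounded_lipschitz_domain U ->
        compactly_contained U Omega ->
        smooth_on Omega f ->
        regularized_energies p C1 C2 E ->
        classical_solutions U f E u ->
        forall (eps : R) (x0 : 'rV[R]_n) (rad theta : R),
          0 < eps <= 1 -> 0 < rad <= 1 -> 0 < theta < 1 ->
          closed_eball x0 rad `<=` U ->
          (sup_grad (closed_eball x0 (theta * rad)) (u eps)
           <= (C / (1 - theta) `^ (n%:R / p))%:E *
              (1 + Lnorm_on (closed_eball x0 rad) q f `^ (p - 1)^-1
                 + (rad `^ (- (n%:R / p)))%:E *
                   Lnorm_on (closed_eball x0 rad) p%:E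
                     (fun x => enorm (grad (u eps) x))))%E)
  /\
  (n = 2%N ->
    forall chi : R, 1 < chi ->
    exists C : R,
      forall (Omega U : set 'rV[R]_n) (f : 'rV[R]_n -> R)
             (E u : R -> 'rV[R]_n -> R),
        bounded_lipschitz_domain Omega ->
        bounded_lipschitz_domain U ->
        compactly_contained U Omega ->
        smooth_on Omega f ->
        regularized_energies p C1 C2 E ->
        classical_solutions U f E u ->
        forall (eps : R) (x0 : 'rV[R]_n) (rad theta : R),
          0 < eps <= 1 -> 0 < rad <= 1 -> 0 < theta < 1 ->
          closed_eball x0 rad `<=` U ->
          (sup_grad (closed_eball x0 (theta * rad)) (u eps)
           <= (C / (1 - theta) `^ (2 * chi / (p * (chi - 1))))%:E *
              (1 + Lnorm_on (closed_eball x0 rad) q f `^ (p - 1)^-1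
                 + (rad `^ (- (2 / p)))%:E *
                   Lnorm_on (closed_eball x0 rad) p%:E
                     (fun x => enorm (grad (u eps) x))))%E).
Proof.
split=> [_|n2 chi chi1].
  have [C HC] := interior_gradient_estimate n_ge2 p_gt1 q_gtn C1_gt0 C1_le_C2 (lexx _).
  exists C => Omega U f E u _ [[_ oU _] _ _] [_ UO] sf.
  exact: (HC U f E u oU (smooth_on_sub (subset_trans (@subset_closure _ U) UO) sf)).
have al_ge : n%:R / p <= 2 * chi / (p * (chi - 1)).
  rewrite n2 -mulf_div ler_peMr ?divr_ge0 ?(ltW (lt_trans ltr01 p_gt1))//.
  by rewrite ler_pdivlMr ?subr_gt0// mul1r lerBlDr lerDl.
have two_n : 2 / p = n%:R / p :> R by rewrite n2.
have [C HC] := interior_gradient_estimate n_ge2 p_gt1 q_gtn C1_gt0 C1_le_C2 al_ge.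
exists C => Omega U f E u _ [[_ oU _] _ _] [_ UO] sf; rewrite two_n.
exact: (HC U f E u oU (smooth_on_sub (subset_trans (@subset_closure _ U) UO) sf)).
Qed.
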